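(* Let $p_1, p_2, \alpha_1, \alpha_2$ be non-zero complex constants with $\alpha_1\neq\alpha_2$, let $\beta\in\mathbb{C}$ be any constant, let $a(z)$ be a non-zero polynomial and let $k\geq 0$ be an integer. Suppose that $f$ is a transcendental entire function of finite order which is a solution of the differential-difference equation $$f^2(z)+a(z)f^{(k)}(z+\beta)=p_1e^{\alpha_1 z}+p_2e^{\alpha_2 z}$$ and which satisfies $N\left(r,\frac{1}{f}\right)=S(r,f)$. Then $\rho(f)=1$, $a(z)\equiv a$ must be a constant, and one of the following holds: (i) $f(z)=c_1e^{\frac{\alpha_1 z}{2}}$, $\; a c_1\left(\frac{\alpha_1}{2}\right)^k e^{\frac{\alpha_1\beta}{2}}=p_2$, $\;\alpha_1=2\alpha_2$; (ii) $f(z)=c_2e^{\frac{\alpha_2 z}{2}}$, $\; a c_2\left(\frac{\alpha_2}{2}\right)^k e^{\frac{\alpha_2\beta}{2}}=p_1$, $\;\alpha_2=2\alpha_1$; where $c_1, c_2$ are constants satisfying $c_i^2=p_i$, $i=1,2$.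
   Context: Standard Nevanlinna theory notation: for a meromorphic function $f$ on $\mathbb{C}$, $T(r,f)$ is the characteristic function, $N(r,f)$ the counting function of poles (with multiplicity) and $m(r,f)$ the proximity function; so $N(r,1/f)$ counts the zeros of $f$ with multiplicity. $S(r,f)$ denotes any quantity that is $o(T(r,f))$ as $r\to\infty$ outside a set of finite linear measure. The order is $\rho(f)=\limsup_{r\to\infty}\frac{\log^+ T(r,f)}{\log r}$. $f^{(k)}$ is the $k$-th derivative, $f^{(0)}=f$, and $f^2(z)=(f(z))^2$. *)

(* Defs.v *)
From HB Require Import structures.
From mathcomp Require Import all_boot all_order all_algebra.
From mathcomp Require Import complex.
From mathcomp Require Import all_classical all_reals all_analysis.
Import Order.TTheory GRing.Theory Num.Theory.
Import numFieldTopology.Exports numFieldNormedType.Exports.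

Set Implicit Arguments.
Unset Strict Implicit.
Unset Printing Implicit Defensive.

Local Open Scope classical_set_scope.
Local Open Scope ring_scope.
Local Open Scope complex_scope.

(* The library gives [R[i]] its algebraic structure and its modulus, but no
   topology: take that of the modulus, so that [derivable] and [derive1n] on
   functions [R[i] -> R[i]] denote complex differentiation. *)
#[warnings="-redundant-canonical-projection"]
HB.instance Definition _ (R : rcfType) := NormedModule.copy R[i] R[i]^o.

Section ComplexFunctions.
Variable R : realType.
Implicit Types (f g : R[i] -> R[i]) (z : R[i]) (r : R) (u : R -> R).

Definition expC z : R[i] :=
  (expR (complex.Re z) * cos (complex.Im z)) +i*
  (expR (complex.Re z) * sin (complex.Im z)).

Definition entire f := forall z, derivable f z 1.

Definition transcendental_entire f :=
  entire f /\ ~ exists p : {poly R[i]}, forall z, f z = p.[z].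

(* Meromorphic functions are represented by total functions whose values at
   the poles are irrelevant: a pole is detected on punctured neighbourhoods.
   In particular [fun z => (f z)^-1] represents 1/f although 0^-1 = 0. *)
Definition has_pole_order f z (n : nat) :=
  (0 < n)%N /\
  exists2 l : R[i], l != 0 & (w - z) ^+ n * f w @[w --> z^'] --> l.

(* 0 when z is not a pole of f. *)
Definition pole_order f z : nat := xget 0%N [set n | has_pole_order f z n].

(* n(r, f); the sum over a set is finitely supported when f is meromorphic. *)
Definition pole_count r f : R :=
  \sum_(z \in [set z : R[i] | `|z| <= r%:C]) ((pole_order f z)%:R : R).

Definition log_plus (x : R) : R := Num.max 0 (ln x).

(* N(r, f) *)
Definition counting_fun r f : R :=
  Rintegral lebesgue_measure `[0, r]%classic
    (fun t => (pole_count t f - pole_count 0 f) / t)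
  + pole_count 0 f * ln r.

(* m(r, f) *)
Definition proximity_fun r f : R :=
  (2 * pi)^-1 *
  Rintegral lebesgue_measure `[0, 2 * pi]%classic
    (fun t => log_plus (complex.Re `|f ((r * cos t) +i* (r * sin t))|)).

(* T(r, f) *)
Definition characteristic_fun r f : R := proximity_fun r f + counting_fun r f.

(* u(r) = S(r, f) *)
Definition small_wrt u f :=
  exists E : set R, [/\ measurable E, (lebesgue_measure E < +oo)%E &
    forall eps : R, 0 < eps -> \forall r \near +oo,
      ~ E r -> `|u r| <= eps * characteristic_fun r f].

Definition growth_order f : \bar R :=
  limf_esup (fun r => (log_plus (characteristic_fun r f) / ln r)%:E)
            (pinfty_nbhs R).

End ComplexFunctions.

(* Main.v *)
(* Put H = p1 e^{alpha1 z} + p2 e^{alpha2 z}, b(z) = a(z) f^(k)(z + beta) and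
   L = (D - alpha1)(D - alpha2), so that f^2 + b = H and L H = 0. Then
   G = L(f^2) = - L b is bounded, up to subexponential factors, both by |f|^2
   and by |f| (taken on a disc of fixed radius). On a circle |z| = r without
   zeros of f, let w be the harmonic function in |z| < r with boundary values
   log |f|: it dominates log |f|, varies little over bounded distances by
   Harnack, and its mean w(0) exceeds a constant by N(r, 1/f) = o(r), since f
   turns out to have exponential type. If G were not 0, Jensen's inequality for
   G would give mean(log |G|) >= - O(1) on |z| = s ~ r/3, and
   log |G| <= w - w^- + o(r), up to arbitrarily small multiples of r, would make
   the mean of w^- small, hence that of w^+ as well. But
   (D - alpha2) H = p1 (alpha1 - alpha2) e^{alpha1 z} is bounded by e^{w} + e^{2w},
   which forces the mean of w^+ to be at least of order |alpha1| r.
   So L(f^2) = 0 and f^2 = A e^{alpha1 z} + B e^{alpha2 z}. Zeros of f^2 are double,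
   so A = 0 or B = 0, f is c e^{alpha_i z/2}, and the equation decides the rest. *)

Require Import Defs.
From HB Require Import structures.
From mathcomp Require Import all_boot all_order all_algebra.
From mathcomp Require Import complex.
From mathcomp Require Import all_classical all_reals all_analysis.
From mathcomp Require Import ring lra.
Import Order.TTheory GRing.Theory Num.Theory.
Import numFieldTopology.Exports numFieldNormedType.Exports.
Set Implicit Arguments.
Unset Strict Implicit.
Unset Printing Implicit Defensive.
Local Open Scope classical_set_scope.
Local Open Scope ring_scope.
Local Open Scope complex_scope.

(** * Modulus and continuity *)

(** The two bounds for G are combined through min(2w, w) = w - w^-: the bound by |f|^2 is the better
    one where w < 0, the bound by |f| where w > 0. Neither alone would control the mean of w^-,
    because the mean of w itself is only known to be small compared with r. The hypothesis on the
    zeros measures N(r, 1/f) against T(r, f), so it yields o(r) only after T(r, f) = O(r) has been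
    extracted from the equation; that is why exponential type precedes the estimate. Two radii are
    used. The outer one, r, avoids the exceptional set of S(r, f) and the moduli of zeros of f. The
    inner one, s, lies in ]r/4, r/3[, so that a neighbourhood of |z| = s of fixed width stays in |z|
    <= r/2, where the Poisson kernel is under control; s avoids the zeros of G only, since for G
    nothing but N(s, 1/G) >= 0 is used. The errors are kept as fixed fractions of |alpha1| r, with
    denominators 192 and 256 chosen so that together they use up half of the lower bound |alpha1| r
    / 16. Complex differentiability is assumed pointwise, without continuity of the derivative, so
    function theory starts from Goursat's theorem. *)

Section Modulus.
Variable R : realType.
Local Notation C := R[i].
Implicit Types z w : C.

(** The modulus as an element of [R]: the norm of [R[i]] takes its values in [R[i]], whereas [expR],
    [ln], integrals and [lra] need real numbers. *)
Definition nc z : R := complex.Re `|z|.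

Lemma ncE z : `|z| = (nc z)%:C.
Proof. by rewrite /nc normc_def. Qed.

Lemma nc_ge0 z : 0 <= nc z.
Proof. by rewrite -lecR -ncE; exact: normr_ge0. Qed.

Lemma ncM z w : nc (z * w) = nc z * nc w.
Proof. by apply: complexI; rewrite -ncE normrM !ncE rmorphM. Qed.

Lemma ncX z n : nc (z ^+ n) = nc z ^+ n.
Proof. by apply: complexI; rewrite -ncE normrX !ncE rmorphXn. Qed.

Lemma ncV z : nc z^-1 = (nc z)^-1.
Proof. by apply: complexI; rewrite -ncE normfV !ncE fmorphV. Qed.

Lemma nc_div z w : nc (z / w) = nc z / nc w.
Proof. by rewrite ncM ncV. Qed.

Lemma ncN z : nc (- z) = nc z.
Proof. by rewrite /nc normrN. Qed.

Lemma ncB z w : nc (z - w) = nc (w - z).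
Proof. by rewrite -ncN opprB. Qed.

Lemma ncD z w : nc (z + w) <= nc z + nc w.
Proof. by rewrite -lecR rmorphD -!ncE ler_normD. Qed.

Lemma ncDB z w : nc (z - w) <= nc z + nc w.
Proof. by rewrite -(ncN w) ncD. Qed.

Lemma nc0 : nc 0 = 0.
Proof. by rewrite /nc normr0. Qed.

Lemma nc1 : nc 1 = 1.
Proof. by rewrite /nc normr1. Qed.

Lemma nc_eq0 z : (nc z == 0) = (z == 0).
Proof. by rewrite -(inj_eq (@complexI R)) -ncE normr_eq0. Qed.

Lemma nc_gt0 z : (0 < nc z) = (z != 0).
Proof. by rewrite lt_neqAle eq_sym nc_eq0 nc_ge0 andbT. Qed.

Lemma nc_real (x : R) : nc x%:C = `|x|.
Proof. by apply: complexI; rewrite -ncE normc_def /= expr0n /= addr0 sqrtr_sqr. Qed.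

Lemma nc_sub z w : nc z - nc w <= nc (z - w).
Proof. by rewrite lerBlDr -{1}(subrK w z) ncD. Qed.

Lemma nc_cplx (x y : R) : nc (x +i* y) = Num.sqrt (x ^+ 2 + y ^+ 2).
Proof. by rewrite /nc normc_def. Qed.

Lemma sqr_nc z : nc z ^+ 2 = complex.Re z ^+ 2 + complex.Im z ^+ 2.
Proof. by rewrite /nc normc_def /= sqr_sqrtr // addr_ge0 // sqr_ge0. Qed.

Lemma Re_le_nc z : `|complex.Re z| <= nc z.
Proof. by rewrite -lecR -ncE normc_ge_Re. Qed.

Lemma Im_le_nc z : `|complex.Im z| <= nc z.
Proof.
by rewrite -ler_sqr ?nnegrE ?nc_ge0 // sqr_nc real_normK ?num_real // lerDr sqr_ge0.
Qed.

Lemma ReD z w : complex.Re (z + w) = complex.Re z + complex.Re w.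
Proof. by case: z w => [? ?] [? ?]. Qed.
Lemma ImD z w : complex.Im (z + w) = complex.Im z + complex.Im w.
Proof. by case: z w => [? ?] [? ?]. Qed.
Lemma ReN z : complex.Re (- z) = - complex.Re z.
Proof. by case: z. Qed.
Lemma ImN z : complex.Im (- z) = - complex.Im z.
Proof. by case: z. Qed.
Lemma ReM z w : complex.Re (z * w) =
  complex.Re z * complex.Re w - complex.Im z * complex.Im w.
Proof. by case: z w => [? ?] [? ?]. Qed.
Lemma ImM z w : complex.Im (z * w) =
  complex.Re z * complex.Im w + complex.Im z * complex.Re w.
Proof. by case: z w => [? ?] [? ?]. Qed.

Lemma nc_le_ReIm z : nc z <= `|complex.Re z| + `|complex.Im z|.
Proof.
case: z => x y; have -> : x +i* y = x%:C + 'i%C * y%:C by rewrite [LHS]complexE.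
by apply: le_trans (ncD _ _) _; rewrite ncM !nc_real nc_cplx expr0n expr1n add0r sqrtr1 mul1r /= !(mul0r,mul1r,mulr0,addr0,subr0,add0r).
Qed.

Lemma gt0_complex (e : C) : 0 < e -> exists2 d : R, 0 < d & e = d%:C.
Proof.
move=> e0; exists (nc e); last by rewrite -ncE gtr0_norm.
by rewrite nc_gt0 gt_eqF.
Qed.

Lemma cvg_nc {T : Type} (F : set_system T) {FF : Filter F} (f : T -> C) (l : C) :
  f @ F --> l <-> forall e : R, 0 < e -> \forall t \near F, nc (l - f t) < e.
Proof.
split=> [/cvgrPdist_lt fl e e0|fl].
  have /fl : (0 : C) < e%:C by rewrite ltcR.
  by apply: filterS => t; rewrite ncE ltcR.
apply/cvgrPdist_lt => e /gt0_complex [d d0 ->].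
by apply: filterS (fl _ d0) => t; rewrite ncE ltcR.
Qed.

Lemma nbhs_nc (z : C) (A : set C) :
  nbhs z A <-> exists2 e : R, 0 < e & forall w, nc (w - z) < e -> A w.
Proof.
split=> [/nbhs_ballP[e /= /gt0_complex [d d0 ->]] dA|[e e0 eA]].
  by exists d => // w wz; apply: dA; rewrite -ball_normE /= ncE ltcR ncB.
apply/nbhs_ballP; exists e%:C; first by rewrite /= ltcR.
by move=> w; rewrite -ball_normE /= ncE ltcR ncB => /eA.
Qed.

Lemma continuous_nc : continuous nc.
Proof.
move=> z; apply/(@cvgrPdist_lt _ _ _ (nbhs z)) => e e0; apply/nbhs_nc; exists e => // w wz.
apply: le_lt_trans wz; rewrite ncB ler_norml nc_sub andbT.
by rewrite lerNl opprB ncB nc_sub.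
Qed.

Lemma continuous_Re : continuous (@complex.Re R).
Proof.
move=> z; apply/(@cvgrPdist_lt _ _ _ (nbhs z)) => e e0; apply/nbhs_nc; exists e => // w wz.
by apply: le_lt_trans wz; rewrite ncB -ReN -ReD Re_le_nc.
Qed.

Lemma continuous_Im : continuous (@complex.Im R).
Proof.
move=> z; apply/(@cvgrPdist_lt _ _ _ (nbhs z)) => e e0; apply/nbhs_nc; exists e => // w wz.
by apply: le_lt_trans wz; rewrite ncB -ImN -ImD Im_le_nc.
Qed.

Lemma continuous_real_complex : continuous (fun x : R => x%:C : C).
Proof.
move=> x; apply/cvg_nc => e e0; near=> y; rewrite -rmorphB nc_real.
by near: y; apply: cvgr_dist_lt.
Unshelve. all: by end_near. Qed.

Section Limits.
Context {T : Type} (F : set_system T) {FF : Filter F}.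
Implicit Types (f g : T -> C) (a b : C).

Lemma cvgCD f g a b : f @ F --> a -> g @ F --> b -> (fun t => f t + g t) @ F --> a + b.
Proof. exact: (@cvgD C _ T F FF f g a b). Qed.

Lemma cvgCN f a : f @ F --> a -> (fun t => - f t) @ F --> - a.
Proof. exact: (@cvgN C _ T F FF f a). Qed.

Lemma cvgCB f g a b : f @ F --> a -> g @ F --> b -> (fun t => f t - g t) @ F --> a - b.
Proof. by move=> fa /cvgCN; exact: cvgCD. Qed.

Lemma cvgCM f g a b : f @ F --> a -> g @ F --> b -> (fun t => f t * g t) @ F --> a * b.
Proof. exact: (@cvgM C T F FF f g a b). Qed.

Lemma cvgCV f a : a != 0 -> f @ F --> a -> (fun t => (f t)^-1) @ F --> a^-1.
Proof. exact: (@cvgV C T F FF f a). Qed.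

Lemma cvgC_cst (c : C) : (fun _ : T => c) @ F --> c.
Proof. by apply/cvg_nc => e e0; apply: filterE => t; rewrite subrr nc0. Qed.

End Limits.

Section Continuity.
Variable T : topologicalType.
Implicit Types f g : T -> C.

Lemma ctsCD f g : continuous f -> continuous g -> continuous (fun t => f t + g t).
Proof. by move=> cf cg t; apply: cvgCD; [exact: cf|exact: cg]. Qed.

Lemma ctsCN f : continuous f -> continuous (fun t => - f t).
Proof. by move=> cf t; apply: cvgCN; exact: cf. Qed.

Lemma ctsCB f g : continuous f -> continuous g -> continuous (fun t => f t - g t).
Proof. by move=> cf cg t; apply: cvgCB; [exact: cf|exact: cg]. Qed.

Lemma ctsCM f g : continuous f -> continuous g -> continuous (fun t => f t * g t).
Proof. by move=> cf cg t; apply: cvgCM; [exact: cf|exact: cg]. Qed.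

Lemma ctsC_cst (c : C) : continuous (fun _ : T => c).
Proof. by move=> t; exact: cvg_cst. Qed.

Lemma ctsCV f : (forall t, f t != 0) -> continuous f -> continuous (fun t => (f t)^-1).
Proof. by move=> f0 cf t; apply: cvgCV; [exact: f0|exact: cf]. Qed.

Lemma cts_comp (U V : topologicalType) (f : T -> U) (g : U -> V) :
  continuous f -> continuous g -> continuous (fun t => g (f t)).
Proof. by move=> cf cg t; apply: (continuous_comp (cf t)); exact: cg. Qed.

End Continuity.

Lemma continuousC_ReIm {T : topologicalType} (f : T -> C) (t : T) :
  {for t, continuous (fun s => complex.Re (f s))} ->
  {for t, continuous (fun s => complex.Im (f s))} -> {for t, continuous f}.
Proof.
move=> fr fi; have -> : f = fun s => (complex.Re (f s))%:C + 'i%C * (complex.Im (f s))%:C.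
  by apply/funext => s; rewrite -complexE.
apply: (@cvgCD _ _ _ (fun s => (complex.Re (f s))%:C : C) (fun s => 'i%C * (complex.Im (f s))%:C : C)).
  exact: (continuous_comp fr (@continuous_real_complex _)).
apply: (@cvgCM _ _ _ (fun=> 'i%C : C) (fun s => (complex.Im (f s))%:C : C)); first exact: cvg_cst.
exact: (continuous_comp fi (@continuous_real_complex _)).
Qed.

End Modulus.

Arguments cvgCD {R T F FF f g a b}.
Arguments cvgCB {R T F FF f g a b}.
Arguments cvgCM {R T F FF f g a b}.
Arguments cvgCN {R T F FF f a}.
Arguments cvgCV {R T F FF f a}.
Arguments cvgC_cst {R T F FF} c.
Arguments cvg_nc {R T F FF f l}.

(** * Derivatives and integrals *)

Section ComplexDerivative.
Variable R : realType.
Local Notation C := R[i].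

(* Caratheodory's form of the derivative of f with respect to i: complex
   differentiation for i = id, differentiation along the real line for i = rc. *)
Definition cd (T : topologicalType) (i f : T -> C) (t : T) (l : C) :=
  exists psi : T -> C, [/\ forall s, f s - f t = psi s * (i s - i t),
    psi t = l & psi @ t --> l].

Section Calculus.
Variables (T : topologicalType) (i : T -> C).
Hypothesis ci : continuous i.
Implicit Types (f g : T -> C) (t : T) (l m : C).

Lemma cd_cst c t : cd i (fun=> c) t 0.
Proof. by exists (fun=> 0); split=> // [s|]; [rewrite subrr mul0r|exact: cvgC_cst]. Qed.

Lemma cd_id t : cd i i t 1.
Proof. by exists (fun=> 1); split=> // [s|]; [rewrite mul1r|exact: cvgC_cst]. Qed.

Lemma cdD f g t l m : cd i f t l -> cd i g t m -> cd i (fun s => f s + g s) t (l + m).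
Proof.
move=> [p [p1 p2 p3]] [q [q1 q2 q3]]; exists (fun s => p s + q s); split.
- by move=> s; rewrite mulrDl -p1 -q1; ring.
- by rewrite p2 q2.
- exact: (cvgCD p3 q3).
Qed.

Lemma cd_continuous f t l : cd i f t l -> {for t, continuous f}.
Proof.
move=> [p [p1 p2 p3]].
have -> : f = fun s => f t + p s * (i s - i t).
  by apply/funext => s; rewrite -p1; ring.
have H : (fun s => f t + p s * (i s - i t)) @ nbhs t --> f t + l * (i t - i t).
  exact: (cvgCD (cvgC_cst _) (cvgCM p3 (cvgCB (@ci t) (cvgC_cst _)))).
by rewrite /prop_for /continuous_at p2; exact: H.
Qed.

Lemma cdM f g t l m : cd i f t l -> cd i g t m ->
  cd i (fun s => f s * g s) t (l * g t + f t * m).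
Proof.
move=> [p [p1 p2 p3]] gd; have gc := cd_continuous gd.
case: gd => [q [q1 q2 q3]]; exists (fun s => p s * g s + f t * q s); split.
- by move=> s; rewrite mulrDl -[f t * q s * _]mulrA -q1 mulrAC -p1; ring.
- by rewrite p2 q2.
- exact: (cvgCD (cvgCM p3 gc) (cvgCM (cvgC_cst _) q3)).
Qed.

Lemma cdZ c f t l : cd i f t l -> cd i (fun s => c * f s) t (c * l).
Proof. by move=> /(cdM (cd_cst c t)); rewrite mul0r add0r. Qed.

Lemma cdN f t l : cd i f t l -> cd i (fun s => - f s) t (- l).
Proof.
move=> /(cdZ (-1)); rewrite mulN1r.
by have -> : (fun s => -1 * f s) = (fun s => - f s) by apply/funext => s; rewrite mulN1r.
Qed.

Lemma cdB f g t l m : cd i f t l -> cd i g t m -> cd i (fun s => f s - g s) t (l - m).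
Proof. by move=> fl /cdN; exact: cdD. Qed.

Lemma cdX f t l n : cd i f t l -> cd i (fun s => f s ^+ n) t (n%:R * f t ^+ n.-1 * l).
Proof.
move=> fl; elim: n => [|n IH].
  have -> : (fun s => f s ^+ 0) = (fun=> 1) by apply/funext => s; rewrite expr0.
  by rewrite mul0r mul0r; exact: cd_cst.
have -> : (fun s => f s ^+ n.+1) = (fun s => f s * f s ^+ n) by apply/funext => s; rewrite exprS.
have := cdM fl IH; congr cd => /=; case: n {IH} => [|n] /=; first by rewrite !expr0; ring.
by rewrite exprS -[n.+2%:R]natr1; ring.
Qed.

Lemma cdV f t l : f t != 0 -> cd i f t l -> cd i (fun s => (f s)^-1) t (- l / f t ^+ 2).
Proof.
move=> ft0 fl; have fc := cd_continuous fl.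
case: fl => p [p1 p2 p3].
(* Away from the zeros of f the slope is the expected one. Where f s = 0 the inverse is 0 by default
   and the increment is -1/f t, so the slope there is a plain quotient; i s = i t cannot occur
   there, as it would give f t = 0. *)
exists (fun s => if f s == 0 then (if i s == i t then 0 else - (f t)^-1 / (i s - i t)) else - p s / (f s * f t)); split.
- move=> s; case: eqVneq => [fs|fs].
    rewrite fs invr0 sub0r; case: eqVneq => [is_|is_].
      by have := p1 s; rewrite is_ subrr mulr0 fs sub0r => /eqP; rewrite oppr_eq0 (negPf ft0).
    by rewrite mulfVK // subr_eq0.
  rewrite mulrAC mulNr -p1; field; exact/andP.
- by rewrite (negPf ft0) p2 expr2.
- apply: (@cvg_trans _ ((fun s => - p s / (f s * f t)) @ t)); last first.
    rewrite expr2; apply: (cvgCM (cvgCN p3)); apply: cvgCV; first by rewrite mulf_neq0.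
    exact: (cvgCM fc (cvgC_cst _)).
  apply: near_eq_cvg; have K : nbhs (f t) [set z | z != 0].
    apply/nbhs_nc; exists (nc (f t)); first by rewrite nc_gt0.
    by move=> w; apply: contraTN => /eqP ->; rewrite sub0r ncN ltxx.
  have : \forall s \near t, f s != 0 by exact: (fc _ K).
  by apply: filterS => s /negPf ->.
Qed.

Lemma cd_div f g t l m : g t != 0 -> cd i f t l -> cd i g t m ->
  cd i (fun s => f s / g s) t ((l * g t - f t * m) / g t ^+ 2).
Proof.
move=> gt0 fl gm; have := cdM fl (cdV gt0 gm); congr cd; field; exact: gt0.
Qed.

(** Injectivity of i at t makes the difference quotient an admissible slope away from t, which gives
    the converse direction. *)
Lemma cd_eps f t l : (forall s, i s = i t -> s = t) ->
  cd i f t l <-> forall e, 0 < e -> \forall s \near t,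
     nc (f s - f t - l * (i s - i t)) <= e * nc (i s - i t).
Proof.
move=> inj; split=> [[p [p1 p2 p3]] e e0|fl].
  move/(@cvg_nc _ _ (nbhs t) _) : p3 => /(_ _ e0); apply: filterS => s /ltW ps.
  by rewrite p1 -mulrBl ncM (ncB (p s)); exact: (ler_wpM2r (nc_ge0 _) ps).
exists (fun s => if i s == i t then l else (f s - f t) / (i s - i t)); split.
- move=> s; case: eqVneq => [/inj ->|is_]; first by rewrite !subrr mulr0.
  by rewrite mulfVK // subr_eq0.
- by rewrite eqxx.
- apply/(@cvg_nc _ _ (nbhs t)) => e e0; have e2 : 0 < e / 2 by rewrite divr_gt0.
  apply: filterS (fl _ e2) => s; case: eqVneq => [_ _|]; first by rewrite subrr nc0.
  rewrite -subr_eq0 => is_ H.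
  have -> : l - (f s - f t) / (i s - i t) = - ((f s - f t - l * (i s - i t)) / (i s - i t)).
    by field.
  rewrite ncN nc_div; apply: (@le_lt_trans _ _ (e / 2)); last by lra.
  by rewrite ler_pdivrMr // nc_gt0.
Qed.

End Calculus.

(** The outer map is complex differentiable while the inner one is differentiable with respect to
    any i, so this covers both composition of holomorphic maps and restriction of a holomorphic map
    to a real path. *)
Lemma cd_comp (T : topologicalType) (i f : T -> C) (g : C -> C) t l m :
  continuous i ->
  cd idfun g (f t) m -> cd i f t l -> cd i (fun s => g (f s)) t (m * l).
Proof.
move=> ci [q [q1 q2 q3]] fl; have fc := cd_continuous ci fl.
case: fl => [p [p1 p2 p3]]; exists (fun s => q (f s) * p s); split.
- by move=> s; rewrite q1 /= p1 mulrA.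
- by rewrite q2 p2.
- have H : (fun s => q (f s)) @ nbhs t --> m by apply: (@cvg_comp _ _ _ f q (nbhs t) (nbhs (f t)) (nbhs m)); [exact: fc|exact: q3].
  exact: (cvgCM H p3).
Qed.

Lemma cd_derive (f : C -> C) z l : cd idfun f z l -> derivable f z 1 /\ derive1 f z = l.
Proof.
move=> [p [p1 p2 p3]].
suff H : (h^-1 *: (f (h *: 1 + z) - f z)) @[h --> (0:C)^'] --> l.
  split; first by apply/cvg_ex; exists l.
  rewrite derive1E; apply: (@cvg_lim C _ C (0:C)^' _ _ _ H); exact: norm_hausdorff.
apply: (@cvg_trans _ ((fun h => p (h + z)) @ (0:C)^')).
  apply: near_eq_cvg; near=> h; rewrite p1 /= -[h *: 1]/(h * 1) -[_ *: _]/(_ * _) mulr1 addrK.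
  by rewrite mulrCA mulVf ?mulr1 //; near: h; exact: nbhs_dnbhs_neq.
apply: cvg_within_filter.
have Hs : (fun h : C => h + z) @ nbhs (0:C) --> z.
  apply/(@cvg_nc _ _ (nbhs (0:C))) => e e0; apply/nbhs_nc; exists e => // w.
  by rewrite subr0 opprD addrCA subrr addr0 ncN.
exact: (@cvg_comp _ _ _ (fun h => h + z) p (nbhs (0:C)) (nbhs z) (nbhs l) Hs p3).
Unshelve. all: by end_near. Qed.

Lemma derive_cd (f : C -> C) z : derivable f z 1 -> cd idfun f z (derive1 f z).
Proof.
move=> df; suff : exists l, cd idfun f z l.
  by move=> [l fl]; have [_ ->] := cd_derive fl.
move/cvg_ex : df => [/= l fl]; exists l; apply/cd_eps; first by [].
move=> e e0; have FF : Filter (0:C)^' by exact: dnbhs_filter.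
have := (@cvg_nc _ _ _ FF _ _).1 fl _ e0.
rewrite /dnbhs near_withinE => /nbhs_nc[d d0 H]; apply/nbhs_nc; exists d => // w wz /=.
have [->|wz0] := eqVneq w z; first by rewrite !subrr mulr0 subr0 nc0 mulr0.
have wz1 : w - z != 0 by rewrite subr_eq0.
have := H (w - z); rewrite subr0 => /(_ wz wz1); rewrite -[_ *: 1]/(_ * 1) mulr1 subrK.
rewrite -[_ *: _]/(_ * _) => /ltW K.
have -> : f w - f z - l * (w - z) = (w - z) * - (l - (w - z)^-1 * (f w - f z)) by field.
by rewrite ncM mulrC ncN ler_wpM2r // nc_ge0.
Qed.

Lemma cd_unique (f : C -> C) z l m : cd idfun f z l -> cd idfun f z m -> l = m.
Proof. by move=> /cd_derive [_ <-] /cd_derive [_ <-]. Qed.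

Definition rc : R -> C := fun x => x%:C.

Lemma rcI x y : rc x = rc y -> x = y.
Proof. exact: complexI. Qed.

Lemma continuous_rc : continuous rc.
Proof. exact: continuous_real_complex. Qed.

Lemma is_derive_cd (F : R -> R) (x d : R) : is_derive x 1 F d -> cd rc (fun t => rc (F t)) x (rc d).
Proof.
move=> [/cvg_ex[/= l Fl] Fd]; have ld : l = d by rewrite -Fd; apply/esym/cvg_lim.
rewrite ld in Fl => {l ld Fd}; apply/cd_eps; first by move=> s /rcI.
move=> e e0; have /cvgrPdist_lt/(_ e e0) := Fl.
rewrite /dnbhs near_withinE => /nbhs_ballP[r /= r0 H]; apply/nbhs_ballP; exists r => //= y xy.
rewrite /rc -!(rmorphB, rmorphM) !nc_real -/rc.
have [->|yx] := eqVneq y x; first by rewrite !subrr mulr0 subr0 normr0 mulr0.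
have yx1 : y - x != 0 by rewrite subr_eq0.
have : ball 0 r (y - x) by move: xy; rewrite -!ball_normE /= sub0r opprB.
move=> /H /(_ yx1); rewrite -[_ *: 1]/(_ * 1) mulr1 subrK -[_ *: _]/(_ * _) => /ltW K.
have -> : F y - F x - d * (y - x) = (y - x) * - (d - (y - x)^-1 * (F y - F x)) by field.
by rewrite normrM mulrC normrN ler_wpM2r.
Qed.

Lemma cd_is_derive_Re (f : R -> C) x l : cd rc f x l ->
  is_derive x 1 (fun t => complex.Re (f t)) (complex.Re l).
Proof.
move=> [p [p1 p2 p3]].
suff H : (h^-1 *: (complex.Re (f (h *: 1 + x)) - complex.Re (f x))) @[h --> (0:R)^'] --> complex.Re l.
  by split; [apply/cvg_ex; exists (complex.Re l)|apply/cvg_lim].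
apply: (@cvg_trans _ ((fun h => complex.Re (p (h + x))) @ (0:R)^')).
  apply: near_eq_cvg; near=> h.
  rewrite -[h *: 1]/(h * 1) mulr1 -ReN -ReD p1 /rc -rmorphB addrK -[_ *: _]/(_ * _).
  rewrite ReM /= mulr0 subr0 mulrCA mulVf ?mulr1 //; near: h; exact: nbhs_dnbhs_neq.
apply: cvg_within_filter; apply: (@cvg_comp _ _ _ (fun h => p (h + x)) _ _ (nbhs l)); last exact: continuous_Re.
apply: (@cvg_comp _ _ _ (fun h => h + x) p (nbhs (0:R)) (nbhs x)); last exact: p3.
by rewrite -{2}[x]add0r; apply: cvgD; [exact: cvg_id|exact: cvg_cst].
Unshelve. all: by end_near. Qed.

Lemma cd_is_derive_Im (f : R -> C) x l : cd rc f x l ->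
  is_derive x 1 (fun t => complex.Im (f t)) (complex.Im l).
Proof.
move=> fl; have := cd_is_derive_Re (cdZ continuous_rc (- 'i%C) fl).
have -> : (fun t => complex.Re (- 'i%C * f t)) = (fun t => complex.Im (f t)).
  by apply/funext => t; rewrite mulNr ReN mulrC ReiNIm opprK.
by rewrite mulNr ReN mulrC ReiNIm opprK.
Qed.

End ComplexDerivative.

(** * Integrals of continuous functions over segments, and the complex exponential *)

Section Integrals.
Variable R : realType.
Local Notation C := R[i].
Local Notation mu := (@lebesgue_measure R).

Definition ig (a b : R) (phi : R -> R) : R := \int[mu]_(x in `[a, b]) phi x.

Definition cig (a b : R) (phi : R -> C) : C :=
  ig a b (fun t => complex.Re (phi t)) +i* ig a b (fun t => complex.Im (phi t)).

Section RealIntegral.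
Implicit Types (phi psi F : R -> R) (a b c : R).

Lemma continuous_integrable phi a b : continuous phi ->
  mu.-integrable `[a, b] (EFin \o phi).
Proof.
move=> cphi; apply: continuous_compact_integrable; first exact: segment_compact.
exact: continuous_subspaceT.
Qed.

Lemma igD phi psi a b : continuous phi -> continuous psi ->
  ig a b (fun t => phi t + psi t) = ig a b phi + ig a b psi.
Proof. by move=> c1 c2; apply: RintegralD => //; exact: continuous_integrable. Qed.

Lemma igZ k phi a b : continuous phi -> ig a b (fun t => k * phi t) = k * ig a b phi.
Proof. by move=> c1; apply: RintegralZl => //; exact: continuous_integrable. Qed.

Lemma igN phi a b : continuous phi -> ig a b (fun t => - phi t) = - ig a b phi.
Proof.
by move=> c1; rewrite -mulN1r -igZ //; congr ig; apply/funext => t; rewrite mulN1r.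
Qed.

Lemma igB phi psi a b : continuous phi -> continuous psi ->
  ig a b (fun t => phi t - psi t) = ig a b phi - ig a b psi.
Proof.
move=> c1 c2; rewrite igD ?igN // => t; apply: cvgN; exact: c2.
Qed.

Lemma ig_le phi psi a b : continuous phi -> continuous psi ->
  (forall t, a <= t <= b -> phi t <= psi t) -> ig a b phi <= ig a b psi.
Proof.
move=> c1 c2 le12; apply: le_Rintegral; [by []|exact: continuous_integrable|exact: continuous_integrable|].
by move=> t /=; rewrite in_itv /=; exact: le12.
Qed.

Lemma ig_ftc F phi a b : a <= b -> continuous phi ->
  (forall t : R, is_derive t 1 F (phi t)) -> ig a b phi = F b - F a.
Proof.
rewrite le_eqVlt => /orP[/eqP <- _ _|ab cphi dF].
  by rewrite subrr /ig set_itv1 Rintegral_set1.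
have Fc t : {for t, continuous F}.
  by apply: differentiable_continuous; apply/derivable1_diffP; exact: ex_derive.
rewrite /ig /Rintegral (continuous_FTC2 ab (F := F)) //.
- exact: continuous_subspaceT.
- split; first by move=> x _; exact: ex_derive.
  + apply: cvg_at_right_filter; exact: Fc.
  + apply: cvg_at_left_filter; exact: Fc.
- by move=> x _; rewrite derive1E; exact: derive_val.
Qed.

Lemma ig_cst k a b : a <= b -> ig a b (fun=> k) = k * (b - a).
Proof.
move=> ab; rewrite mulrBr; apply: (@ig_ftc (fun t => k * t)) => //; first exact: cst_continuous.
move=> t; have := @is_deriveZ R R R id k t 1 1 (is_derive_id _ _).
by rewrite -[k%:A]/(k * 1) mulr1; apply.
Qed.

Lemma ig_chasles phi a b c : a <= b -> b <= c -> continuous phi ->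
  ig a c phi = ig a b phi + ig b c phi.
Proof.
move=> ab bc cphi; apply/eqP; rewrite addrC -subr_eq; apply/eqP.
rewrite /ig Rintegral_itvB ?bnd_simp //; last exact: continuous_integrable.
rewrite Rintegral_itv_obnd_cbnd //.
by apply: integrableS (continuous_integrable b c cphi) => //; exact: subset_itv_oc_cc.
Qed.

Lemma ig_ge0 phi a b : (forall t, a <= t <= b -> 0 <= phi t) -> 0 <= ig a b phi.
Proof. by move=> h; apply: Rintegral_ge0 => t /=; rewrite in_itv /=; exact: h. Qed.

Lemma eq_ig phi psi a b : (forall t, a <= t <= b -> phi t = psi t) -> ig a b phi = ig a b psi.
Proof. by move=> h; apply: eq_Rintegral => t; rewrite inE /= in_itv /=; exact: h. Qed.

End RealIntegral.

Section ComplexIntegral.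
Implicit Types (phi psi F : R -> C) (a b c : R).

Lemma ctsRe phi : continuous phi -> continuous (fun t => complex.Re (phi t)).
Proof. by move=> h; apply: (cts_comp h); exact: continuous_Re. Qed.

Lemma ctsIm phi : continuous phi -> continuous (fun t => complex.Im (phi t)).
Proof. by move=> h; apply: (cts_comp h); exact: continuous_Im. Qed.

Lemma ctsnc phi : continuous phi -> continuous (fun t => nc (phi t)).
Proof. by move=> h; apply: (cts_comp h); exact: continuous_nc. Qed.

Hint Resolve ctsRe ctsIm ctsnc : core.

Lemma cigD phi psi a b : continuous phi -> continuous psi ->
  cig a b (fun t => phi t + psi t) = cig a b phi + cig a b psi.
Proof.
move=> c1 c2; rewrite /cig -[RHS]/(_ +i* _); congr (_ +i* _); rewrite -igD; auto;
  by congr ig; apply/funext => t; rewrite (ReD, ImD).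
Qed.

Lemma cigZ (k : C) phi a b : continuous phi -> cig a b (fun t => k * phi t) = k * cig a b phi.
Proof.
move=> c1; rewrite /cig; case: k => x y; rewrite -[RHS]/(_ +i* _); congr (_ +i* _).
  rewrite -!igZ -?igB; auto; last 2 first.
  - by move=> t; apply: cvgM; [exact: cvg_cst|exact: ctsRe].
  - by move=> t; apply: cvgM; [exact: cvg_cst|exact: ctsIm].
  by congr ig; apply/funext => t; rewrite ReM.
rewrite -!igZ -?igD; auto; last 2 first.
- by move=> t; apply: cvgM; [exact: cvg_cst|exact: ctsIm].
- by move=> t; apply: cvgM; [exact: cvg_cst|exact: ctsRe].
by congr ig; apply/funext => t; rewrite ImM.
Qed.

Lemma cigN phi a b : continuous phi -> cig a b (fun t => - phi t) = - cig a b phi.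
Proof. by move=> h; rewrite -mulN1r -cigZ //; congr cig; apply/funext => t; rewrite mulN1r. Qed.

Lemma cigB phi psi a b : continuous phi -> continuous psi ->
  cig a b (fun t => phi t - psi t) = cig a b phi - cig a b psi.
Proof. by move=> c1 c2; rewrite (cigD _ _ c1 (ctsCN c2)) cigN. Qed.

Lemma eq_cig phi psi a b : (forall t, a <= t <= b -> phi t = psi t) -> cig a b phi = cig a b psi.
Proof. by move=> h; congr (_ +i* _); apply: eq_ig => t /h ->. Qed.

(** Rotation by the unimodular u = conj(I)/|I| makes the integral I real and equal to its modulus;
    then only the real part of u phi matters. *)
Lemma nc_cig phi a b : continuous phi -> nc (cig a b phi) <= ig a b (fun t => nc (phi t)).
Proof.
move=> c1; set I := cig a b phi.
have [I0|I0] := eqVneq I 0; first by rewrite I0 nc0; apply: ig_ge0 => t _; exact: nc_ge0.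
have nI : 0 < nc I by rewrite nc_gt0.
pose u := I^*%C / rc (nc I).
have nu : nc u = 1.
  rewrite nc_div nc_real ger0_norm ?nc_ge0 //; have -> : nc I^*%C = nc I by rewrite /nc normcJ.
  by rewrite divff // gt_eqF.
have : cig a b (fun t => u * phi t) = rc (nc I).
  rewrite cigZ // -/I /u mulrAC [_ * I]mulrC -sqr_normc ncE -/(rc _) expr2 mulfK //.
  by rewrite -[0]/(rc 0) (inj_eq (@complexI R)) gt_eqF.
move=> /(congr1 (@complex.Re R)) /= <-.
have cu : continuous (fun t => u * phi t) by apply: ctsCM; [exact: ctsC_cst|exact: c1].
apply: ig_le; auto => t _.
by apply: le_trans (ler_norm _) _; apply: le_trans (Re_le_nc _) _; rewrite ncM nu mul1r.
Qed.

Lemma nc_cig_le phi a b M : a <= b -> continuous phi ->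
  (forall t, a <= t <= b -> nc (phi t) <= M) -> nc (cig a b phi) <= M * (b - a).
Proof.
move=> ab c1 h; apply: le_trans (nc_cig _ _ c1) _; rewrite -ig_cst //.
by apply: ig_le; auto; exact: cst_continuous.
Qed.

Lemma cig_ftc F phi a b : a <= b -> continuous phi ->
  (forall t, cd (@rc R) F t (phi t)) -> cig a b phi = F b - F a.
Proof.
move=> ab c1 dF; rewrite /cig.
have -> : ig a b (fun t => complex.Re (phi t)) = complex.Re (F b) - complex.Re (F a).
  by apply: (@ig_ftc (fun t => complex.Re (F t))) => //; [exact: ctsRe|move=> t; exact: cd_is_derive_Re].
have -> : ig a b (fun t => complex.Im (phi t)) = complex.Im (F b) - complex.Im (F a).
  by apply: (@ig_ftc (fun t => complex.Im (F t))) => //; [exact: ctsIm|move=> t; exact: cd_is_derive_Im].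
by case: (F b) (F a) => [? ?] [? ?].
Qed.

Lemma cig_chasles phi a b c : a <= b -> b <= c -> continuous phi ->
  cig a c phi = cig a b phi + cig b c phi.
Proof.
by move=> ab bc c1; rewrite /cig (@ig_chasles _ a b c) 1?(@ig_chasles _ a b c) //; auto.
Qed.

Lemma cig_cst (k : C) a b : a <= b -> cig a b (fun=> k) = k * rc (b - a).
Proof.
move=> ab; rewrite (@cig_ftc (fun t => k * rc t)) //.
- by rewrite -mulrBr -rmorphB.
- exact: ctsC_cst.
- by move=> t; have := cdZ (@continuous_rc R) k (cd_id (@rc R) t); rewrite mulr1.
Qed.

End ComplexIntegral.

Definition expi (t : R) : C := cos t +i* sin t.

Lemma nc_expi t : nc (expi t) = 1.
Proof. by rewrite nc_cplx cos2Dsin2 sqrtr1. Qed.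

Lemma expi_neq0 t : expi t != 0.
Proof. by rewrite -nc_gt0 nc_expi. Qed.

Lemma expiE t : expi t = rc (cos t) + 'i%C * rc (sin t).
Proof. by rewrite [LHS]complexE. Qed.

Lemma expi0 : expi 0 = 1.
Proof. by rewrite /expi cos0 sin0. Qed.

Lemma expi2pi : expi (2 * pi) = 1.
Proof. by rewrite /expi mulr_natl cos2pi sin2pi. Qed.

Lemma cd_expi t : cd (@rc R) expi t ('i%C * expi t).
Proof.
have -> : expi = fun t => rc (cos t) + 'i%C * rc (sin t) by apply/funext => s; exact: expiE.
have := cdD (is_derive_cd (is_derive_cos t)) (cdZ (@continuous_rc R) 'i%C (is_derive_cd (is_derive_sin t))).
congr cd; rewrite /rc rmorphN mulrDr mulrA -expr2 sqr_i; ring.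
Qed.

Lemma continuous_expi : continuous expi.
Proof. by move=> t; exact: (cd_continuous (@continuous_rc R) (cd_expi t)). Qed.

Lemma expCE (z : C) : expC z = rc (expR (complex.Re z)) * expi (complex.Im z).
Proof. by rewrite /expC /expi /rc; simpc. Qed.

Lemma expCD (z w : C) : expC (z + w) = expC z * expC w.
Proof.
rewrite !expCE ReD ImD expRD /rc /expi cosD sinD; simpc.
by congr (_ +i* _); ring.
Qed.

Lemma expC0 : expC (0 : C) = 1.
Proof. by rewrite expCE /= expR0 expi0 mulr1. Qed.

Lemma nc_expC (z : C) : nc (expC z) = expR (complex.Re z).
Proof. by rewrite expCE ncM nc_expi mulr1 nc_real ger0_norm // expR_ge0. Qed.

Lemma expC_neq0 (z : C) : expC z != 0.
Proof. by rewrite -nc_gt0 nc_expC expR_gt0. Qed.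

(** With w = x + i y one has e^w - 1 = (e^x - 1) e^(i y) + (e^(i y) - 1); the slopes of the two
    real-variable increments tend to 1 and to i. *)
Lemma cd_expC0 : cd idfun (@expC R) 0 1.
Proof.
have [p [p1 p2 p3]] := is_derive_cd (is_derive_expR (0 : R)).
have [q [q1 q2 q3]] := cd_expi 0.
apply/cd_eps => // e e0.
have e3 : 0 < e / 2 by rewrite divr_gt0.
have H1 : (fun w : C => p (complex.Re w) * expi (complex.Im w)) @ nbhs (0 : C) --> (1 : C).
  have -> : (1 : C) = 1 * expi (complex.Im (0 : C)) by rewrite /= expi0 mulr1.
  apply: cvgCM.
    apply: (@cvg_comp _ _ _ (@complex.Re R) p (nbhs (0:C)) (nbhs (0:R)) (nbhs (1:C))).
      exact: (@continuous_Re R 0).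
    have E1 : rc (expR 0) = 1 :> C by rewrite expR0.
    by rewrite -E1; exact: p3.
  by apply: (cts_comp (@continuous_Im R) continuous_expi).
have H2 : (fun w : C => q (complex.Im w)) @ nbhs (0 : C) --> ('i%C : C).
  apply: (@cvg_comp _ _ _ (@complex.Im R) q (nbhs (0:C)) (nbhs (0:R)) (nbhs ('i%C:C))).
    exact: (@continuous_Im R 0).
  by move: q3; rewrite expi0 mulr1.
move/cvg_nc : H1 => /(_ _ e3) H1; move/cvg_nc : H2 => /(_ _ e3) H2.
near=> w.
have h1 : nc (1 - p (complex.Re w) * expi (complex.Im w)) < e / 2 by near: w.
have h2 : nc ('i%C - q (complex.Im w)) < e / 2 by near: w.
rewrite /= expC0 subr0 mul1r.
have -> : expC w - 1 - w = - ((1 - p (complex.Re w) * expi (complex.Im w)) * rc (complex.Re w)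
    + ('i%C - q (complex.Im w)) * rc (complex.Im w)).
  have a1 := p1 (complex.Re w); have a2 := q1 (complex.Im w).
  rewrite expR0 in a1; rewrite expi0 in a2.
  rewrite -[rc 0]/(0 : C) subr0 -[rc 1]/(1 : C) in a1; rewrite -[rc 0]/(0 : C) subr0 in a2.
  rewrite expCE [in X in _ - X](complexE w) -/(rc _) -/(rc _).
  rewrite !mulrBl mulrAC -a1 -a2; ring.
rewrite ncN; apply: le_trans (ncD _ _) _; rewrite !ncM !nc_real.
have r1 := Re_le_nc w; have r2 := Im_le_nc w; have r0 := nc_ge0 w.
have n1 := nc_ge0 (1 - p (complex.Re w) * expi (complex.Im w)).
have n2 := nc_ge0 ('i%C - q (complex.Im w)).
have := ler_pM n1 (normr_ge0 _) (ltW h1) r1; have := ler_pM n2 (normr_ge0 _) (ltW h2) r2; lra.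
Unshelve. all: by end_near. Qed.

Lemma cd_expC (z : C) : cd idfun (@expC R) z (expC z).
Proof.
have [p [p1 p2 p3]] := cd_expC0.
have ci : continuous (@idfun C) by move=> x; exact: cvg_id.
have := cdZ ci (expC z) (cd_comp (f := fun w : C => w - z) (g := @expC R) ci (m := 1) _ (cdB ci (cd_id idfun z) (cd_cst _ z z))).
rewrite /= subrr => /(_ cd_expC0); rewrite subr0 !mulr1.
by have -> : (fun s => expC z * expC (s - z)) = @expC R by apply/funext => s; rewrite -expCD addrC subrK.
Qed.

End Integrals.

(** * Cauchy's formula and entire functions *)

Section Goursat.
Variable R : realType.
Local Notation C := R[i].

Lemma continuous_id : continuous (@idfun C).
Proof. by move=> x; exact: cvg_id. Qed.

Lemma ctsH (y : R) : continuous (fun x : R => x +i* y : C).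
Proof. by move=> x; apply: continuousC_ReIm => /=; [exact: cvg_id|exact: cvg_cst]. Qed.

Lemma ctsV (x : R) : continuous (fun y : R => x +i* y : C).
Proof. by move=> y; apply: continuousC_ReIm => /=; [exact: cvg_cst|exact: cvg_id]. Qed.

Lemma cdH (y x : R) : cd (@rc R) (fun x : R => x +i* y : C) x 1.
Proof.
have -> : (fun x : R => x +i* y : C) = fun x => rc x + 'i%C * rc y.
  by apply/funext => s; rewrite [LHS]complexE.
by have := cdD (cd_id (@rc R) x) (cd_cst (@rc R) ('i%C * rc y) x); rewrite addr0.
Qed.

Lemma cdVert (x y : R) : cd (@rc R) (fun y : R => x +i* y : C) y 'i%C.
Proof.
have -> : (fun y : R => x +i* y : C) = fun y => rc x + 'i%C * rc y.
  by apply/funext => s; rewrite [LHS]complexE.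
have := cdD (cd_cst (@rc R) (rc x) y) (cdZ (@continuous_rc R) 'i%C (cd_id (@rc R) y)).
by rewrite mulr1 add0r.
Qed.

Section Rectangle.
Implicit Types (u v : C -> C) (x y : R).

Definition hor u y x0 x1 : C := cig x0 x1 (fun t => u (t +i* y)).
Definition ver u x y0 y1 : C := cig y0 y1 (fun t => u (x +i* t)).
(** The integral of u dz along the boundary, counterclockwise, with dz = i dy on the vertical
    sides. *)
Definition rect_int u x0 x1 y0 y1 : C :=
  hor u y0 x0 x1 + 'i%C * ver u x1 y0 y1 - hor u y1 x0 x1 - 'i%C * ver u x0 y0 y1.

Lemma ctsuH u y : continuous u -> continuous (fun t : R => u (t +i* y)).
Proof. by move=> cu; exact: (cts_comp (@ctsH y) cu). Qed.

Lemma ctsuV u x : continuous u -> continuous (fun t : R => u (x +i* t)).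
Proof. by move=> cu; exact: (cts_comp (@ctsV x) cu). Qed.

Lemma rect_intB u v x0 x1 y0 y1 : continuous u -> continuous v ->
  rect_int (fun z => u z - v z) x0 x1 y0 y1 = rect_int u x0 x1 y0 y1 - rect_int v x0 x1 y0 y1.
Proof.
move=> cu cv; rewrite /rect_int /hor /ver.
rewrite (cigB _ _ (ctsuH (y := y0) cu) (ctsuH (y := y0) cv)) (cigB _ _ (ctsuH (y := y1) cu) (ctsuH (y := y1) cv)).
rewrite (cigB _ _ (ctsuV (x := x0) cu) (ctsuV (x := x0) cv)) (cigB _ _ (ctsuV (x := x1) cu) (ctsuV (x := x1) cv)).
ring.
Qed.

Lemma rect_int_splitx u x0 x1 x2 y0 y1 : continuous u -> x0 <= x1 -> x1 <= x2 ->
  rect_int u x0 x2 y0 y1 = rect_int u x0 x1 y0 y1 + rect_int u x1 x2 y0 y1.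
Proof.
move=> cu h1 h2; rewrite /rect_int /hor.
rewrite (cig_chasles h1 h2 (ctsuH (y := y0) cu)) (cig_chasles h1 h2 (ctsuH (y := y1) cu)).
ring.
Qed.

Lemma rect_int_splity u x0 x1 y0 y1 y2 : continuous u -> y0 <= y1 -> y1 <= y2 ->
  rect_int u x0 x1 y0 y2 = rect_int u x0 x1 y0 y1 + rect_int u x0 x1 y1 y2.
Proof.
move=> cu h1 h2; rewrite /rect_int /ver.
rewrite (cig_chasles h1 h2 (ctsuV (x := x0) cu)) (cig_chasles h1 h2 (ctsuV (x := x1) cu)).
ring.
Qed.

Lemma rect_int_primitive u U x0 x1 y0 y1 : x0 <= x1 -> y0 <= y1 -> continuous u ->
  (forall z, cd idfun U z (u z)) -> rect_int u x0 x1 y0 y1 = 0.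
Proof.
move=> h1 h2 cu dU; rewrite /rect_int.
have H y : hor u y x0 x1 = U (x1 +i* y) - U (x0 +i* y).
  apply: (@cig_ftc R (fun t => U (t +i* y))) => //; first exact: ctsuH.
  by move=> t; have := cd_comp (@continuous_rc R) (dU _) (cdH y t); rewrite mulr1.
have V x : 'i%C * ver u x y0 y1 = U (x +i* y1) - U (x +i* y0).
  rewrite /ver -cigZ; last exact: ctsuV.
  apply: (@cig_ftc R (fun t => U (x +i* t))) => //.
    by apply: ctsCM; [exact: ctsC_cst|exact: ctsuV].
  by move=> t; have := cd_comp (@continuous_rc R) (dU _) (cdVert x t); rewrite mulrC.
rewrite !H !V; ring.
Qed.

Lemma nc_i : nc 'i%C = 1 :> R.
Proof. by rewrite nc_cplx expr0n expr1n add0r sqrtr1. Qed.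

Lemma rect_int_le u x0 x1 y0 y1 M : x0 <= x1 -> y0 <= y1 -> continuous u ->
  (forall x y, x0 <= x <= x1 -> y0 <= y <= y1 -> nc (u (x +i* y)) <= M) ->
  nc (rect_int u x0 x1 y0 y1) <= 2 * M * ((x1 - x0) + (y1 - y0)).
Proof.
move=> h1 h2 cu bu.
have y00 : y0 <= y0 <= y1 by rewrite lexx.
have y11 : y0 <= y1 <= y1 by rewrite lexx andbT.
have x00 : x0 <= x0 <= x1 by rewrite lexx.
have x11 : x0 <= x1 <= x1 by rewrite lexx andbT.
have A y : y0 <= y <= y1 -> nc (hor u y x0 x1) <= M * (x1 - x0).
  by move=> hy; apply: nc_cig_le => // [|t ht]; [exact: ctsuH|exact: bu].
have B x : x0 <= x <= x1 -> nc ('i%C * ver u x y0 y1) <= M * (y1 - y0).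
  move=> hx; rewrite ncM nc_i mul1r.
  by apply: nc_cig_le => // [|t ht]; [exact: ctsuV|exact: bu].
have := A _ y00; have := A _ y11; have := B _ x00; have := B _ x11.
rewrite /rect_int.
set a := hor u y0 _ _; set b := hor u y1 _ _; set c := _ * ver u x0 _ _; set d := _ * ver u x1 _ _.
have := ncDB (a + d - b) c; have := ncDB (a + d) b; have := ncD a d; lra.
Qed.

End Rectangle.

Lemma nested_intervals (x d : nat -> R) :
  (forall n, x n <= x n.+1) -> (forall n, x n.+1 + d n.+1 <= x n + d n) ->
  (forall n, 0 <= d n) -> exists X, forall n, x n <= X <= x n + d n.
Proof.
move=> x1 x2 d0.
have mono n m : (n <= m)%N -> x n <= x m.
  by move=> /subnKC <-; elim: (m - n)%N => [|k IH]; rewrite ?addn0 // addnS (le_trans IH).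
have mono2 n m : (n <= m)%N -> x m + d m <= x n + d n.
  by move=> /subnKC <-; elim: (m - n)%N => [|k IH]; rewrite ?addn0 // addnS (le_trans _ IH).
have ub n m : x m <= x n + d n.
  have [mn|/ltnW nm] := leqP m n; first by rewrite (le_trans (mono _ _ mn)) // lerDl.
  by apply: le_trans (mono2 _ _ nm); rewrite lerDl.
exists (sup (range x)) => n; apply/andP; split.
  apply: ub_le_sup; last by exists n.
  by exists (x 0%N + d 0%N) => _ [m _ <-].
apply: ge_sup; first by exists (x 0%N), 0%N.
by move=> _ [m _ <-].
Qed.

Lemma exists_pow2_gt (S e : R) : 0 < e -> exists n, S / 2 ^+ n < e.
Proof.
move=> e0; exists (Num.Def.archi_bound (S / e)).
have [S0|S0] := leP S 0.
  apply: le_lt_trans e0; rewrite mulr_le0_ge0 // invr_ge0 exprn_ge0 //.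
rewrite ltr_pdivrMr ?exprn_gt0 // -ltr_pdivrMl // mulrC.
apply: lt_le_trans (archi_boundP _) _; first by rewrite divr_ge0 // ltW.
by rewrite -natrX ler_nat; apply: ltnW; exact: ltn_expl.
Qed.

Lemma le_max4 (a b c d e : R) : e <= a + b + c + d -> [\/ e / 4 <= a, e / 4 <= b, e / 4 <= c | e / 4 <= d].
Proof.
move=> h; have [|h1] := leP (e / 4) a; first by constructor 1.
have [|h2] := leP (e / 4) b; first by constructor 2.
have [|h3] := leP (e / 4) c; first by constructor 3.
by constructor 4; lra.
Qed.

Section Bisection.
Variables (u : C -> C) (du : C -> C).
Hypothesis (udu : forall z, cd idfun u z (du z)).

Lemma cd_cts : continuous u.
Proof. by move=> z; exact: (cd_continuous continuous_id (udu z)). Qed.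

Variables (dx dy : R).
Hypotheses (dx0 : 0 <= dx) (dy0 : 0 <= dy).

Let K n (p : R * R) : R :=
  nc (rect_int u p.1 (p.1 + dx / 2 ^+ n) p.2 (p.2 + dy / 2 ^+ n)).

(** Inner sides cancel when the four quarters are added, so at least one quarter keeps a quarter of
    the modulus of the integral. *)
Let bisect_step n (p : R * R) : exists q : R * R,
  [/\ K n p / 4 <= K n.+1 q,
   p.1 <= q.1 /\ q.1 + dx / 2 ^+ n.+1 <= p.1 + dx / 2 ^+ n &
   p.2 <= q.2 /\ q.2 + dy / 2 ^+ n.+1 <= p.2 + dy / 2 ^+ n].
Proof.
have e2 (d : R) : d / 2 ^+ n = d / 2 ^+ n.+1 + d / 2 ^+ n.+1.
  by rewrite exprS; field; rewrite expf_neq0.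
case: p => x y /=.
have hx : 0 <= dx / 2 ^+ n.+1 by rewrite divr_ge0 // exprn_ge0.
have hy : 0 <= dy / 2 ^+ n.+1 by rewrite divr_ge0 // exprn_ge0.
set ex := dx / 2 ^+ n.+1 in hx *; set ey := dy / 2 ^+ n.+1 in hy *.
have x1 : x <= x + ex by rewrite lerDl.
have x2 : x + ex <= x + ex + ex by rewrite lerDl.
have y1 : y <= y + ey by rewrite lerDl.
have y2 : y + ey <= y + ey + ey by rewrite lerDl.
have H : K n (x, y) <= K n.+1 (x, y) + K n.+1 (x, y + ey) + K n.+1 (x + ex, y) + K n.+1 (x + ex, y + ey).
  rewrite /K /= !e2 -/ex -/ey !addrA.
  rewrite (rect_int_splitx _ _ cd_cts x1 x2) !(rect_int_splity _ _ cd_cts y1 y2).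
  set a := rect_int u x _ y _; set b := rect_int u x _ _ _; set c := rect_int u _ _ y _.
  set d := rect_int u _ _ _ _.
  by have := ncD (a + b) (c + d); have := ncD a b; have := ncD c d; lra.
have ax : x <= x /\ x + ex <= x + dx / 2 ^+ n by rewrite (e2 dx) -/ex addrA.
have bx : x <= x + ex /\ x + ex + ex <= x + dx / 2 ^+ n by rewrite (e2 dx) -/ex addrA.
have ay : y <= y /\ y + ey <= y + dy / 2 ^+ n by rewrite (e2 dy) -/ey addrA.
have by_ : y <= y + ey /\ y + ey + ey <= y + dy / 2 ^+ n by rewrite (e2 dy) -/ey addrA.
by case/le_max4: H => H; [exists (x, y)|exists (x, y + ey)|exists (x + ex, y)|exists (x + ex, y + ey)].
Qed.

(** The chosen quarters shrink to a point z. Near z, u differs little from its affine approximation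
    p, and p has a primitive, so its boundary integral vanishes; what remains is too small for the
    lower bound k / 4^n. *)
Lemma goursat0 x0 y0 : rect_int u x0 (x0 + dx) y0 (y0 + dy) = 0.
Proof.
have [f fP] := choice (fun np : nat * (R * R) => bisect_step np.1 np.2).
pose s := fix s n := if n is n'.+1 then f (n', s n') else (x0, y0).
have sP n := fP (n, s n).
have [X XP] := @nested_intervals (fun n => (s n).1) (fun n => dx / 2 ^+ n)
  (fun n => let: And3 _ (conj h _) _ := sP n in h) (fun n => let: And3 _ (conj _ h) _ := sP n in h)
  (fun n => divr_ge0 dx0 (exprn_ge0 n (ler0n R 2))).
have [Y YP] := @nested_intervals (fun n => (s n).2) (fun n => dy / 2 ^+ n)
  (fun n => let: And3 _ _ (conj h _) := sP n in h) (fun n => let: And3 _ _ (conj _ h) := sP n in h)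
  (fun n => divr_ge0 dy0 (exprn_ge0 n (ler0n R 2))).
have KP n : K 0 (x0, y0) / 4 ^+ n <= K n (s n).
  elim: n => [|n IH]; first by rewrite expr0 divr1.
  have [h _ _] := sP n; apply: le_trans h; rewrite /= exprS invfM mulrCA mulrC.
  by rewrite ler_wpM2r // invr_ge0.
apply/eqP; rewrite -nc_eq0; apply/eqP/le_anti; rewrite nc_ge0 andbT leNgt; apply/negP => K0.
have {}K0 : 0 < K 0 (x0, y0) by rewrite /K /= !divr1.
set k := K 0 (x0, y0) in K0 KP.
pose S := dx + dy + 1; have S0 : 0 < S by rewrite ltr_wpDl // addr_ge0.
(* With this e the final bound 2 e S^2 / 4^n is half of k / 4^n. *)
pose e := k / (4 * S ^+ 2); have e0 : 0 < e by rewrite divr_gt0 // mulr_gt0 // exprn_gt0.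
have /(_ _ e0)/nbhs_nc[d d0 dP] := (cd_eps _ _ (fun s => id)).1 (udu (X +i* Y)).
have [n nP] := exists_pow2_gt S d0.
pose z := X +i* Y.
pose p w := u z + du z * (w - z).
have cid := continuous_id.
have cp : continuous p.
  by apply: ctsCD; [exact: ctsC_cst|apply: ctsCM; [exact: ctsC_cst|apply: ctsCB; [exact: cid|exact: ctsC_cst]]].
have := KP n; rewrite leNgt => /negP; apply.
pose w := dx / 2 ^+ n; pose h := dy / 2 ^+ n.
have w0 : 0 <= w by rewrite divr_ge0 // exprn_ge0.
have h0 : 0 <= h by rewrite divr_ge0 // exprn_ge0.
have p0 : rect_int p (s n).1 ((s n).1 + w) (s n).2 ((s n).2 + h) = 0.
  apply: (@rect_int_primitive _ (fun w => u z * w + du z / 2 * (w - z) ^+ 2)); [by rewrite lerDl|by rewrite lerDl|exact: cp|].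
  move=> v; have := cdD (cdZ cid (u z) (cd_id idfun v)) (cdZ cid (du z / 2) (cdX cid 2 (cdB cid (cd_id idfun v) (cd_cst _ z v)))).
  by congr cd; rewrite /p /= expr1; field.
rewrite /K -/w -/h -[rect_int u _ _ _ _]subr0 -p0 -(rect_intB _ _ _ _ cd_cts cp).
apply: (@le_lt_trans _ _ (2 * (e * (w + h)) * (w + h))).
  have := @rect_int_le (fun v => u v - p v) (s n).1 ((s n).1 + w) (s n).2 ((s n).2 + h) (e * (w + h)).
  have -> : (s n).1 + w - (s n).1 = w by ring.
  have -> : (s n).2 + h - (s n).2 = h by ring.
  rewrite !lerDl => /(_ w0 h0) B; apply: B; first by apply: ctsCB; [exact: cd_cts|exact: cp].
  move=> x y /andP[a1 a2] /andP[b1 b2].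
  have H1 : nc (x +i* y - z) <= w + h.
    apply: le_trans (nc_le_ReIm _) _; rewrite /= lerD // ler_norml.
      by have /andP[] := XP n; rewrite -/w => *; apply/andP; split; lra.
    by have /andP[] := YP n; rewrite -/h => *; apply/andP; split; lra.
  have wh : w + h < d.
    apply: le_lt_trans nP; rewrite /w /h -mulrDl ler_wpM2r ?invr_ge0 ?exprn_ge0 //.
    by rewrite /S lerDl.
  have := dP (x +i* y) (le_lt_trans H1 wh); rewrite /= -/z.
  have -> : u (x +i* y) - u z - du z * (x +i* y - z) = u (x +i* y) - p (x +i* y) by rewrite /p; ring.
  by move/le_trans; apply; rewrite ler_pM2l.
have wS : w + h <= S / 2 ^+ n.
  by rewrite /w /h -mulrDl ler_wpM2r ?invr_ge0 ?exprn_ge0 // /S lerDl.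
have : (w + h) ^+ 2 <= S ^+ 2 / 4 ^+ n.
  have -> : (4 : R) ^+ n = (2 ^+ n) ^+ 2 by rewrite exprAC; congr (_ ^+ n); ring.
  by rewrite -expr_div_n ler_sqr ?nnegrE ?addr_ge0 // divr_ge0 ?exprn_ge0 // ltW.
have n0 : 0 < (4 : R) ^+ n by rewrite exprn_gt0.
move=> H; have -> : 2 * (e * (w + h)) * (w + h) = 2 * e * (w + h) ^+ 2 by ring.
apply: (@le_lt_trans _ _ (2 * e * (S ^+ 2 / 4 ^+ n))); first by rewrite ler_pM2l // mulr_gt0.
have -> : 2 * e * (S ^+ 2 / 4 ^+ n) = k / 4 ^+ n / 2.
  by rewrite /e; field; rewrite !gt_eqF.
have : 0 < k / 4 ^+ n by rewrite divr_gt0.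
lra.
Qed.

End Bisection.

Lemma goursat (u du : C -> C) (x0 x1 y0 y1 : R) : (forall z, cd idfun u z (du z)) ->
  x0 <= x1 -> y0 <= y1 -> rect_int u x0 x1 y0 y1 = 0.
Proof.
move=> udu x01 y01; have := goursat0 udu (dx := x1 - x0) (dy := y1 - y0).
by rewrite !subr_ge0 => /(_ x01 y01 x0 y0); rewrite ![_ + (_ - _)]addrC !subrK.
Qed.

Definition cmean (phi : R -> C) : C := rc (2 * pi)^-1 * cig 0 (2 * pi) phi.
Definition mean (phi : R -> R) : R := (2 * pi)^-1 * ig 0 (2 * pi) phi.

Lemma pi2_gt0 : 0 < 2 * pi :> R.
Proof. by rewrite mulr_gt0 // pi_gt0. Qed.

Lemma rc_neq0 (x : R) : (rc x != 0) = (x != 0).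
Proof. by rewrite -[0 in LHS]/(rc 0) (inj_eq (@complexI R)). Qed.

Lemma cd_expiV t : cd (@rc R) (fun t => (expi t)^-1) t (- 'i%C * (expi t)^-1).
Proof.
have := cdV (@continuous_rc R) (expi_neq0 t) (cd_expi t); congr cd.
by field; exact: expi_neq0.
Qed.

Lemma cts_expiV : continuous (fun t : R => (expi t)^-1).
Proof. by apply: ctsCV; [exact: expi_neq0|exact: continuous_expi]. Qed.

Lemma cig_expiV : cig 0 (2 * pi) (fun t : R => (expi t)^-1) = 0.
Proof.
have i0 : 'i%C != 0 :> C by rewrite -nc_gt0 nc_i.
rewrite (@cig_ftc R (fun t => 'i%C * (expi t)^-1)).
- by rewrite expi0 expi2pi subrr.
- by rewrite ltW // pi2_gt0.
- exact: cts_expiV.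
- move=> t; have := cdZ (@continuous_rc R) 'i%C (cd_expiV t); congr cd.
  by rewrite mulrA mulrN -expr2 sqr_i opprK mul1r.
Qed.

(* Goursat's theorem is applied to x + i y |-> f (z + e^(x + i y)) e^-(x + i y), which has period
   2 pi in y: its integral over a period does not depend on x, and x --> -oo identifies it. *)
Lemma derivative_cmean (f df : C -> C) z : (forall z, cd idfun f z (df z)) ->
  df z = cmean (fun t => f (z + expi t) / expi t).
Proof.
move=> fdf; have cf := cd_cts fdf; have cid := continuous_id.
have P0 := pi2_gt0.
pose W rho := cig 0 (2 * pi) (fun t => f (z + rc rho * expi t) / (rc rho * expi t)).
pose u w := f (z + expC w) * (expC w)^-1.
have K w : exists l, cd idfun u w l.
  eexists; apply: (cdM cid).
    apply: (cd_comp (f := fun w => z + expC w) (g := f) cid); first exact: fdf.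
    by apply: cdD; [exact: cd_cst|exact: cd_expC].
  by apply: (cdV cid); [exact: expC_neq0|exact: cd_expC].
have [du udu] := choice K.
have WE x : W (expR x) = ver u x 0 (2 * pi).
  by apply: eq_cig => t _; rewrite /u expCE.
have Wconst x : x <= 0 -> W (expR x) = W 1.
  move=> x0; rewrite -expR0 !WE.
  have := goursat udu x0 (ltW P0); rewrite /rect_int.
  have -> : hor u 0 x 0 = hor u (2 * pi) x 0.
    by apply: eq_cig => t _; rewrite /u !expCE /= expi0 expi2pi.
  rewrite [_ + 'i%C * _ - _]addrAC subrr add0r => /eqP; rewrite -mulrBr mulf_eq0 subr_eq0.
  by rewrite -nc_eq0 nc_i oner_eq0 => /eqP ->.
have cE (rho : R) : continuous (fun t => rc rho * expi t) by apply: ctsCM; [exact: ctsC_cst|exact: continuous_expi].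
suff H : W 1 = df z * rc (2 * pi).
  rewrite /cmean; have -> : cig 0 (2 * pi) (fun t => f (z + expi t) / expi t) = W 1.
    by apply: eq_cig => t _; rewrite mul1r.
  by rewrite H mulrCA -rmorphM mulVf ?mulr1 // gt_eqF.
apply/eqP; rewrite -subr_eq0 -nc_eq0; apply/eqP/le_anti; rewrite nc_ge0 andbT.
apply/ler_addgt0Pr => e0 e00; rewrite add0r.
pose e := e0 / (2 * pi); have e_gt0 : 0 < e by rewrite divr_gt0.
have /(_ _ e_gt0)/nbhs_nc[d d0 dP] := (cd_eps _ _ (fun s => id)).1 (fdf z).
(* Then e^x < d, because e^(1/d) >= 1 + 1/d > 1/d. *)
pose x := - d^-1.
have x0 : x <= 0 by rewrite oppr_le0 invr_ge0 ltW.
have xd : expR x < d.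
  rewrite /x expRN -[ltRHS]invrK ltf_pV2 ?posrE ?invr_gt0 ?expR_gt0 //.
  by apply: lt_le_trans (expR_ge1Dx _); rewrite ltrDr.
rewrite -(Wconst _ x0); set rho := expR x in xd *.
have r0 : 0 < rho by exact: expR_gt0.
have rE t : rc rho * expi t != 0 by rewrite mulf_neq0 ?expi_neq0 // rc_neq0 gt_eqF.
have c1 : continuous (fun t => f (z + rc rho * expi t) / (rc rho * expi t)).
  apply: ctsCM; last by apply: ctsCV; [exact: rE|exact: cE].
  apply: (@cts_comp _ _ _ (fun t => z + rc rho * expi t) f); last exact: cf.
  by apply: ctsCD; [exact: ctsC_cst|exact: cE].
have c2 : continuous (fun t => f z / rc rho * (expi t)^-1).
  by apply: ctsCM; [exact: ctsC_cst|exact: cts_expiV].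
(* The term f z / (rho e^(i t)) may be inserted because it integrates to 0; the integrand becomes
   the error of the first-order expansion of f at z, divided by rho e^(i t). *)
have -> : W rho - df z * rc (2 * pi) = cig 0 (2 * pi) (fun t => f (z + rc rho * expi t) / (rc rho * expi t)
     - f z / rc rho * (expi t)^-1 - df z).
  rewrite (cigB _ _ (ctsCB c1 c2) (@ctsC_cst _ _ (df z))) (cigB _ _ c1 c2) (cigZ _ _ _ cts_expiV).
  by rewrite cig_expiV mulr0 subr0 cig_cst ?subr0 // ltW.
apply: le_trans (nc_cig_le (M := e) (ltW P0) _ _) _.
- by apply: ctsCB; [exact: (ctsCB c1 c2)|exact: ctsC_cst].
- move=> t _.
  have n1 : nc (rc rho * expi t) = rho by rewrite ncM nc_expi mulr1 nc_real gtr0_norm.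
  have -> : f (z + rc rho * expi t) / (rc rho * expi t) - f z / rc rho / expi t - df z =
    (f (z + rc rho * expi t) - f z - df z * (z + rc rho * expi t - z)) / (rc rho * expi t).
    by field; rewrite expi_neq0 rc_neq0 gt_eqF.
  rewrite nc_div ler_pdivrMr n1 //.
  have := dP (z + rc rho * expi t); rewrite /= [z + _ - z]addrAC subrr add0r n1.
  exact.
- by rewrite subr0 /e mulfVK // gt_eqF.
Qed.

End Goursat.

(** * Integrals depending on a complex parameter *)

Section ParametricIntegrals.
Variable R : realType.
Local Notation C := R[i].

Lemma ctsCX (T : topologicalType) (f : T -> C) n : continuous f -> continuous (fun t => f t ^+ n).
Proof.
move=> cf; elim: n => [|n IH]; first exact: ctsC_cst.
have -> : (fun t => f t ^+ n.+1) = (fun t => f t * f t ^+ n) by apply/funext => t; rewrite exprS.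
exact: (ctsCM cf IH).
Qed.

(** Nothing is assumed of the continuity of dg, so the increment is not written as an integral: a
    rotation makes it real and the real mean value theorem applies. *)
Lemma mean_value_ineq (g dg : R -> C) (M : R) :
  (forall s, 0 <= s <= 1 -> cd (@rc R) g s (dg s)) ->
  (forall s, 0 <= s <= 1 -> nc (dg s) <= M) -> nc (g 1 - g 0) <= M.
Proof.
move=> gd gM; set I := g 1 - g 0.
have [I0|I0] := eqVneq I 0.
  by rewrite I0 nc0; apply: le_trans (nc_ge0 (dg 0)) (gM _ _); rewrite lexx ler01.
have nI : 0 < nc I by rewrite nc_gt0.
pose u := I^*%C / rc (nc I).
have nu : nc u = 1.
  rewrite nc_div nc_real ger0_norm ?nc_ge0 //; have -> : nc I^*%C = nc I by rewrite /nc normcJ.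
  by rewrite divff // gt_eqF.
have uI : u * I = rc (nc I).
  by rewrite /u mulrAC [_ * I]mulrC -sqr_normc ncE -/(rc _) expr2 mulfK // rc_neq0 gt_eqF.
pose F s := complex.Re (u * g s).
have dF (s : R) : s \in `[0, 1] -> is_derive s 1 F (complex.Re (u * dg s)).
  rewrite in_itv /= => h; apply: cd_is_derive_Re; apply: cdZ; [exact: continuous_rc|exact: gd].
have h1 (s : R) : s \in `]0, 1[ -> is_derive s 1 F (complex.Re (u * dg s)).
  by move=> s01; apply: dF; exact: subset_itv_oo_cc.
have h2 : {within `[0, 1], continuous F}.
  apply: continuous_in_subspaceT => s; rewrite inE => s01.
  by apply: differentiable_continuous; apply/derivable1_diffP; have [] := dF s s01.
have [c c01] := MVT_segment ler01 h1 h2.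
rewrite subr0 mulr1 => E.
have <- : F 1 - F 0 = nc I.
  by rewrite /F -ReN -ReD -mulrN -mulrDr -/I uI.
rewrite E; apply: le_trans (ler_norm _) _; apply: le_trans (Re_le_nc _) _.
by rewrite ncM nu mul1r; apply: gM; move: c01; rewrite in_itv.
Qed.

Lemma mean_value_ineqC (f df : C -> C) (u v : C) (M : R) :
  (forall s, 0 <= s <= 1 -> cd idfun f (u + rc s * (v - u)) (df (u + rc s * (v - u)))) ->
  (forall s, 0 <= s <= 1 -> nc (df (u + rc s * (v - u))) <= M) ->
  nc (f v - f u) <= M * nc (v - u).
Proof.
move=> fd fM.
have := @mean_value_ineq (fun s => f (u + rc s * (v - u))) (fun s => df (u + rc s * (v - u)) * (v - u)) (M * nc (v - u)).
have -> : u + rc 1 * (v - u) = v by rewrite /rc; ring.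
have -> : u + rc 0 * (v - u) = u by rewrite /rc; ring.
apply=> s s01; last by rewrite ncM ler_wpM2r ?nc_ge0 //; exact: fM.
apply: (cd_comp (f := fun s => u + rc s * (v - u)) (@continuous_rc R) (fd s s01)).
have := cdD (cd_cst (@rc R) u s) (cdM (@continuous_rc R) (cd_id (@rc R) s) (cd_cst (@rc R) (v - u) s)).
by rewrite mulr0 addr0 mul1r add0r.
Qed.

Lemma segment_const (f : C -> C) (u v : C) :
  (forall s, 0 <= s <= 1 -> cd idfun f (u + rc s * (v - u)) 0) -> f v = f u.
Proof.
move=> fd; apply/eqP; rewrite -subr_eq0 -nc_eq0; apply/eqP/le_anti; rewrite nc_ge0 andbT.
have := @mean_value_ineqC f (fun=> 0) u v 0 fd; rewrite mul0r; apply=> s _.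
by rewrite nc0.
Qed.

Lemma cd_near (f g : C -> C) z l : (\forall w \near z, f w = g w) ->
  cd idfun f z l -> cd idfun g z l.
Proof.
move=> fg H0; have H := (cd_eps _ _ (fun s => id)).1 H0; apply/(cd_eps _ _ (fun s => id)) => e e0.
have fgz := nbhs_singleton fg.
by have := H e e0; apply: filterS2 fg => w <-; rewrite fgz.
Qed.

Lemma nbhs_disc (z0 z : C) (r : R) : nc (z - z0) < r -> \forall w \near z, nc (w - z0) < r.
Proof.
move=> zr; apply/nbhs_nc; exists (r - nc (z - z0)); first by rewrite subr_gt0.
move=> w; rewrite ltrBrDr => h; apply: le_lt_trans h.
have -> : w - z0 = (w - z) + (z - z0) by ring.
exact: ncD.
Qed.

Section Uniformity.
Variables (D : C -> R -> C) (a b : R) (u0 : C).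
Hypothesis Dc : forall t, {for (u0, t), continuous (fun p : C * R => D p.1 p.2)}.

(** Compactness of [a, b] turns continuity at each point (u0, t) into an estimate uniform in t. *)
Lemma unif_param (e : R) : 0 < e -> exists2 d, 0 < d & forall u t, a <= t <= b ->
  nc (u - u0) < d -> nc (D u t - D u0 t) <= e.
Proof.
move=> e0.
have := (compact_near_coveringP `[a, b]%classic).1 (@segment_compact R a b).
move=> /(_ C (nbhs u0) (fun u t => nc (D u t - D u0 t) <= e) _) H.
have /nbhs_nc[d d0 dP] : \forall u \near u0, `[a, b]%classic `<=` (fun t => nc (D u t - D u0 t) <= e).
  apply: H => t0 _.
  have e2 : 0 < e / 2 by rewrite divr_gt0.
  have /(@cvg_nc _ _ (nbhs (u0, t0))) /(_ _ e2) [[A B] /= [nA nB] AB] := Dc (t := t0).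
  exists (B, A) => //= -[t u] /= [Bt Au].
  have h1 := AB (u, t) (conj Au Bt).
  have h2 := AB (u0, t) (conj (nbhs_singleton nA) Bt).
  have -> : D u t - D u0 t = (D u0 t0 - D u0 t) - (D u0 t0 - D u t) by ring.
  by apply: le_trans (ncDB _ _) _; rewrite /= in h1 h2; lra.
by exists d => // u t tab /dP; apply; rewrite /= in_itv.
Qed.

Lemma cts_slice : continuous (D u0).
Proof.
move=> t; apply: (@cvg_comp _ _ _ (fun t => (u0, t)) (fun p => D p.1 p.2) (nbhs t) (nbhs (u0, t))); last exact: (Dc (t := t)).
move=> P [[A B] /= [nA nB] AB]; rewrite nbhs_filterE /=; apply: filterS nB => s Bs.
by apply: AB; split; [exact: nbhs_singleton nA|exact: Bs].
Qed.

Lemma cts_param_integral d0 : a <= b -> 0 < d0 ->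
  (forall u, nc (u - u0) < d0 -> continuous (D u)) ->
  {for u0, continuous (fun u => cig a b (D u))}.
Proof.
move=> ab d0_gt0 Dcu; apply/(@cvg_nc _ _ (nbhs u0)) => e e0.
pose e1 := e / (b - a + 1); have ba : 0 < b - a + 1 by lra.
have e1_gt0 : 0 < e1 by rewrite divr_gt0.
have [d d_gt0 dP] := unif_param e1_gt0.
have n1 : \forall u \near u0, nc (u - u0) < d by apply: nbhs_disc; rewrite subrr nc0.
have n2 : \forall u \near u0, nc (u - u0) < d0 by apply: nbhs_disc; rewrite subrr nc0.
apply: filterS2 n1 n2 => u u1 u2.
rewrite ncB -(cigB _ _ (Dcu u u2) cts_slice).
apply: le_lt_trans (nc_cig_le (M := e1) ab _ _) _.
- exact: (ctsCB (Dcu u u2) cts_slice).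
- by move=> t tab; apply: dP.
- rewrite /e1 mulrAC ltr_pdivrMr // ltr_pM2l //; lra.
Qed.

Variables (Phi : C -> R -> C) (d0 : R).
Hypothesis d0_gt0 : 0 < d0.
Hypothesis Phic : forall u, nc (u - u0) < d0 -> continuous (Phi u).
Hypothesis PhiD : forall u t, nc (u - u0) < d0 -> cd idfun (fun v => Phi v t) u (D u t).

(** For fixed t the function v |-> Phi v t - v D u0 t has derivative D v t - D u0 t, uniformly small
    near u0; the mean value inequality bounds its increment, and integration in t keeps the
    bound. *)
Lemma leibniz : a <= b -> cd idfun (fun u => cig a b (Phi u)) u0 (cig a b (D u0)).
Proof.
move=> ab; apply/cd_eps => // e e0.
pose e1 := e / (b - a + 1); have ba : 0 < b - a + 1 by lra.
have e1_gt0 : 0 < e1 by rewrite divr_gt0.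
have [d d_gt0 dP] := unif_param e1_gt0.
have n1 : \forall u \near u0, nc (u - u0) < d by apply: nbhs_disc; rewrite subrr nc0.
have n2 : \forall u \near u0, nc (u - u0) < d0 by apply: nbhs_disc; rewrite subrr nc0.
apply: filterS2 n1 n2 => u u1 u2; rewrite /=.
have u00 : nc (u0 - u0) < d0 by rewrite subrr nc0.
have seg s : 0 <= s <= 1 -> nc (u0 + rc s * (u - u0) - u0) <= nc (u - u0).
  move=> /andP[s0 s1]; have -> : u0 + rc s * (u - u0) - u0 = rc s * (u - u0) by ring.
  by rewrite ncM nc_real ger0_norm // ler_piMl // nc_ge0.
have ct := ctsCM (@ctsC_cst R _ (u - u0)) cts_slice.
have -> : cig a b (Phi u) - cig a b (Phi u0) - cig a b (D u0) * (u - u0) =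
  cig a b (fun t => Phi u t - Phi u0 t - (u - u0) * D u0 t).
  rewrite (cigB _ _ (ctsCB (Phic u2) (Phic u00)) ct) (cigB _ _ (Phic u2) (Phic u00)) (cigZ _ _ _ cts_slice).
  by rewrite [_ * (u - u0)]mulrC.
apply: le_trans (nc_cig_le (M := e1 * nc (u - u0)) ab _ _) _.
- exact: (ctsCB (ctsCB (Phic u2) (Phic u00)) ct).
- move=> t tab.
  pose F v := Phi v t - v * D u0 t.
  have -> : Phi u t - Phi u0 t - (u - u0) * D u0 t = F u - F u0 by rewrite /F; ring.
  apply: (@mean_value_ineqC F (fun v => D v t - D u0 t)) => s s01.
    have su : nc (u0 + rc s * (u - u0) - u0) < d0 by apply: le_lt_trans (seg s s01) u2.
    have := cdB (@continuous_id R) (PhiD t su) (cdM (@continuous_id R) (cd_id idfun _) (cd_cst idfun (D u0 t) _)).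
    by rewrite mul1r mulr0 addr0.
  by apply: dP => //; apply: le_lt_trans (seg s s01) u1.
- rewrite mulrAC ler_wpM2r ?nc_ge0 // /e1 mulrAC ler_pdivrMr // ler_pM2l //; lra.
Qed.

End Uniformity.

Definition circ (r t : R) : C := rc r * expi t.

Lemma cts_circ r : continuous (circ r).
Proof. by apply: ctsCM; [exact: ctsC_cst|exact: continuous_expi]. Qed.

Lemma cd_circ r t : cd (@rc R) (circ r) t ('i%C * circ r t).
Proof.
have := cdZ (@continuous_rc R) (rc r) (cd_expi t); congr cd.
by rewrite /circ mulrCA.
Qed.

Lemma nc_circ r t : 0 <= r -> nc (circ r t) = r.
Proof. by move=> r0; rewrite ncM nc_expi mulr1 nc_real ger0_norm. Qed.

Lemma circ2pi r : circ r (2 * pi) = circ r 0.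
Proof. by rewrite /circ expi2pi expi0. Qed.

Lemma circ_sub_neq0 r t u : nc u < r -> circ r t - u != 0.
Proof.
move=> ur; rewrite subr_eq0; apply/eqP => E.
have r0 : 0 <= r by apply: le_trans (nc_ge0 u) (ltW ur).
by move: ur; rewrite -E nc_circ // ltxx.
Qed.

Lemma cig_periodic (F phi : R -> C) : F 0 = F (2 * pi) -> continuous phi ->
  (forall t, cd (@rc R) F t (phi t)) -> cig 0 (2 * pi) phi = 0.
Proof.
by move=> F0 cphi dF; rewrite (cig_ftc (ltW (pi2_gt0 R)) cphi dF) F0 subrr.
Qed.

Lemma cts_fst : continuous (fun p : C * R => p.1).
Proof. by move=> p; exact: cvg_fst. Qed.

Lemma cts_snd : continuous (fun p : C * R => p.2).
Proof. by move=> p; exact: cvg_snd. Qed.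

(** Since phi is any continuous density, the formula can be iterated: differentiating a Cauchy
    integral again gives an integral of the same kind. *)
Lemma cauchy_type (phi : R -> C) (r : R) (n : nat) (u0 : C) : continuous phi -> nc u0 < r ->
  cd idfun (fun u => cig 0 (2 * pi) (fun t => phi t / (circ r t - u) ^+ n)) u0
    (n%:R * cig 0 (2 * pi) (fun t => phi t / (circ r t - u0) ^+ n.+1)).
Proof.
move=> cphi u0r.
have d0 : 0 < r - nc u0 by rewrite subr_gt0.
have inr u : nc (u - u0) < r - nc u0 -> nc u < r.
  rewrite ltrBrDr => h; apply: le_lt_trans h.
  have {1}-> : u = u - u0 + u0 by ring.
  exact: ncD.
have cpow u m : nc u < r -> continuous (fun t => phi t / (circ r t - u) ^+ m).
  move=> ur; apply: (ctsCM cphi); apply: ctsCV; first by move=> t; rewrite expf_neq0 // circ_sub_neq0.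
  by apply: ctsCX; apply: ctsCB; [exact: cts_circ|exact: ctsC_cst].
rewrite -cigZ; last exact: cpow.
apply: (@leibniz (fun u t => n%:R * (phi t / (circ r t - u) ^+ n.+1)) 0 (2 * pi) u0 _
  (fun u t => phi t / (circ r t - u) ^+ n) (r - nc u0) d0).
- move=> t.
  have H : {for (u0, t), continuous (fun p : C * R => circ r p.2 - p.1)}.
    apply: cvgCB; last exact: cts_fst.
    exact: (cts_comp cts_snd (@cts_circ r)).
  have H2 m : (fun p : C * R => (circ r p.2 - p.1) ^+ m) @ nbhs (u0, t) --> (circ r t - u0) ^+ m.
    elim: m => [|m IH]; first exact: cvgC_cst.
    have -> : (fun p : C * R => (circ r p.2 - p.1) ^+ m.+1) = (fun p => (circ r p.2 - p.1) * (circ r p.2 - p.1) ^+ m).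
      by apply/funext => p; rewrite exprS.
    by rewrite exprS; exact: (cvgCM H IH).
  apply: (cvgCM (cvgC_cst _)); apply: cvgCM; first exact: (cts_comp cts_snd cphi).
  by apply: (cvgCV _ (H2 _)); rewrite expf_neq0 // circ_sub_neq0.
- by move=> u /inr ur; exact: cpow.
- move=> u t /inr ur; have nz := circ_sub_neq0 t ur.
  have cid := @continuous_id R.
  have h1 := cdB cid (cd_cst idfun (circ r t) u) (cd_id idfun u).
  have := cdZ cid (phi t) (cdV (f := fun s => (circ r t - s) ^+ n) cid (expf_neq0 n nz) (cdX cid n h1)); congr cd.
  case: n {cpow} => [|n]; first by rewrite !mul0r oppr0 mul0r mulr0.
  by rewrite /= sub0r !exprS; field; rewrite expf_neq0 // nz.
- by rewrite ltW // pi2_gt0.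
Qed.

End ParametricIntegrals.

(** * Cauchy's integral formula in a disc *)

Section CauchyFormula.
Variable R : realType.
Local Notation C := R[i].

Lemma seg_lt (u v : C) (s r : R) : 0 <= s <= 1 -> nc u < r -> nc v < r -> nc (u + rc s * (v - u)) < r.
Proof.
move=> /andP[s0 s1] ur vr.
have -> : u + rc s * (v - u) = rc (1 - s) * u + rc s * v by rewrite /rc rmorphB rmorph1; ring.
apply: le_lt_trans (ncD _ _) _; rewrite !ncM !nc_real !ger0_norm ?subr_ge0 //.
have [->|s_neq0] := eqVneq s 0; first by rewrite subr0 mul1r mul0r addr0.
have s_gt0 : 0 < s by rewrite lt_neqAle eq_sym s_neq0.
have h1 : (1 - s) * nc u <= (1 - s) * r by rewrite ler_wpM2l ?subr_ge0 // ltW.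
have h2 : s * nc v < s * r by rewrite ltr_pM2l.
lra.
Qed.

(** As a function of the pole the integral is constant: its derivative is the integral of z/(z -
    v)^2 over the circle, which is the t-derivative of i/(z - v). At v = 0 the integrand is 1. *)
Lemma cig_cauchy_kernel (r : R) (u : C) : nc u < r ->
  cig 0 (2 * pi) (fun t => circ r t / (circ r t - u)) = rc (2 * pi).
Proof.
move=> ur; have r0 : 0 < r by apply: le_lt_trans (nc_ge0 u) ur.
have P0 := pi2_gt0 R.
pose L v := cig 0 (2 * pi) (fun t => circ r t / (circ r t - v) ^+ 1).
have L0 : L 0 = rc (2 * pi).
  have -> : rc (2 * pi) = 1 * rc (2 * pi - 0) :> C by rewrite mul1r subr0.
  rewrite -cig_cst; last exact: ltW.
  apply: eq_cig => t _; rewrite expr1 subr0 divff //.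
  by have := @circ_sub_neq0 R r t 0; rewrite subr0 nc0; apply.
rewrite -L0 -[LHS]/(L u); apply: segment_const => s s01; rewrite add0r subr0.
have sr : nc (rc s * u) < r.
  by have := @seg_lt 0 u s r s01; rewrite nc0 add0r subr0; apply.
have := cauchy_type 1 (@cts_circ R r) sr; congr cd.
rewrite mul1r; apply: (@cig_periodic R (fun t => 'i%C / (circ r t - rc s * u))).
- by rewrite circ2pi.
- apply: ctsCM; first exact: cts_circ.
  apply: ctsCV => [t|]; first by rewrite expf_neq0 // circ_sub_neq0.
  by apply: ctsCX; apply: ctsCB; [exact: cts_circ|exact: ctsC_cst].
- move=> t; have crc := @continuous_rc R.
  have := cdZ crc 'i%C (cdV (f := fun t => circ r t - rc s * u) crc (circ_sub_neq0 t sr) (cdB crc (cd_circ r t) (cd_cst (@rc R) (rc s * u) t))).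
  congr cd; rewrite subr0 mulrA mulrN mulrA -expr2 sqr_i; ring.
Qed.

Section Disc.
Variables (k dk : C -> C) (rho : R).
Hypothesis kd : forall z, nc z < rho -> cd idfun k z (dk z).
Hypothesis dkc : forall z, nc z < rho -> {for z, continuous dk}.

Lemma cts_disc_comp (T : topologicalType) (g : T -> C) : continuous g ->
  (forall t, nc (g t) < rho) -> continuous (fun t => k (g t)).
Proof.
move=> cg gr t; apply: (continuous_comp (cg t)).
exact: (cd_continuous (@continuous_id R) (kd (gr t))).
Qed.

(* J(l) is the integral for the map k (u + l (circ - u)); its derivative is the integral of a
   derivative in t, hence 0, and J(0) is the value wanted. *)
Lemma cauchy_formula (r : R) (u : C) : nc u < r -> r < rho ->
  k u = cmean (fun t => k (circ r t) * (circ r t / (circ r t - u))).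
Proof.
move=> ur rrho; have r0 : 0 < r by apply: le_lt_trans (nc_ge0 u) ur.
have P0 := pi2_gt0 R; have crc := @continuous_rc R; have cid := @continuous_id R.
have ck : continuous (fun t => circ r t / (circ r t - u)).
  apply: ctsCM; first exact: cts_circ.
  apply: ctsCV => [t|]; first exact: circ_sub_neq0.
  by apply: ctsCB; [exact: cts_circ|exact: ctsC_cst].
pose J l := cig 0 (2 * pi) (fun t => k (u + l * (circ r t - u)) * (circ r t / (circ r t - u))).
have J0 : J 0 = k u * rc (2 * pi).
  rewrite -(cig_cauchy_kernel ur) -cigZ //; apply: eq_cig => t _.
  by rewrite mul0r addr0.
have J1 : J 1 = rc (2 * pi) * cmean (fun t => k (circ r t) * (circ r t / (circ r t - u))).
  rewrite /cmean mulrA -rmorphM mulfV ?gt_eqF // mul1r.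
  by apply: eq_cig => t _; rewrite mul1r addrC subrK.
suff : J 1 = J 0.
  rewrite J1 J0 mulrC => /(mulIf _) -> //.
  by rewrite rc_neq0 gt_eqF.
apply: segment_const => s s01; rewrite add0r subr0 mulr1.
(* As |z - u| < 2 r on the circle, moving l by less than d moves u + l (z - u) by less than rho - r,
   so it stays in the disc where k is differentiable. *)
pose d := (rho - r) / (2 * r).
have d_gt0 : 0 < d by rewrite divr_gt0 ?subr_gt0 // mulr_gt0.
have zu t : nc (circ r t - u) < 2 * r.
  apply: le_lt_trans (ncDB _ _) _; rewrite nc_circ ?ltW //; lra.
have ind l t : nc (l - rc s) < d -> nc (u + l * (circ r t - u)) < rho.
  move=> ld.
  have -> : u + l * (circ r t - u) = (u + rc s * (circ r t - u)) + (l - rc s) * (circ r t - u) by ring.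
  apply: le_lt_trans (ncD _ _) _; rewrite ncM.
  have h1 : nc (u + rc s * (circ r t - u)) <= r.
    apply/ler_addgt0Pr => e e0; apply: ltW; apply: seg_lt => //.
      by apply: lt_trans ur _; rewrite ltrDl.
    by rewrite nc_circ ?ltW // ltrDl.
  have h2 : nc (l - rc s) * nc (circ r t - u) < rho - r.
    have -> : rho - r = d * (2 * r) by rewrite /d mulfVK // gt_eqF // mulr_gt0.
    by apply: ltr_pM => //; exact: nc_ge0.
  lra.
have ss : nc (rc s - rc s) < d by rewrite subrr nc0.
have cl (l : C) : continuous (fun t => u + l * (circ r t - u)).
  apply: ctsCD; first exact: ctsC_cst.
  apply: ctsCM; first exact: ctsC_cst.
  by apply: ctsCB; [exact: cts_circ|exact: ctsC_cst].
pose D l t := dk (u + l * (circ r t - u)) * circ r t.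
have Dc t : {for (rc s, t), continuous (fun p : C * R => D p.1 p.2)}.
  apply: cvgCM; last exact: (cts_comp (@cts_snd R) (@cts_circ R r)).
  have H : (fun p : C * R => u + p.1 * (circ r p.2 - u)) @ nbhs (rc s, t) --> u + rc s * (circ r t - u).
    have hf : (fun p : C * R => p.1) @ nbhs (rc s, t) --> rc s := @cts_fst R (rc s, t).
    have hs : (fun p : C * R => circ r p.2) @ nbhs (rc s, t) --> circ r t.
      exact: (@cts_comp _ _ _ _ _ (@cts_snd R) (@cts_circ R r) (rc s, t)).
    exact: (cvgCD (cvgC_cst _) (cvgCM hf (cvgCB hs (cvgC_cst _)))).
  apply: (@cvg_comp _ _ _ (fun p : C * R => u + p.1 * (circ r p.2 - u)) dk (nbhs (rc s, t)) (nbhs (u + rc s * (circ r t - u))) _ H).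
  by apply: dkc; apply: ind.
have DJ : cd idfun J (rc s) (cig 0 (2 * pi) (D (rc s))).
  apply: (@leibniz R D 0 (2 * pi) (rc s) Dc (fun l t => k (u + l * (circ r t - u)) * (circ r t / (circ r t - u))) d d_gt0).
  - by move=> l ld; apply: ctsCM ck; apply: (cts_disc_comp (cl l)) => t; exact: ind.
  - move=> l t ld; have nz := circ_sub_neq0 t ur.
    have h1 := cdD (cd_cst idfun u l) (cdM cid (cd_id idfun l) (cd_cst idfun (circ r t - u) l)).
    have h2 := cd_comp (f := fun l : C => u + l * (circ r t - u)) (g := k) cid (kd (ind l t ld)) h1.
    have := cdM cid h2 (cd_cst idfun (circ r t / (circ r t - u)) l); congr cd.
    by rewrite /D /=; field.
  - exact: ltW.
move: DJ; congr cd.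
have Dcs : continuous (D (rc s)).
  by apply: cts_slice Dc.
(* The primitive used for s <> 0 has s in its denominator; for s = 0 the integrand is a constant
   times z, with primitive -i z. *)
have [s0|s0] := eqVneq s 0.
  have -> : cig 0 (2 * pi) (D (rc s)) = cig 0 (2 * pi) (fun t => dk u * circ r t).
    by apply: eq_cig => t _; rewrite /D s0 mul0r addr0.
  rewrite cigZ; last exact: cts_circ.
  rewrite (_ : cig _ _ _ = 0) ?mulr0 //.
  apply: (@cig_periodic R (fun t => - 'i%C * circ r t)); [by rewrite circ2pi|exact: cts_circ|].
  move=> t; have := cdZ crc (- 'i%C) (cd_circ r t); congr cd.
  by rewrite mulrA mulNr -expr2 sqr_i opprK mul1r.
have i0 : 'i%C != 0 :> C by rewrite -nc_gt0 nc_i.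
have s0' : rc s != 0 by rewrite rc_neq0.
apply: (@cig_periodic R (fun t => (- 'i%C / rc s) * k (u + rc s * (circ r t - u)))) => //.
  by rewrite circ2pi.
move=> t.
have h1 := cdD (cd_cst (@rc R) u t) (cdZ crc (rc s) (cdB crc (cd_circ r t) (cd_cst (@rc R) u t))).
have := cdZ crc (- 'i%C / rc s) (cd_comp crc (kd (ind (rc s) t ss)) h1); congr cd.
rewrite /D subr0 add0r.
transitivity (- ('i%C ^+ 2) * (dk (u + rc s * (circ r t - u)) * circ r t)); first by field.
by rewrite sqr_i opprK mul1r.
Qed.

End Disc.
End CauchyFormula.

(** * Entire functions: derivatives, division by a zero, bounds from a circle *)

Section Entire.
Variable R : realType.
Local Notation C := R[i].
Implicit Types (f g : C -> C) (z u : C).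

Lemma entire_cd f z : entire f -> cd idfun f z (derive1 f z).
Proof. by move=> ef; apply: derive_cd; exact: ef. Qed.

Lemma cd_entire f df : (forall z, cd idfun f z (df z)) -> entire f /\ derive1 f = df.
Proof. by move=> fd; split=> [z|]; [|apply/funext => z]; have [] := cd_derive (fd z). Qed.

Lemma entire_continuous f : entire f -> continuous f.
Proof. by move=> ef z; exact: (cd_continuous (@continuous_id R) (entire_cd z ef)). Qed.

Lemma entire_derive1_cmean f z : entire f -> derive1 f z = cmean (fun t => f (z + expi t) / expi t).
Proof. by move=> ef; apply: derivative_cmean => w; exact: entire_cd. Qed.

(** The mean value formula expresses f' through f alone, so continuity of f suffices. This supplies
    the continuity that [cauchy_formula] asks of the derivative. *)
Lemma continuous_derive1 f : entire f -> continuous (derive1 f).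
Proof.
move=> ef; have cf := entire_continuous ef.
have -> : derive1 f = (fun z => cmean (fun t => f (z + expi t) / expi t)).
  by apply/funext => z; exact: entire_derive1_cmean.
move=> z; suff H : {for z, continuous (fun u => cig 0 (2 * pi) (fun t => f (u + expi t) / expi t))}.
  exact: (@cvgCM R _ (nbhs z) _ _ _ _ _ (cvgC_cst _) H).
apply: (@cts_param_integral R (fun z t => f (z + expi t) / expi t) 0 (2 * pi) z _ 1).
- move=> t; apply: cvgCM; last exact: (cts_comp (@cts_snd R) (@cts_expiV R)).
  have H : (fun p : C * R => p.1 + expi p.2) @ nbhs (z, t) --> z + expi t.
    have hf : (fun p : C * R => p.1) @ nbhs (z, t) --> z := @cts_fst R (z, t).
    have hs : (fun p : C * R => expi p.2) @ nbhs (z, t) --> expi t.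
      exact: (@cts_comp _ _ _ _ _ (@cts_snd R) (@continuous_expi R) (z, t)).
    exact: (cvgCD hf hs).
  exact: (@cvg_comp _ _ _ (fun p : C * R => p.1 + expi p.2) f (nbhs (z, t)) (nbhs (z + expi t)) _ H (cf _)).
- by rewrite ltW // pi2_gt0.
- exact: ltr01.
- move=> w _; apply: ctsCM (@cts_expiV R).
  apply: (@cts_comp _ _ _ (fun t => w + expi t) f) cf.
  by apply: ctsCD; [exact: ctsC_cst|exact: continuous_expi].
Qed.

Lemma entire_cauchy f r u : entire f -> nc u < r ->
  f u = cmean (fun t => f (circ r t) * (circ r t / (circ r t - u))).
Proof.
move=> ef ur; apply: (@cauchy_formula R f (derive1 f) (r + 1)) => //.
- by move=> z _; exact: entire_cd.
- by move=> z _; exact: continuous_derive1.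
- by rewrite ltrDl.
Qed.

(** Cauchy's formula differentiated once writes f' as a Cauchy integral with exponent 2, which
    [cauchy_type] differentiates again. *)
Lemma entire_derive1 f : entire f -> entire (derive1 f).
Proof.
move=> ef; have cf := entire_continuous ef.
suff : forall z, exists l, cd idfun (derive1 f) z l.
  by move=> H z; have [l /cd_derive[]] := H z.
move=> z; have cid := @continuous_id R; pose r := nc z + 1.
have zr : nc z < r by rewrite /r ltrDl.
pose phi t := f (circ r t) * circ r t.
have cphi : continuous phi.
  by apply: ctsCM; [exact: (cts_comp (@cts_circ R r) cf)|exact: cts_circ].
have H u : nc u < r -> derive1 f u = rc (2 * pi)^-1 * cig 0 (2 * pi) (fun t => phi t / (circ r t - u) ^+ 2).
  move=> ur; apply: (@cd_unique _ f u); first exact: entire_cd.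
  have := cdZ cid (rc (2 * pi)^-1) (cauchy_type 1 cphi ur); rewrite mul1r.
  apply: cd_near; have := @nbhs_disc R 0 u r; rewrite subr0 => /(_ ur).
  apply: filterS => w; rewrite subr0 => wr; rewrite (entire_cauchy ef wr) /cmean.
  by congr (_ * _); apply: eq_cig => t _; rewrite expr1 /phi mulrA.
exists (rc (2 * pi)^-1 * (2%:R * cig 0 (2 * pi) (fun t => phi t / (circ r t - z) ^+ 3))).
apply: cd_near (cdZ cid (rc (2 * pi)^-1) (cauchy_type 2 cphi zr)).
have := @nbhs_disc R 0 z r; rewrite subr0 => /(_ zr).
by apply: filterS => w; rewrite subr0 => /H ->.
Qed.

Lemma entire_derive1n f n : entire f -> entire (derive1n n f).
Proof. by move=> ef; elim: n => [//|n IH]; rewrite derive1nS; exact: entire_derive1. Qed.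

Lemma nc_cmean_le (phi : R -> C) M : continuous phi ->
  (forall t, 0 <= t <= 2 * pi -> nc (phi t) <= M) -> nc (cmean phi) <= M.
Proof.
move=> cphi H; have P0 := pi2_gt0 R.
have := nc_cig_le (M := M) (ltW P0) cphi H; rewrite subr0 => h.
by rewrite /cmean ncM nc_real gtr0_norm ?invr_gt0 // ler_pdivrMl // [2 * pi * M]mulrC.
Qed.

Lemma derive1_le f z M : entire f -> (forall u, nc (u - z) <= 1 -> nc (f u) <= M) -> nc (derive1 f z) <= M.
Proof.
move=> ef fM; rewrite entire_derive1_cmean //; apply: nc_cmean_le.
  apply: ctsCM (@cts_expiV R).
  apply: (@cts_comp _ _ _ (fun t => z + expi t) f); last exact: entire_continuous.
  by apply: ctsCD; [exact: ctsC_cst|exact: continuous_expi].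
by move=> t _; rewrite nc_div nc_expi divr1; apply: fM; rewrite addrAC subrr add0r nc_expi.
Qed.

(** Each derivative costs one unit of distance, by the Cauchy estimate on a circle of radius 1. *)
Lemma derive1n_le f n z M : entire f -> (forall u, nc (u - z) <= n%:R -> nc (f u) <= M) ->
  nc (derive1n n f z) <= M.
Proof.
move=> ef; elim: n z => [|n IH] z fM; first by apply: fM; rewrite subrr nc0.
rewrite derive1nS; apply: derive1_le; first exact: entire_derive1n.
move=> u uz; apply: IH => v vu; apply: fM.
have -> : v - z = (v - u) + (u - z) by ring.
by apply: le_trans (ncD _ _) _; rewrite -natr1 lerD.
Qed.

Lemma entireD f g : entire f -> entire g ->
  entire (fun z => f z + g z) /\ derive1 (fun z => f z + g z) = fun z => derive1 f z + derive1 g z.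
Proof. by move=> ef eg; apply: cd_entire => z; apply: cdD; exact: entire_cd. Qed.

Lemma entireB f g : entire f -> entire g ->
  entire (fun z => f z - g z) /\ derive1 (fun z => f z - g z) = fun z => derive1 f z - derive1 g z.
Proof. by move=> ef eg; apply: cd_entire => z; apply: (cdB (@continuous_id R)); exact: entire_cd. Qed.

Lemma entireM f g : entire f -> entire g ->
  entire (fun z => f z * g z) /\ derive1 (fun z => f z * g z) = fun z => derive1 f z * g z + f z * derive1 g z.
Proof. by move=> ef eg; apply: cd_entire => z; apply: (cdM (@continuous_id R)); exact: entire_cd. Qed.

Lemma entire_cst c : entire (fun _ : C => c) /\ derive1 (fun _ : C => c) = fun=> 0.
Proof. by apply: cd_entire => z; exact: cd_cst. Qed.

Lemma entireZ c f : entire f -> entire (fun z => c * f z) /\ derive1 (fun z => c * f z) = fun z => c * derive1 f z.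
Proof. by move=> ef; apply: cd_entire => z; apply: (cdZ (@continuous_id R)); exact: entire_cd. Qed.

Lemma entireX f n : entire f -> entire (fun z => f z ^+ n) /\
  derive1 (fun z => f z ^+ n) = fun z => n%:R * f z ^+ n.-1 * derive1 f z.
Proof. by move=> ef; apply: cd_entire => z; apply: (cdX (@continuous_id R)); exact: entire_cd. Qed.

Lemma entire_id : entire (fun z : C => z) /\ derive1 (fun z : C => z) = fun=> 1.
Proof. by apply: cd_entire => z; exact: (cd_id idfun). Qed.

Lemma entire_shift f b : entire f -> entire (fun z => f (z + b)) /\
  derive1 (fun z => f (z + b)) = fun z => derive1 f (z + b).
Proof.
move=> ef; apply: cd_entire => z.
have := cd_comp (f := fun z => z + b) (g := f) (@continuous_id R) (entire_cd _ ef) (cdD (cd_id idfun z) (cd_cst idfun b z)).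
by rewrite addr0 mulr1.
Qed.

Lemma entire_expC c : entire (fun z : C => expC (c * z)) /\
  derive1 (fun z : C => expC (c * z)) = fun z => c * expC (c * z).
Proof.
apply: cd_entire => z.
have := cd_comp (f := fun z => c * z) (@continuous_id R) (cd_expC (c * z)) (cdZ (@continuous_id R) c (cd_id idfun z)).
by rewrite mulr1 mulrC.
Qed.

Lemma entire_poly (p : {poly C}) : entire (fun z => p.[z]).
Proof.
elim/poly_ind: p => [|p c IH].
  have -> : (fun z => (0 : {poly C}).[z]) = fun=> 0 by apply/funext => z; rewrite horner0.
  exact: (entire_cst 0).1.
have -> : (fun z => (p * 'X + c%:P).[z]) = fun z => p.[z] * z + c by apply/funext => z; rewrite !hornerE.
exact: (entireD (entireM IH entire_id.1).1 (entire_cst c).1).1.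
Qed.

(** After a translation the zero is at 0. Near 0 the quotient F(u)/u equals the Cauchy integral q of
    F(z)/z, because 1/(z - u) - 1/z = u/(z (z - u)); so q provides both the value and the derivative
    at 0. *)
Lemma entire_divide f a : entire f -> f a = 0 -> exists2 g, entire g & forall z, f z = (z - a) * g z.
Proof.
move=> ef fa; have cid := @continuous_id R.
pose F z := f (z + a).
have eF : entire F by exact: (entire_shift a ef).1.
have cF := entire_continuous eF.
pose phi t := F (circ 1 t).
have cphi : continuous phi by exact: (cts_comp (@cts_circ R 1) cF).
pose q u := rc (2 * pi)^-1 * cig 0 (2 * pi) (fun t => phi t / (circ 1 t - u) ^+ 1).
pose G u := if u == 0 then q 0 else F u / u.
have F0 : F 0 = 0 by rewrite /F add0r.
have ck u : nc u < 1 -> continuous (fun t => phi t / (circ 1 t - u)).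
  move=> u1; apply: (ctsCM cphi); apply: ctsCV => [t|]; first exact: circ_sub_neq0.
  by apply: ctsCB; [exact: cts_circ|exact: ctsC_cst].
have Gq u : nc u < 1 -> G u = q u.
  move=> u1; rewrite /G; case: eqVneq => [->//|u0].
  have : F u - F 0 = u * q u.
    rewrite (entire_cauchy eF u1) (@entire_cauchy F 1 0 eF); last by rewrite nc0.
    rewrite /cmean -mulrBr /q mulrCA; congr (_ * _); rewrite -cigZ; last first.
      by have := ck _ u1; congr (continuous _); apply/funext => t; rewrite expr1.
    have z0 (t : R) : circ 1 t != 0 by have := @circ_sub_neq0 R 1 t 0; rewrite subr0 nc0; apply.
    have c0 (v : C) : nc v < 1 -> continuous (fun t => F (circ 1 t) * (circ 1 t / (circ 1 t - v))).
      move=> v1; apply: (ctsCM cphi); apply: ctsCM; first exact: cts_circ.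
      apply: ctsCV => [t|]; first exact: circ_sub_neq0.
      by apply: ctsCB; [exact: cts_circ|exact: ctsC_cst].
    rewrite -(cigB _ _ (c0 u u1)); last by apply: c0; rewrite nc0.
    apply: eq_cig => t _; rewrite /phi expr1 subr0; field.
    by rewrite z0 circ_sub_neq0.
  by rewrite F0 subr0 => ->; rewrite mulrAC divff // mul1r.
have dG u : exists l, cd idfun G u l.
  have [->|u0] := eqVneq u 0.
    have z1 : nc (0 : C) < 1 by rewrite nc0.
    exists (rc (2 * pi)^-1 * (1%:R * cig 0 (2 * pi) (fun t => phi t / (circ 1 t - 0) ^+ 2))).
    apply: cd_near (cdZ cid (rc (2 * pi)^-1) (cauchy_type 1 cphi z1)).
    have := @nbhs_disc R 0 0 1; rewrite subr0 => /(_ z1).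
    by apply: filterS => w; rewrite subr0 => /Gq ->.
  exists ((derive1 F u * u - F u * 1) / u ^+ 2).
  apply: cd_near (cd_div (g := idfun) cid u0 (entire_cd u eF) (cd_id idfun u)).
  apply/nbhs_nc; exists (nc u); first by rewrite nc_gt0.
  move=> w; rewrite /G; case: eqVneq => // ->; by rewrite sub0r ncN ltxx.
have eG : entire G by move=> u; have [l /cd_derive[]] := dG u.
exists (fun z => G (z - a)); first exact: (entire_shift (- a) eG).1.
move=> z; rewrite /G subr_eq0; case: eqVneq => [->|za]; first by rewrite fa subrr mul0r.
by rewrite /F subrK mulrC mulfVK // subr_eq0.
Qed.

(** A substitute for the maximum principle, read off from Cauchy's formula; the extra factor bounds
    the Cauchy kernel and equals 1 at the centre. *)
Lemma entire_max f r M u : entire f -> nc u < r ->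
  (forall t, 0 <= t <= 2 * pi -> nc (f (circ r t)) <= M) ->
  nc (f u) <= M * (r / (r - nc u)).
Proof.
move=> ef ur fM; have r0 : 0 < r by apply: le_lt_trans (nc_ge0 u) ur.
have d0 : 0 < r - nc u by rewrite subr_gt0.
rewrite (entire_cauchy ef ur); apply: nc_cmean_le.
  apply: ctsCM; first exact: (cts_comp (@cts_circ R r) (entire_continuous ef)).
  apply: ctsCM; first exact: cts_circ.
  apply: ctsCV => [t|]; first exact: circ_sub_neq0.
  by apply: ctsCB; [exact: cts_circ|exact: ctsC_cst].
move=> t t01; rewrite ncM nc_div nc_circ; last exact: ltW.
have h1 : nc (f (circ r t)) <= M by exact: fM.
have h2 : r - nc u <= nc (circ r t - u) by have := nc_sub (circ r t) u; rewrite nc_circ // ltW.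
apply: ler_pM; [exact: nc_ge0|by rewrite divr_ge0 ?nc_ge0 // ltW|exact: h1|].
by rewrite ler_pM2l // lef_pV2 // posrE // (lt_le_trans d0).
Qed.

Lemma entire_max0 f r M : entire f -> 0 < r ->
  (forall t, 0 <= t <= 2 * pi -> nc (f (circ r t)) <= M) -> nc (f 0) <= M.
Proof.
move=> ef r0 fM; have := @entire_max f r M 0 ef; rewrite nc0 subr0 divff ?gt_eqF // mulr1.
by apply.
Qed.

End Entire.

(** * Logarithms and Poisson's formula *)

Section Logarithm.
Variable R : realType.
Local Notation C := R[i].

Lemma expi_surj (w : C) : nc w = 1 -> exists t, expi t = w.
Proof.
case: w => x y n1; have xy : x ^+ 2 + y ^+ 2 = 1.
  by have := sqr_nc (x +i* y); rewrite n1 expr1n.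
have x1 : -1 <= x <= 1.
  by rewrite -ler_norml -(ler_sqr (normr_ge0 _)) ?nnegrE // real_normK ?num_real // expr1n -xy lerDl sqr_ge0.
have [y0|y0] := leP 0 y.
  exists (acos x); rewrite /expi acosK // sin_acos //.
  by rewrite -xy addrAC subrr add0r sqrtr_sqr ger0_norm.
exists (- acos x); rewrite /expi cosN sinN acosK // sin_acos //.
by rewrite -xy addrAC subrr add0r sqrtr_sqr ltr0_norm // opprK.
Qed.

Lemma expC_surj (w : C) : w != 0 -> exists c, expC c = w.
Proof.
move=> w0; have n0 : 0 < nc w by rewrite nc_gt0.
have /expi_surj[t tE] : nc (w / rc (nc w)) = 1.
  by rewrite nc_div nc_real gtr0_norm // divff // gt_eqF.
exists (ln (nc w) +i* t); rewrite expCE /= lnK ?posrE // tE mulrC divfK //.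
by rewrite rc_neq0 gt_eqF.
Qed.

Section LogDisc.
Variables (F : C -> C) (rho : R).
Hypothesis eF : entire F.
Hypothesis F0 : forall z, nc z < rho -> F z != 0.

Let q z := derive1 F z / F z.
Let dq z := (derive1 (derive1 F) z * F z - derive1 F z * derive1 F z) / F z ^+ 2.
(* The segment from 0 to z is parametrized by sg t * z for t in [0, pi], a parametrization
   defined and smooth on the whole line. *)
Let sg (t : R) : C := rc ((1 - cos t) / 2).
Let dsg (t : R) : C := rc (sin t / 2).

Let cd_q z : nc z < rho -> cd idfun q z (dq z).
Proof.
move=> zr; apply: (cd_div (@continuous_id R) (F0 zr)); first by apply: entire_cd; exact: entire_derive1.
exact: entire_cd.
Qed.

Let cts_q z : nc z < rho -> {for z, continuous q}.
Proof. by move=> zr; exact: (cd_continuous (@continuous_id R) (cd_q zr)). Qed.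

Let cts_dq z : nc z < rho -> {for z, continuous dq}.
Proof.
move=> zr.
have e1 := entire_derive1 eF; have e2 := entire_derive1 e1.
have n : (entireX 2 eF).1 = (entireX 2 eF).1 by [].
have c0 := entire_continuous eF (x := z).
have c1 := entire_continuous e1 (x := z).
have c2 := entire_continuous e2 (x := z).
have c3 := entire_continuous (entireX 2 eF).1 (x := z).
have F20 : F z ^+ 2 != 0 by rewrite expf_neq0 // F0.
exact: (cvgCM (cvgCB (cvgCM c2 c0) (cvgCM c1 c1)) (cvgCV F20 c3)).
Qed.

Let cd_sg t : cd (@rc R) sg t (dsg t).
Proof.
have := cdZ (@continuous_rc R) (rc (2^-1)) (cdB (@continuous_rc R) (cd_cst (@rc R) 1 t) (is_derive_cd (is_derive_cos t))).
rewrite sub0r -rmorphN opprK -rmorphM mulrC /dsg.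
congr cd; apply/funext => s; rewrite /sg /rc rmorphM rmorphB rmorph1 mulrC //.
Qed.

Let cd_dsg t : cd (@rc R) dsg t (rc (cos t / 2)).
Proof.
have := cdZ (@continuous_rc R) (rc (2^-1)) (is_derive_cd (is_derive_sin t)).
rewrite -rmorphM mulrC; congr cd; apply/funext => s; rewrite /dsg /rc rmorphM mulrC //.
Qed.

Let cts_sg : continuous sg.
Proof. by move=> t; exact: (cd_continuous (@continuous_rc R) (cd_sg t)). Qed.

Let cts_dsg : continuous dsg.
Proof. by move=> t; exact: (cd_continuous (@continuous_rc R) (cd_dsg t)). Qed.

Let sg_lt t z : nc z < rho -> nc (sg t * z) < rho.
Proof.
move=> zr; apply: le_lt_trans zr; rewrite ncM /sg nc_real ler_piMl ?nc_ge0 //.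
have := cos_le1 t; have := cos_geN1 t => h1 h2.
by rewrite ler_norml; apply/andP; split; lra.
Qed.

(** Here [u * K u] is the integral of F'/F along the segment from 0 to u. *)
Let K u := cig 0 pi (fun t => q (sg t * u) * dsg t).

Let cts_Kint u : nc u < rho -> continuous (fun t => q (sg t * u) * dsg t).
Proof.
move=> ur; apply: (ctsCM _ cts_dsg) => t.
have h : {for t, continuous (fun t => sg t * u)}.
  exact: (ctsCM cts_sg (@ctsC_cst R _ u) (x := t)).
exact: (continuous_comp h (cts_q (sg_lt t ur))).
Qed.

Let cd_K u : nc u < rho -> cd idfun K u (cig 0 pi (fun t => dq (sg t * u) * sg t * dsg t)).
Proof.
move=> ur.
have d0 : 0 < rho - nc u by rewrite subr_gt0.
have inr v : nc (v - u) < rho - nc u -> nc v < rho.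
  rewrite ltrBrDr => h; apply: le_lt_trans h.
  have {1}-> : v = v - u + u by ring.
  exact: ncD.
apply: (@leibniz R (fun v t => dq (sg t * v) * sg t * dsg t) 0 pi u _ (fun v t => q (sg t * v) * dsg t) _ d0).
- move=> t.
  have s1 : (fun p : C * R => sg p.2) @ nbhs (u, t) --> sg t.
    exact: (@cts_comp _ _ _ _ _ (@cts_snd R) cts_sg (u, t)).
  have s2 : (fun p : C * R => dsg p.2) @ nbhs (u, t) --> dsg t.
    exact: (@cts_comp _ _ _ _ _ (@cts_snd R) cts_dsg (u, t)).
  have s3 : (fun p : C * R => p.1) @ nbhs (u, t) --> u := @cts_fst R (u, t).
  have s4 : (fun p : C * R => dq (sg p.2 * p.1)) @ nbhs (u, t) --> dq (sg t * u).
    apply: (@cvg_comp _ _ _ (fun p : C * R => sg p.2 * p.1) dq (nbhs (u, t)) (nbhs (sg t * u))).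
      exact: (cvgCM s1 s3).
    exact: (cts_dq (sg_lt t ur)).
  exact: (cvgCM (cvgCM s4 s1) s2).
- by move=> v /inr; exact: cts_Kint.
- move=> v t /inr vr.
  have cid := @continuous_id R.
  have h := cd_comp (f := fun v : C => sg t * v) (g := q) cid (cd_q (sg_lt t vr)) (cdZ cid (sg t) (cd_id idfun v)).
  by have := cdM cid h (cd_cst idfun (dsg t) v); rewrite mulr1 mulr0 addr0.
- exact: pi_ge0.
Qed.

(** The logarithm is c0 plus the integral of F'/F from 0: then F e^(-h) has derivative 0, and e^c0 =
    F(0) fixes the constant to 1. *)
Lemma exists_log : exists h q0 : C -> C,
  [/\ forall z, nc z < rho -> cd idfun h z (q0 z),
      forall z, nc z < rho -> {for z, continuous q0} &
      forall z, nc z < rho -> F z = expC (h z)].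
Proof.
have [rho0|rho0] := leP rho 0.
  have no z : nc z < rho -> False by move=> /lt_le_trans /(_ rho0); rewrite ltNge nc_ge0.
  by exists idfun, idfun; split=> z /no.
have z0 : nc (0 : C) < rho by rewrite nc0.
have [c0 c0E] := expC_surj (F0 z0).
have cid := @continuous_id R.
pose h u := c0 + u * K u.
have hd u : nc u < rho -> cd idfun h u (q u).
  move=> ur; have := cdD (cd_cst idfun c0 u) (cdM cid (cd_id idfun u) (cd_K ur)); congr cd.
  rewrite /= add0r mul1r /K.
  have c1 := cts_Kint ur.
  have c2 : continuous (fun t => dq (sg t * u) * sg t * dsg t).
    apply: (ctsCM _ cts_dsg); apply: (ctsCM _ cts_sg) => t.
    have hh : {for t, continuous (fun t => sg t * u)}.
      exact: (ctsCM cts_sg (@ctsC_cst R _ u) (x := t)).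
    exact: (continuous_comp hh (cts_dq (sg_lt t ur))).
  have c3 := ctsCM (@ctsC_cst R _ u) c2.
  rewrite -(cigZ _ _ _ c2) -(cigD _ _ c1 c3).
  (* The integrand of K(u) + u K'(u) is the t-derivative of sg t q(sg t u), and sg runs from 0 at t
     = 0 to 1 at t = pi. *)
  rewrite (@cig_ftc R (fun t => sg t * q (sg t * u))).
  - by rewrite /sg cos0 cospi subrr opprK mul0r -[rc 0]/(0 : C) !mul0r subr0 divff // -[rc 1]/(1 : C) !mul1r.
  - exact: pi_ge0.
  - exact: (ctsCD c1 c3).
  - move=> t; have crc := @continuous_rc R.
    have g1 := cdM crc (cd_sg t) (cd_cst (@rc R) u t).
    have g2 := cd_comp (f := fun t => sg t * u) (g := q) crc (cd_q (sg_lt t ur)) g1.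
    have := cdM crc (cd_sg t) g2; congr cd; ring.
exists h, q; split; [exact: hd|exact: cts_q|move=> u ur].
have E : F u * expC (- h u) = F 0 * expC (- h 0).
  apply: (@segment_const R (fun v => F v * expC (- h v))) => s s01; rewrite add0r subr0.
  have sr : nc (rc s * u) < rho.
    by have := @seg_lt R 0 u s rho s01; rewrite nc0 add0r subr0; apply.
  have g := cd_comp (f := fun v => - h v) cid (cd_expC _) (cdN cid (hd _ sr)).
  have := cdM cid (entire_cd (rc s * u) eF) g; congr cd.
  by rewrite /q; field; exact: F0.
have h0 : h 0 = c0 by rewrite /h mul0r addr0.
move: E; rewrite h0 -c0E -expCD subrr expC0 => E.
by rewrite -[F u]mulr1 -(@expC0 R) -(subrr (h u)) addrC expCD mulrA E mul1r.
Qed.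

End LogDisc.
End Logarithm.

(** * Poisson's formula and bounds for its kernel *)

Section Poisson.
Variable R : realType.
Local Notation C := R[i].

(** The Poisson kernel (|z|^2 - |u|^2) / |z - u|^2, as the real part of a function holomorphic in
    u. *)
Definition pk (z u : C) : R := complex.Re ((z + u) / (z - u)).

Lemma Re_cmean (phi : R -> C) : complex.Re (cmean phi) = mean (fun t => complex.Re (phi t)).
Proof. by rewrite /cmean /cig /mean ReM /= mul0r subr0. Qed.

Lemma pkE (z u : C) : z - u != 0 -> pk z u = 1 + 2 * complex.Re (u / (z - u)).
Proof.
move=> zu; have -> : pk z u = complex.Re (1 + (u / (z - u) + u / (z - u))).
  by congr complex.Re; field.
by rewrite !ReD /= mulr_natl mulr2n.
Qed.

Lemma conj_div (z w : C) : (z / w)^*%C = z^*%C / w^*%C.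
Proof. by rewrite rmorphM fmorphV. Qed.

(** On the circle the Cauchy kernel is 1 + w with w = u/(z - u). The function m(z) = conj(u) z /
    (r^2 - conj(u) z) is holomorphic on a larger disc, vanishes at 0 and equals conj(w) on the
    circle. So adding m to the kernel leaves the mean unchanged and makes the kernel real, 1 + 2 Re
    w. *)
Lemma poisson (h q : C -> C) (rho r : R) (u : C) :
  (forall z, nc z < rho -> cd idfun h z (q z)) ->
  (forall z, nc z < rho -> {for z, continuous q}) -> nc u < r -> r < rho ->
  complex.Re (h u) = mean (fun t => pk (circ r t) u * complex.Re (h (circ r t))).
Proof.
move=> hd qc ur rrho; have r0 : 0 < r by apply: le_lt_trans (nc_ge0 u) ur.
have P0 := pi2_gt0 R; have cid := @continuous_id R.
pose ub := u^*%C; have nub : nc ub = nc u by rewrite /nc normcJ.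
(* The pole of m has modulus r^2/|u|. The second bound lies strictly between r and that modulus, and
   it makes sense for u = 0 as well. *)
pose rho' := Num.min rho (2 * r ^+ 2 / (r + nc u)).
have ru0 : 0 < r + nc u by rewrite ltr_pwDl ?nc_ge0.
have r_rho' : r < rho'.
  rewrite lt_min rrho ltr_pdivlMr // expr2 mulrA mulrC ltr_pM2r //; lra.
pose den (z : C) := rc (r ^+ 2) - ub * z.
have den0 z : nc z < rho' -> den z != 0.
  rewrite lt_min => /andP[_ zr]; rewrite subr_eq0; apply/eqP => E.
  have := congr1 (@nc R) E; rewrite nc_real ncM nub ger0_norm ?sqr_ge0 // => E2.
  have : nc u * nc z < r ^+ 2; last by rewrite -E2 ltxx.
  have [u0|u0] := eqVneq (nc u) 0; first by rewrite u0 mul0r exprn_gt0.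
  have u1 : 0 < nc u by rewrite lt_neqAle eq_sym u0 nc_ge0.
  apply: (@lt_le_trans _ _ (nc u * (2 * r ^+ 2 / (r + nc u)))); first by rewrite ltr_pM2l.
  rewrite mulrA ler_pdivrMr // [2 * _]mulrC mulrCA ler_pM2l ?exprn_gt0 //.
  rewrite mulrC; lra.
pose m z := ub * z / den z.
pose dm z := (ub * den z - ub * z * (- ub)) / den z ^+ 2.
have md z : nc z < rho' -> cd idfun m z (dm z).
  move=> zr; apply: (cd_div cid (den0 z zr)).
    by have := cdZ cid ub (cd_id idfun z); rewrite mulr1.
  have := cdB cid (cd_cst idfun (rc (r ^+ 2)) z) (cdZ cid ub (cd_id idfun z)).
  by rewrite mulr1 sub0r.
have cden : continuous den.
  by apply: ctsCB; [exact: ctsC_cst|apply: ctsCM; [exact: ctsC_cst|exact: cid]].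
have cm z : nc z < rho' -> {for z, continuous m}.
  by move=> zr; exact: (cd_continuous cid (md z zr)).
have cdm z : nc z < rho' -> {for z, continuous dm}.
  move=> zr; have n2 : den z ^+ 2 != 0 by rewrite expf_neq0 // den0.
  have c3 : {for z, continuous (fun z : C => den z ^+ 2)} := @ctsCX R _ den 2 cden z.
  have c4 : {for z, continuous (fun z : C => ub * den z)} := @ctsCM R _ _ _ (@ctsC_cst R _ ub) cden z.
  have c5 : {for z, continuous (fun z : C => ub * z * - ub)} :=
    @ctsCM R _ _ _ (@ctsCM R _ _ _ (@ctsC_cst R _ ub) cid) (@ctsC_cst R _ (- ub)) z.
  exact: (cvgCM (cvgCB c4 c5) (cvgCV n2 c3)).
have lt1 z : nc z < rho' -> nc z < rho by rewrite lt_min => /andP[].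
have ch : continuous (fun t => h (circ r t)).
  by apply: (cts_disc_comp hd (@cts_circ R r)) => t; rewrite nc_circ // ltW.
have cmc : continuous (fun t => m (circ r t)).
  by apply: (cts_disc_comp md (@cts_circ R r)) => t; rewrite nc_circ // ltW.
have E0 : cmean (fun t => h (circ r t) * m (circ r t)) = 0.
  have hd2 z : nc z < rho' -> cd idfun (fun z => h z * m z) z (q z * m z + h z * dm z).
    by move=> zr; apply: (cdM cid); [exact: (hd z (lt1 z zr))|exact: md].
  have hc2 z : nc z < rho' -> {for z, continuous (fun z => q z * m z + h z * dm z)}.
    move=> zr; have c1 := qc z (lt1 z zr); have c2 := cd_continuous cid (hd z (lt1 z zr)).
    exact: (cvgCD (cvgCM c1 (cm z zr)) (cvgCM c2 (cdm z zr))).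
  have z0r : nc (0 : C) < r by rewrite nc0.
  have m0 : m 0 = 0 by rewrite /m mulr0 mul0r.
  have := cauchy_formula hd2 hc2 z0r r_rho'; rewrite m0 mulr0 => ->.
  congr (_ * _); apply: eq_cig => t _; rewrite subr0 divff ?mulr1 //.
  by have := @circ_sub_neq0 R r t 0; rewrite subr0 nc0; apply.
have ck : continuous (fun t => circ r t / (circ r t - u)).
  apply: ctsCM; first exact: cts_circ.
  apply: ctsCV => [t|]; first exact: circ_sub_neq0.
  by apply: ctsCB; [exact: cts_circ|exact: ctsC_cst].
rewrite -[h u]addr0 -E0 (cauchy_formula hd qc ur rrho).
rewrite /cmean -mulrDr -(cigD _ _ (ctsCM ch ck) (ctsCM ch cmc)) -/(cmean _) Re_cmean.
congr (_ * _); apply: eq_ig => t _.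
rewrite -mulrDr; have zu := circ_sub_neq0 t ur; set z := circ r t in zu *.
pose w := u / (z - u).
have -> : z / (z - u) + m z = rc (pk z u).
  have -> : m z = w^*%C.
    have zuE : (z - u)^*%C = z^*%C - ub by exact: rmorphB.
    rewrite conj_div zuE /m /den -/ub.
    have zz : rc (r ^+ 2) = z * z^*%C by rewrite -sqr_normc ncE /rc rmorphXn /z nc_circ // ltW.
    have z0 : z != 0 by have := @circ_sub_neq0 R r t 0; rewrite subr0 nc0; apply.
    have zu' : z^*%C - ub != 0 by rewrite -zuE conjc_eq0.
    rewrite zz [ub * z]mulrC -mulrBr; field; exact/andP.
  have -> : z / (z - u) = 1 + w by rewrite /w; field.
  rewrite (pkE zu) -/w -addrA addcJ /rc rmorphD rmorphM rmorph1 rmorph_nat //.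
by rewrite mulrC ReM /= mul0r subr0.
Qed.

Lemma pk_ge0 (z u : C) : nc u < nc z -> 0 <= pk z u.
Proof.
move=> uz; have zu : z - u != 0.
  by apply: contraTneq uz => /eqP; rewrite subr_eq0 => /eqP ->; rewrite ltxx.
pose w := u / (z - u).
have -> : pk z u = nc (1 + w) ^+ 2 - nc w ^+ 2.
  by rewrite (pkE zu) -/w !sqr_nc !ReD ImD /=; ring.
have -> : 1 + w = z / (z - u) by rewrite /w; field.
rewrite subr_ge0 ler_sqr ?nnegrE ?nc_ge0 // !nc_div ler_wpM2r ?invr_ge0 ?nc_ge0 //.
exact: ltW.
Qed.

Lemma circ_dist (z u : C) (r : R) : nc z = r -> nc u <= r / 2 -> r / 2 <= nc (z - u).
Proof. by move=> zr ur; have := nc_sub z u; rewrite zr; lra. Qed.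

Lemma pk_le3 (z u : C) (r : R) : 0 < r -> nc z = r -> nc u <= r / 2 -> pk z u <= 3.
Proof.
move=> r0 zr ur; apply: le_trans (ler_norm _) _; apply: le_trans (Re_le_nc _) _.
have d := circ_dist zr ur.
have d0 : 0 < nc (z - u) by apply: lt_le_trans d; rewrite divr_gt0.
rewrite nc_div ler_pdivrMr //; have := ncD z u; rewrite zr; lra.
Qed.

(** The two quotients differ by 2 z (u - v) / ((z - u)(z - v)), where both factors of the
    denominator have modulus at least r/2. *)
Lemma pk_lip (z u v : C) (r : R) : 0 < r -> nc z = r -> nc u <= r / 2 -> nc v <= r / 2 ->
  `|pk z u - pk z v| <= 8 * nc (u - v) / r.
Proof.
move=> r0 zr ur vr.
have du := circ_dist zr ur; have dv := circ_dist zr vr.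
have r2 : 0 < r / 2 by rewrite divr_gt0.
have u0 : z - u != 0 by rewrite -nc_gt0 (lt_le_trans r2).
have v0 : z - v != 0 by rewrite -nc_gt0 (lt_le_trans r2).
rewrite /pk -ReN -ReD; apply: le_trans (Re_le_nc _) _.
have -> : (z + u) / (z - u) - (z + v) / (z - v) = 2 * z * (u - v) / ((z - u) * (z - v)).
  by field; rewrite u0 v0.
rewrite nc_div !ncM zr.
have -> : nc (2 : C) = 2 by have := nc_real (2 : R); rewrite /rc rmorph_nat => ->; rewrite ger0_norm.
have p : (r / 2) * (r / 2) <= nc (z - u) * nc (z - v) by apply: ler_pM => //; exact: ltW.
have p0 : 0 < (r / 2) * (r / 2) by rewrite mulr_gt0.
rewrite ler_pdivrMr; last exact: lt_le_trans p.
apply: (@le_trans _ _ (8 * nc (u - v) / r * ((r / 2) * (r / 2)))).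
  by rewrite le_eqVlt; apply/orP; left; apply/eqP; field; rewrite gt_eqF.
by rewrite ler_wpM2l // divr_ge0 ?mulr_ge0 ?nc_ge0 // ltW.
Qed.

End Poisson.

(** * Zeros and the counting function *)

Section Zeros.
Variable R : realType.
Local Notation C := R[i].
Implicit Types (f g : C -> C) (z u a : C) (s : seq C).

Lemma circle_bound f r : continuous f -> exists M, forall t, 0 <= t <= 2 * pi -> nc (f (circ r t)) <= M.
Proof.
move=> cf; have P0 := pi2_gt0 R.
have c : continuous (fun t => nc (f (circ r t))).
  by apply: ctsnc; exact: (cts_comp (@cts_circ R r) cf).
have [|c0 _ cP] := @EVT_max R (fun t => nc (f (circ r t))) 0 (2 * pi) (ltW P0).
  exact: continuous_subspaceT.
by exists (nc (f (circ r c0))) => t t01; apply: cP; rewrite in_itv.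
Qed.

Lemma disc_bound f r : entire f -> exists2 M, 0 <= M & forall z, nc z <= r -> nc (f z) <= M.
Proof.
move=> ef; pose r' := 2 * `|r| + 2.
have [M MP] := circle_bound r' (entire_continuous ef).
have M0 : 0 <= M by apply: le_trans (MP 0 _); [exact: nc_ge0|rewrite lexx ltW // pi2_gt0].
exists (M * 2) => [|z zr]; first by rewrite mulr_ge0.
have rr := ler_norm r; have r0 := normr_ge0 r.
have zr' : nc z < r' by rewrite /r'; lra.
apply: le_trans (entire_max ef zr' MP) _; rewrite ler_wpM2l // ler_pdivrMr ?subr_gt0 //.
by rewrite /r'; lra.
Qed.

(** Otherwise z^n divides f for every n. The quotient is at most M/(2|w|)^n on |z| = 2|w|, which
    forces |f(w)| <= 2 M / 2^n for all n. *)
Lemma order_at0 f : entire f -> (exists w, f w != 0) ->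
  exists (m : nat) g, [/\ entire g, g 0 != 0 & forall z, f z = z ^+ m * g z].
Proof.
move=> ef [w fw]; apply: contrapT => H.
have A n : exists2 g, entire g & forall z, f z = z ^+ n * g z.
  elim: n => [|n [g eg gE]]; first by exists f => // z; rewrite expr0 mul1r.
  have [g0|g0] := eqVneq (g 0) 0; last by exfalso; apply: H; exists n, g.
  have [g1 eg1 g1E] := entire_divide eg g0; exists g1 => // z.
  by rewrite gE g1E subr0 exprS; ring.
have w0 : w != 0.
  apply: contraNneq fw => w0; have [g _ ->] := A 1%N.
  by rewrite w0 expr1 mul0r.
have nw : 0 < nc w by rewrite nc_gt0.
have [M M0 MP] := disc_bound (2 * nc w) ef.
have P n : nc (f w) <= 2 * M / 2 ^+ n.
  have [g eg gE] := A n.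
  have r0 : 0 < 2 * nc w by rewrite mulr_gt0.
  have wr : nc w < 2 * nc w by lra.
  have gM t : 0 <= t <= 2 * pi -> nc (g (circ (2 * nc w) t)) <= M / (2 * nc w) ^+ n.
    move=> _; rewrite ler_pdivlMr ?exprn_gt0 // mulrC.
    have := MP (circ (2 * nc w) t); rewrite (nc_circ _ (ltW r0)) lexx => /(_ isT).
    by rewrite gE ncM ncX (nc_circ _ (ltW r0)).
  have := entire_max eg wr gM.
  have -> : 2 * nc w / (2 * nc w - nc w) = 2 by field; rewrite gt_eqF //; lra.
  move=> h; rewrite gE ncM ncX; apply: le_trans (ler_wpM2l (exprn_ge0 _ (nc_ge0 w)) h) _.
  rewrite exprMn le_eqVlt; apply/orP; left; apply/eqP; field.
  by rewrite !expf_neq0 // gt_eqF.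
have fw0 : 0 < nc (f w) by rewrite nc_gt0.
have [n nP] := exists_pow2_gt (2 * M) fw0.
by have := le_lt_trans (P n) nP; rewrite ltxx.
Qed.

Definition pr s z : C := \prod_(a <- s) (z - a).

Lemma entire_pr s : entire (pr s).
Proof.
elim: s => [|a s IH].
  have -> : pr [::] = fun=> 1 by apply/funext => z; rewrite /pr big_nil.
  exact: (entire_cst 1).1.
have -> : pr (a :: s) = fun z => (z - a) * pr s z by apply/funext => z; rewrite /pr big_cons.
exact: (entireM (entireB (entire_id R).1 (entire_cst a).1).1 IH).1.
Qed.

Lemma pr_cons a s z : pr (a :: s) z = (z - a) * pr s z.
Proof. by rewrite /pr big_cons. Qed.

Lemma pr_cat s1 s2 z : pr (s1 ++ s2) z = pr s1 z * pr s2 z.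
Proof. by rewrite /pr big_cat. Qed.

Lemma pr_perm s1 s2 z : perm_eq s1 s2 -> pr s1 z = pr s2 z.
Proof. by move=> p; rewrite /pr (perm_big _ p). Qed.

Lemma pr_nseq0 m z : pr (nseq m 0) z = z ^+ m.
Proof. by elim: m => [|m IH]; [rewrite /pr big_nil|rewrite /= pr_cons IH subr0 exprS]. Qed.

Lemma pr_neq0 s z : (pr s z != 0) = (z \notin s).
Proof.
elim: s => [|a s IH]; first by rewrite /pr big_nil oner_eq0.
by rewrite pr_cons mulf_eq0 negb_or IH subr_eq0 inE negb_or.
Qed.

Lemma factor_zeros f (r : R) : entire f -> f 0 != 0 -> 0 < r -> exists s g,
  [/\ entire g, forall z, f z = pr s z * g z, forall a, a \in s -> 0 < nc a <= r &
      forall z, nc z <= r -> g z != 0].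
Proof.
move=> ef f0 r0; apply: contrapT => H.
have A n : exists s g, [/\ size s = n, entire g, forall z, f z = pr s z * g z &
    forall a, a \in s -> nc a <= r].
  elim: n => [|n [s [g [ss eg gE sr]]]].
    by exists [::], f; split=> // z; rewrite /pr big_nil mul1r.
  have [z [zr gz]] : exists z, nc z <= r /\ g z = 0.
    apply: contrapT => nz; apply: H; exists s, g; split=> //.
      move=> a as_; rewrite sr // andbT nc_gt0; apply: contraNneq f0 => a0.
      by rewrite gE mulf_eq0 -[_ == 0]negbK pr_neq0 -a0 as_.
    by move=> z zr; apply/eqP => gz; apply: nz; exists z.
  have [g1 eg1 g1E] := entire_divide eg gz; exists (z :: s), g1; split=> //=.
  - by rewrite ss.
  - by move=> w; rewrite gE g1E pr_cons; ring.
  - by move=> a; rewrite inE => /orP[/eqP ->|/sr].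
have [M M0 MP] := disc_bound (3 * r) ef.
have r3 : 0 < 3 * r by rewrite mulr_gt0.
have P n : nc (f 0) <= M / 2 ^+ n.
  have [s [g [ss eg gE sr]]] := A n.
  have prle : nc (pr s 0) <= r ^+ n.
    rewrite -ss; elim: s sr {ss gE} => [|a s IH] sr; first by rewrite /pr big_nil nc1 expr0.
    rewrite pr_cons ncM sub0r ncN /= exprS ler_pM ?nc_ge0 //; first by apply: sr; rewrite inE eqxx.
    by apply: IH => b bs; apply: sr; rewrite inE bs orbT.
  have prge t : (2 * r) ^+ n <= nc (pr s (circ (3 * r) t)).
    rewrite -ss; elim: s sr {ss gE prle} => [|a s IH] sr; first by rewrite /pr big_nil nc1 expr0.
    rewrite pr_cons ncM /= exprS ler_pM ?exprn_ge0 ?mulr_ge0 //; try exact: ltW.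
      have := nc_sub (circ (3 * r) t) a; rewrite nc_circ; last exact: ltW.
      have : nc a <= r by apply: sr; rewrite inE eqxx.
      by move=> h1 h2; lra.
    by apply: IH => b bs; apply: sr; rewrite inE bs orbT.
  have n0 : 0 < (2 * r) ^+ n by rewrite exprn_gt0 // mulr_gt0.
  have gM t : 0 <= t <= 2 * pi -> nc (g (circ (3 * r) t)) <= M / (2 * r) ^+ n.
    move=> _; rewrite ler_pdivlMr //.
    have := MP (circ (3 * r) t); rewrite (nc_circ _ (ltW r3)) lexx => /(_ isT).
    by rewrite gE ncM mulrC => h; apply: le_trans h; rewrite ler_wpM2l ?nc_ge0.
  have := entire_max0 eg r3 gM => h.
  rewrite gE ncM; apply: le_trans (ler_pM (nc_ge0 _) (nc_ge0 _) prle h) _.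
  rewrite exprMn le_eqVlt; apply/orP; left; apply/eqP; field.
  by rewrite !expf_neq0 // gt_eqF.
have fw0 : 0 < nc (f 0) by rewrite nc_gt0.
have [n nP] := exists_pow2_gt M fw0.
by have := le_lt_trans (P n) nP; rewrite ltxx.
Qed.

Lemma list_gap s (r : R) : (forall a, a \in s -> r < nc a) ->
  exists2 rho, r < rho & forall a, a \in s -> rho <= nc a.
Proof.
elim: s => [|a s IH] h; first by exists (r + 1); rewrite ?ltrDl.
have [b bs|rho rrho H] := IH; first by apply: h; rewrite inE bs orbT.
exists (Num.min rho (nc a)); first by rewrite lt_min rrho h // inE eqxx.
move=> b; rewrite inE => /orP[/eqP ->|/H bs]; first by rewrite ge_min lexx orbT.
by rewrite ge_min bs.
Qed.

(** There are finitely many zeros in the disc of radius r + 1, so their moduli stay at a positive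
    distance from r. Logarithms and Poisson's formula need such an open disc around the closed
    one. *)
Lemma zero_free_open f (r : R) : entire f -> 0 < r -> (forall z, nc z <= r -> f z != 0) ->
  exists2 rho, r < rho & forall z, nc z < rho -> f z != 0.
Proof.
move=> ef r0 fr.
have f0 : f 0 != 0 by apply: fr; rewrite nc0 ltW.
have r1 : 0 < r + 1 by rewrite addr_gt0.
have [s [g [eg gE sr g0]]] := factor_zeros ef f0 r1.
have [|rho rrho H] := @list_gap s r.
  move=> a as_; rewrite ltNge; apply/negP => /fr; rewrite gE mulf_eq0 negb_or pr_neq0 as_ //.
exists (Num.min rho (r + 1)) => [|z]; first by rewrite lt_min rrho ltrDl ltr01.
rewrite lt_min => /andP[z1 z2]; rewrite gE mulf_neq0 //; last by apply: g0; exact: ltW.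
by rewrite pr_neq0; apply/negP => /H; rewrite leNgt z1.
Qed.

Lemma mean_le (phi psi : R -> R) : continuous phi -> continuous psi ->
  (forall t, phi t <= psi t) -> mean phi <= mean psi.
Proof.
move=> c1 c2 h; have P0 := pi2_gt0 R.
rewrite /mean ler_pM2l ?invr_gt0 //.
by apply: ig_le => // t _; exact: h.
Qed.

Lemma meanZ k (phi : R -> R) : continuous phi -> mean (fun t => k * phi t) = k * mean phi.
Proof. by move=> c; rewrite /mean igZ // mulrCA. Qed.

Lemma meanD (phi psi : R -> R) : continuous phi -> continuous psi ->
  mean (fun t => phi t + psi t) = mean phi + mean psi.
Proof. by move=> c1 c2; rewrite /mean igD // mulrDr. Qed.

Lemma meanN (phi : R -> R) : continuous phi -> mean (fun t => - phi t) = - mean phi.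
Proof. by move=> c; rewrite /mean igN // mulrN. Qed.

Lemma mean_cst (k : R) : mean (fun=> k) = k.
Proof.
rewrite /mean ig_cst ?subr0; last by rewrite ltW // pi2_gt0.
by rewrite mulrCA mulVf ?mulr1 // gt_eqF // pi2_gt0.
Qed.

Lemma eq_mean (phi psi : R -> R) : (forall t, phi t = psi t) -> mean phi = mean psi.
Proof. by move=> h; congr mean; apply/funext. Qed.

(** In this form continuity is visible at x = 0 too, where [ln] itself is discontinuous. *)
Lemma log_plusE (x : R) : 0 <= x -> log_plus x = ln (Num.max 1 x).
Proof.
move=> x0; rewrite /log_plus; have [x1|x1] := leP x 1.
  by rewrite ln1; apply/max_idPl; rewrite ln_le0.
by apply/max_idPr; rewrite ln_ge0 // ltW.
Qed.

Lemma cts_log_plus (phi : R -> R) : continuous phi -> (forall t, 0 <= phi t) ->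
  continuous (fun t => log_plus (phi t)).
Proof.
move=> c h; have -> : (fun t => log_plus (phi t)) = (fun t => ln (Num.max 1 (phi t))).
  by apply/funext => t; rewrite log_plusE.
move=> t; apply: (@continuous_comp _ _ _ (fun t => Num.max 1 (phi t)) (@ln R)).
  by apply: continuous_max; [exact: cvg_cst|exact: c].
by apply: continuous_ln; rewrite lt_max ltr01.
Qed.

Lemma cts_ln (phi : R -> R) : continuous phi -> (forall t, 0 < phi t) ->
  continuous (fun t => ln (phi t)).
Proof.
move=> c h t; apply: (@continuous_comp _ _ _ phi (@ln R)); first exact: c.
by apply: continuous_ln.
Qed.

(** The proximity function; for entire f it is the whole characteristic, by
    [characteristic_funE]. *)
Definition Tch (f : C -> C) (r : R) : R := mean (fun t => log_plus (nc (f (circ r t)))).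

(* F replaces each factor z - a by its reflection in |z| = r: it has no zeros in the disc, |F| = |f|
   on the circle and |F| >= |f| inside, so that w = log |F| is a harmonic majorant of log |f|. *)
Section Potential.
Variables (f g : C -> C) (s : seq C) (r : R).
Hypotheses (r0 : 0 < r) (eg : entire g) (fE : forall z, f z = pr s z * g z).
Hypotheses (sr : forall a, a \in s -> nc a < r) (g0 : forall z, nc z <= r -> g z != 0).

Let bl z : C := \prod_(a <- s) (rc r - a^*%C * z / rc r).
Let F z := bl z * g z.

Let rcr0 : rc r != 0. Proof. by rewrite rc_neq0 gt_eqF. Qed.

Let entire_bl : entire bl.
Proof.
rewrite /bl; elim: s => [|a s' IH].
  have -> : (fun z => \prod_(a <- [::]) (rc r - a^*%C * z / rc r)) = fun=> 1 by apply/funext => z; rewrite big_nil.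
  exact: (entire_cst 1).1.
have -> : (fun z => \prod_(b <- a :: s') (rc r - b^*%C * z / rc r)) =
    (fun z => (rc r - (a^*%C / rc r) * z) * \prod_(b <- s') (rc r - b^*%C * z / rc r)).
  by apply/funext => z; rewrite big_cons mulrAC.
exact: (entireM (entireB (entire_cst (rc r)).1 (entireZ (a^*%C / rc r) (entire_id R).1).1).1 IH).1.
Qed.

Let nc_conj (a : C) : nc a^*%C = nc a. Proof. by rewrite /nc normcJ. Qed.

Let bl_neq0 z : nc z <= r -> bl z != 0.
Proof.
move=> zr; rewrite /bl; elim: s sr => [|a s' IH] h; first by rewrite big_nil oner_eq0.
rewrite big_cons mulf_neq0 //; last by apply: IH => b bs; apply: h; rewrite inE bs orbT.
rewrite subr_eq0; apply/eqP => E.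
have := congr1 (@nc R) E; rewrite nc_div ncM nc_conj nc_real gtr0_norm // => /eqP.
have ar : nc a < r by apply: h; rewrite inE eqxx.
rewrite -(inj_eq (mulIf (lt0r_neq0 r0))) divfK ?lt0r_neq0 // => /eqP E2.
have : nc a * nc z < r * r; last by rewrite -E2 ltxx.
apply: (@le_lt_trans _ _ (nc a * r)); first by rewrite ler_wpM2l // nc_ge0.
by rewrite ltr_pM2r.
Qed.

Let factor_le a z : nc a < r -> nc z <= r -> nc (z - a) <= nc (rc r - a^*%C * z / rc r).
Proof.
move=> ar zr; rewrite -ler_sqr ?nnegrE ?nc_ge0 // -subr_ge0.
have -> : nc (rc r - a^*%C * z / rc r) ^+ 2 - nc (z - a) ^+ 2 =
    (r ^+ 2 - nc a ^+ 2) * (r ^+ 2 - nc z ^+ 2) / r ^+ 2.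
  have -> : a^*%C * z / rc r = rc r^-1 * (a^*%C * z) by rewrite mulrC /rc fmorphV.
  rewrite !sqr_nc !(ReD, ImD, ReN, ImN, ReM, ImM).
  case: a z {ar zr} => [a1 a2] [x y] /=; field; exact: lt0r_neq0.
by rewrite divr_ge0 ?sqr_ge0 // mulr_ge0 // subr_ge0 ler_sqr ?nnegrE ?nc_ge0 // ltW.
Qed.

Let factor_eq a z : nc z = r -> nc (rc r - a^*%C * z / rc r) = nc (z - a).
Proof.
move=> zr; have zz : z * z^*%C = rc r * rc r by rewrite -sqr_normc ncE zr expr2.
have -> : rc r - a^*%C * z / rc r = z * (z^*%C - a^*%C) / rc r.
  by rewrite mulrBr zz; field; exact: rcr0.
have -> : z^*%C - a^*%C = (z - a)^*%C by rewrite rmorphB.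
rewrite nc_div ncM nc_conj nc_real gtr0_norm // zr; field; exact: lt0r_neq0.
Qed.

Let bl_ge z : nc z <= r -> nc (pr s z) <= nc (bl z).
Proof.
move=> zr; rewrite /bl /pr; elim: s sr => [|a s' IH] h; first by rewrite !big_nil.
rewrite !big_cons !ncM ler_pM ?nc_ge0 //; first by apply: factor_le => //; apply: h; rewrite inE eqxx.
by apply: IH => b bs; apply: h; rewrite inE bs orbT.
Qed.

Let bl_circ z : nc z = r -> nc (bl z) = nc (pr s z).
Proof.
move=> zr; rewrite /bl /pr; elim: s => [|a s' IH]; first by rewrite !big_nil.
by rewrite !big_cons !ncM factor_eq // IH.
Qed.

Let bl0 : nc (bl 0) = r ^+ size s.
Proof.
rewrite /bl; elim: s => [|a s' IH]; first by rewrite big_nil nc1 expr0.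
by rewrite big_cons ncM IH mulr0 mul0r subr0 nc_real gtr0_norm // exprS.
Qed.

Let entire_f : entire f.
Proof.
have -> : f = fun z => pr s z * g z by apply/funext.
exact: (entireM (@entire_pr s) eg).1.
Qed.

Lemma f_circ_gt0 t : 0 < nc (f (circ r t)).
Proof.
rewrite nc_gt0 fE mulf_neq0 //; last by apply: g0; rewrite nc_circ // ltW.
by rewrite pr_neq0; apply/negP => /sr; rewrite nc_circ ?ltxx // ltW.
Qed.

Let cts_nf : continuous (fun t => nc (f (circ r t))).
Proof. by apply: ctsnc; exact: (cts_comp (@cts_circ R r) (entire_continuous entire_f)). Qed.

(** Take w = log |F| as the real part of a logarithm of F. Poisson's formula recovers w from log |f|
    on |z| = r: kernel values in [0, 3] on the half disc bound w by the characteristic, and the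
    Lipschitz bound on the kernel gives the Harnack-type estimate of the last clause. *)
Lemma exists_potential : exists w : C -> R,
  [/\ (forall u, nc u <= r -> nc (f u) <= expR (w u)) /\ w 0 = ln (nc (g 0)) + (size s)%:R * ln r,
      forall p, 0 <= p <= r -> continuous (fun t => w (circ p t)) /\ mean (fun t => w (circ p t)) = w 0,
      w 0 = mean (fun t => ln (nc (f (circ r t)))),
      forall u, nc u <= r / 2 -> w u <= 3 * Tch f r &
      forall u v, nc u <= r / 2 -> nc v <= r / 2 ->
        w u - w v <= 8 * nc (u - v) / r * mean (fun t => `|ln (nc (f (circ r t)))|)].
Proof.
have eF : entire F by exact: (entireM entire_bl eg).1.
have F0 z : nc z <= r -> F z != 0 by move=> zr; rewrite mulf_neq0 // ?bl_neq0 ?g0.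
have [rho rrho Frho] := zero_free_open eF r0 F0.
have [h [q [hd qc hE]]] := exists_log eF Frho.
pose w z := complex.Re (h z).
have nF z : nc z < rho -> nc (F z) = expR (w z) by move=> zr; rewrite hE // nc_expC.
have cw p : 0 <= p <= r -> continuous (fun t => w (circ p t)).
  move=> /andP[p0 pr_]; apply: ctsRe; apply: (cts_disc_comp hd (@cts_circ R p)) => t.
  by rewrite nc_circ // (le_lt_trans pr_).
have wE t : w (circ r t) = ln (nc (f (circ r t))).
  have zr : nc (circ r t) = r by rewrite nc_circ // ltW.
  by rewrite fE ncM -bl_circ // -ncM -/(F _) nF ?zr // expRK.
have nfr := cts_ln cts_nf f_circ_gt0.
have nabs : continuous (fun t => `|ln (nc (f (circ r t)))|).
  by move=> t; apply: cvg_norm; exact: nfr.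
have clp : continuous (fun t => log_plus (nc (f (circ r t)))).
  by apply: cts_log_plus => // t; exact: nc_ge0.
have cpk u : nc u < r -> continuous (fun t => pk (circ r t) u).
  move=> ur; apply: ctsRe; apply: ctsCM.
    by apply: ctsCD; [exact: cts_circ|exact: ctsC_cst].
  apply: ctsCV => [t|]; first exact: circ_sub_neq0.
  by apply: ctsCB; [exact: cts_circ|exact: ctsC_cst].
have P u : nc u < r -> w u = mean (fun t => pk (circ r t) u * ln (nc (f (circ r t)))).
  by move=> ur; rewrite /w (poisson hd qc ur rrho); apply: eq_mean => t; rewrite -wE.
have cM (a b : R -> R) : continuous a -> continuous b -> continuous (fun t => a t * b t).
  by move=> ca cb t; apply: cvgM; [exact: ca|exact: cb].
have lt2 u : nc u <= r / 2 -> nc u < r by move=> h1; apply: le_lt_trans h1 _; rewrite ltr_pdivrMr // ltr_pMr // ltr1n.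
have zr t : nc (circ r t) = r by rewrite nc_circ // ltW.
exists w; split; first split.
- move=> u ur; rewrite fE ncM -nF; last exact: le_lt_trans rrho.
  by rewrite ncM ler_wpM2r ?nc_ge0 // bl_ge.
- have z0 : nc (0 : C) < rho by rewrite nc0 (lt_trans r0).
  have g00 : 0 < nc (g 0) by rewrite nc_gt0 g0 // nc0 ltW.
  rewrite -[w 0]expRK -nF // ncM bl0 lnM ?posrE ?exprn_gt0 // addrC lnXn // mulr_natl //.
- move=> p p0r; split; first exact: cw.
  have [->|pn0] := eqVneq p 0.
    rewrite (eq_mean (psi := fun=> w 0)) ?mean_cst // => t.
    by rewrite /circ mul0r.
  move: p0r => /andP[p0 p_r].
  have p_gt0 : 0 < p by rewrite lt_neqAle eq_sym pn0.
  have p_rho : p < rho := le_lt_trans p_r rrho.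
  rewrite [RHS](poisson (u := 0) hd qc _ p_rho) ?nc0 //; apply: eq_mean => t.
  have nz : circ p t != 0 by rewrite -nc_gt0 nc_circ // ltW.
  by rewrite /pk addr0 subr0 divff // mul1r.
- have r00 : nc (0 : C) < r by rewrite nc0.
  rewrite (P _ r00); apply: eq_mean => t.
  have nz : circ r t != 0 by rewrite -nc_gt0 zr.
  by rewrite /pk addr0 subr0 divff // mul1r.
- move=> u u2; rewrite (P _ (lt2 _ u2)) /Tch -meanZ //; apply: mean_le.
  + exact: cM (cpk u (lt2 _ u2)) nfr.
  + by move=> t; apply: cvgM; [exact: cvg_cst|exact: clp].
  + move=> t; have k0 : 0 <= pk (circ r t) u by apply: pk_ge0; rewrite zr lt2.
    have k3 := pk_le3 r0 (zr t) u2.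
    apply: (@le_trans _ _ (pk (circ r t) u * log_plus (nc (f (circ r t))))).
      by rewrite ler_wpM2l // /log_plus le_max lexx orbT.
    by rewrite ler_wpM2r // /log_plus le_max lexx.
- move=> u v u2 v2; rewrite (P _ (lt2 _ u2)) (P _ (lt2 _ v2)).
  have cu := cM _ _ (cpk u (lt2 _ u2)) nfr; have cv := cM _ _ (cpk v (lt2 _ v2)) nfr.
  have cnv : continuous (fun t => - (pk (circ r t) v * ln (nc (f (circ r t))))).
    by move=> t; apply: cvgN; exact: cv.
  rewrite -(meanN cv) -(meanD cu cnv) -(meanZ _ nabs); apply: mean_le.
  + by move=> t; apply: cvgD; [exact: cu|exact: cnv].
  + by move=> t; apply: cvgM; [exact: cvg_cst|exact: nabs].
  + move=> t; rewrite -mulrBl; apply: le_trans (ler_norm _) _; rewrite normrM.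
    by rewrite ler_wpM2r // pk_lip.
Qed.

End Potential.
End Zeros.

(** * The counting and characteristic functions computed for entire f and 1/f *)

Section NevanlinnaFunctions.
Variable R : realType.
Local Notation C := R[i].
Local Notation mu := (@lebesgue_measure R).
Implicit Types (f g F G : C -> C) (z : C) (s : seq C).

Lemma circE (r t : R) : circ r t = (r * cos t) +i* (r * sin t).
Proof. by rewrite /circ /expi /rc; simpc. Qed.

Lemma proximity_funE r f : proximity_fun r f = Tch f r.
Proof.
rewrite /proximity_fun /Tch /mean; congr (_ * _); apply: eq_ig => t _.
by rewrite -circE.
Qed.

Lemma cvg_dnbhs F z (l : C) : F @ nbhs z --> l -> F @ z^' --> l.
Proof. by move=> h; apply: cvg_within_filter; exact: h. Qed.

Lemma cvg_dnbhs_unique F z (a b : C) : F @ z^' --> a -> F @ z^' --> b -> a = b.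
Proof.
move=> /cvg_nc Fa /cvg_nc Fb; apply/eqP; rewrite -subr_eq0 -nc_eq0; apply/eqP/le_anti.
rewrite nc_ge0 andbT; apply/ler_addgt0Pr => e e0; rewrite add0r.
have e2 : 0 < e / 2 by rewrite divr_gt0.
have [w [h1 h2]] := filter_ex (filterI (Fa _ e2) (Fb _ e2)).
have -> : a - b = (a - F w) - (b - F w) by ring.
by apply: le_trans (ncDB _ _) _; lra.
Qed.

Lemma cvg_pow_sub z n : (0 < n)%N -> (fun w : C => (w - z) ^+ n) @ nbhs z --> (0 : C).
Proof.
case: n => [//|n] _.
have c : continuous (fun w : C => (w - z) ^+ n.+1).
  by apply: ctsCX; apply: ctsCB; [exact: continuous_id|exact: ctsC_cst].
have H : (fun w : C => (w - z) ^+ n.+1) @ nbhs z --> (z - z) ^+ n.+1 := c z.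
by rewrite subrr expr0n in H.
Qed.

(** A positive order n would give the nonzero limit l as 0^n F(z) = 0; with no order available
    [xget] returns its default 0. *)
Lemma pole_order_continuous F z : {for z, continuous F} -> pole_order F z = 0%N.
Proof.
move=> cF; rewrite /pole_order; case: xgetP => // n _ [n0 [l l0 Fl]].
have H : (fun w => (w - z) ^+ n * F w) @ nbhs z --> 0 * F z by exact: (cvgCM (cvg_pow_sub z n0) cF).
have := cvg_dnbhs_unique Fl (cvg_dnbhs H); rewrite mul0r => l00.
by rewrite l00 eqxx in l0.
Qed.

(** The exponent is unique: if two qualified, the limit for the smaller one times the remaining
    power of w - z would make the limit for the larger one 0. *)
Lemma pole_order_inv f G z (m : nat) : (0 < m)%N -> {for z, continuous G} -> G z != 0 ->
  (forall w, f w = (w - z) ^+ m * G w) -> pole_order (fun w => (f w)^-1) z = m.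
Proof.
move=> m0 cG Gz fE.
have cV : (fun w => (G w)^-1) @ nbhs z --> (G z)^-1 by exact: (cvgCV Gz cG).
have wz : \forall w \near z^', w != z by exact: nbhs_dnbhs_neq.
have hasm : has_pole_order (fun w => (f w)^-1) z m.
  split=> //; exists (G z)^-1; first by rewrite invr_eq0.
  apply: cvg_trans (cvg_dnbhs cV); apply: near_eq_cvg.
  apply: filterS wz => w wz; rewrite fE invfM mulrA mulfV ?mul1r //.
  by rewrite expf_neq0 // subr_eq0.
rewrite /pole_order; case: xgetP => [n _ [n0 [l l0 Fl]]|no]; last by exfalso; exact: (no m).
have [nm|mn|//] := ltngtP n m.
- have mn0 : (0 < m - n)%N by rewrite subn_gt0.
  have H : (fun w => (w - z) ^+ (m - n) * ((w - z) ^+ n * (f w)^-1)) @ z^' --> 0 * l.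
    exact: (cvgCM (cvg_dnbhs (cvg_pow_sub z mn0)) Fl).
  have H2 : (fun w => (w - z) ^+ (m - n) * ((w - z) ^+ n * (f w)^-1)) @ z^' --> (G z)^-1.
    apply: cvg_trans (cvg_dnbhs cV); apply: near_eq_cvg.
    apply: filterS wz => w wz; rewrite mulrA -exprD subnK; last exact: ltnW.
    by rewrite fE invfM mulrA mulfV ?mul1r // expf_neq0 // subr_eq0.
  have := cvg_dnbhs_unique H H2; rewrite mul0r => /esym/eqP.
  by rewrite invr_eq0 (negPf Gz).
- have mn0 : (0 < n - m)%N by rewrite subn_gt0.
  have H : (fun w => (w - z) ^+ (n - m) * (G w)^-1) @ z^' --> 0 * (G z)^-1.
    exact: (cvgCM (cvg_dnbhs (cvg_pow_sub z mn0)) (cvg_dnbhs cV)).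
  have H2 : (fun w => (w - z) ^+ n * (f w)^-1) @ z^' --> 0 * (G z)^-1.
    apply: cvg_trans H; apply: near_eq_cvg.
    apply: filterS wz => w wz; have -> : (w - z) ^+ n = (w - z) ^+ (n - m) * (w - z) ^+ m.
      by rewrite -exprD subnK // ltnW.
    by rewrite fE invfM mulrA mulfK // expf_neq0 // subr_eq0.
  have := cvg_dnbhs_unique Fl H2; rewrite mul0r => l00.
  by rewrite l00 eqxx in l0.
Qed.

Lemma pole_count_entire f r : entire f -> pole_count r f = 0.
Proof.
move=> ef; apply: fsbig1 => z _; rewrite pole_order_continuous //.
exact: entire_continuous.
Qed.

Lemma counting_fun_entire f r : entire f -> counting_fun r f = 0.
Proof.
move=> ef; rewrite /counting_fun pole_count_entire // mul0r addr0.
rewrite (_ : (fun t => _) = fun=> 0).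
  by rewrite /Rintegral integral0.
by apply/funext => t; rewrite pole_count_entire // subrr mul0r.
Qed.

Lemma characteristic_funE f r : entire f -> characteristic_fun r f = Tch f r.
Proof. by move=> ef; rewrite /characteristic_fun counting_fun_entire // addr0 proximity_funE. Qed.

Section CountingZeros.
Variables (f g : C -> C) (s : seq C) (rho : R).
Hypotheses (eg : entire g) (fE : forall z, f z = pr s z * g z).
Hypothesis (g0 : forall z, nc z <= rho -> g z != 0).

Lemma pole_order_zeros z : nc z <= rho -> pole_order (fun w => (f w)^-1) z = count_mem z s.
Proof.
move=> zr.
pose s0 := [seq x <- s | predC (pred1 z) x].
have ps : perm_eq s (nseq (count_mem z s) z ++ s0).
  have H : perm_eq s ([seq x <- s | pred1 z x] ++ s0) by rewrite perm_sym perm_filterC.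
  apply: (perm_trans H); rewrite perm_cat2r.
  suff -> : nseq (count_mem z s) z = [seq x <- s | pred1 z x] by exact: perm_refl.
  by rewrite -size_filter; apply/esym/all_pred1P; exact: filter_all.
have prn n w : pr (nseq n z) w = (w - z) ^+ n.
  by elim: n => [|n IH]; [rewrite /pr big_nil|rewrite /= pr_cons IH exprS].
have fG w : f w = (w - z) ^+ count_mem z s * (pr s0 w * g w).
  by rewrite fE (pr_perm w ps) pr_cat prn mulrA.
have cG : {for z, continuous (fun w => pr s0 w * g w)}.
  exact: (@ctsCM R _ _ _ (entire_continuous (@entire_pr R s0)) (entire_continuous eg) z).
have G0 : pr s0 z * g z != 0 by rewrite mulf_neq0 ?g0 // pr_neq0 mem_filter /= eqxx.
have [c0|c0] := posnP (count_mem z s); last exact: (pole_order_inv c0 cG G0 fG).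
rewrite c0; apply: pole_order_continuous.
have -> : (fun w => (f w)^-1) = fun w => (pr s0 w * g w)^-1.
  by apply/funext => w; rewrite fG c0 expr0 mul1r.
exact: (cvgCV G0 cG).
Qed.

Lemma pole_count_zeros t : t <= rho -> pole_count t (fun w => (f w)^-1) = (count (fun a => nc a <= t) s)%:R.
Proof.
move=> trho; rewrite /pole_count.
have P z : (`|z| <= t%:C) = (nc z <= t) by rewrite ncE lecR.
rewrite (fsbigE [seq z <- undup s | nc z <= t]).
- rewrite big_filter_cond.
  (* A sum over distinct zeros weighted by multiplicity is a sum of ones over the list s with
     repetitions. *)
  transitivity (\sum_(z <- undup s | nc z <= t) iterop (count_mem z s) +%R (1 : R) 0).
    apply: eq_big => [z|z /andP[zt _]]; last by rewrite pole_order_zeros // (le_trans zt).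
    by case: (boolP (nc z <= t)) => //= zt; apply/mem_set; rewrite /= P.
  by rewrite big_undup_iterop_count -sum1_count natr_sum.
- by rewrite filter_uniq // undup_uniq.
- by move=> z /=; rewrite mem_filter P => /andP[].
- move=> z /=; rewrite P mem_filter mem_undup => zt; rewrite zt /= => zs.
  by rewrite pole_order_zeros ?(le_trans zt) // (count_memPn zs).
Qed.

End CountingZeros.

(** A zero of modulus al adds a unit step at al to n(t), hence log(r/al) to N(r). The step also
    removes the singularity of 1/t at 0. *)
Lemma integral_recip (al r : R) : 0 < al -> al < r ->
  mu.-integrable `[0, r] (EFin \o (fun t : R => ((al <= t)%R)%:R / t)) /\
  \int[mu]_(t in `[0, r]) (((al <= t)%R)%:R / t) = ln r - ln al.
Proof.
move=> al0 alr.
have cinv : {within `[al, r], continuous (fun t : R => t^-1)}.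
  apply: continuous_in_subspaceT => t; rewrite inE /= in_itv /= => /andP[alt _].
  by apply: inv_continuous; rewrite gt_eqF // (lt_le_trans al0).
have E : (fun t : R => ((al <= t)%R)%:R / t) = (fun t => t^-1) \_ `[al, +oo[.
  apply/funext => t; rewrite patchE; case: ifPn => [|].
    by rewrite inE /= in_itv /= andbT => ->; rewrite mul1r.
  by rewrite notin_setE /= in_itv /= andbT => /negP/negPf ->; rewrite mul0r.
have I : `[0, r]%classic `&` `[al, +oo[%classic = `[al, r]%classic :> set R.
  apply/seteqP; split => t /=; rewrite !in_itv /= ?andbT.
    by move=> [/andP[_ ->] ->].
  by move=> /andP[h ->]; rewrite h andbT; split=> //; rewrite (le_trans (ltW al0)).
split.
  have h : mu.-integrable `[al, r] (EFin \o (fun t : R => t^-1)).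
    by apply: continuous_compact_integrable => //; exact: segment_compact.
  rewrite E -restrict_EFin; apply/integrable_restrict => //.
  by rewrite I.
rewrite E -Rintegral_mkcondr I /Rintegral (continuous_FTC2 alr cinv (F := @ln R)) //.
- split.
  + move=> t; rewrite in_itv /= => /andP[alt _].
    have t0 : 0 < t by rewrite (lt_trans al0).
    by apply: ex_derive; exact: is_derive1_ln.
  + by apply: cvg_at_right_filter; exact: continuous_ln.
  + by apply: cvg_at_left_filter; apply: continuous_ln; exact: lt_trans alr.
- move=> t; rewrite in_itv /= => /andP[alt _].
  have t0 : 0 < t by rewrite (lt_trans al0).
  have d := is_derive1_ln t0.
  by rewrite derive1E; exact: derive_val.
Qed.

Lemma integral_count s (r : R) : 0 < r -> (forall a, a \in s -> 0 < nc a < r) ->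
  mu.-integrable `[0, r] (EFin \o (fun t => (count (fun a => nc a <= t) s)%:R / t)) /\
  \int[mu]_(t in `[0, r]) ((count (fun a => nc a <= t) s)%:R / t) = \sum_(a <- s) (ln r - ln (nc a)).
Proof.
move=> r0; elim: s => [|a s IH] h.
  rewrite big_nil (_ : (fun t : R => _) = fun=> 0); last by apply/funext => t; rewrite mul0r.
  split; last by rewrite /Rintegral integral0.
  have -> : EFin \o (fun=> 0 : R) = cst 0%E by [].
  exact: integrable0.
have /andP[a0 ar] : 0 < nc a < r by apply: h; rewrite inE eqxx.
have [i1 e1] := integral_recip a0 ar.
have hs b : b \in s -> 0 < nc b < r by move=> bs; apply: h; rewrite inE bs orbT.
have [i2 e2] := IH hs.
have E : (fun t => (count (fun b => nc b <= t) (a :: s))%:R / t) =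
    (fun t => ((nc a <= t)%R)%:R / t + (count (fun b => nc b <= t) s)%:R / t).
  by apply/funext => t; rewrite /= natrD mulrDl.
rewrite E big_cons -e1 -e2; split; last by rewrite RintegralD.
have mI : measurable (`[0, r]%classic : set (measurableTypeR R)) by exact: measurable_itv.
have := integrableD mI i1 i2.
by apply: eq_integrable => // t _ /=; rewrite EFinD.
Qed.

Lemma counting_fun_zeros f g s (m : nat) (r : R) : 0 < r -> entire g ->
  (forall z, f z = z ^+ m * pr s z * g z) -> (forall a, a \in s -> 0 < nc a < r) ->
  (forall z, nc z <= r -> g z != 0) ->
  counting_fun r (fun z => (f z)^-1) = \sum_(a <- s) (ln r - ln (nc a)) + m%:R * ln r.
Proof.
move=> r0 eg fE sr g0.
have fE2 z : f z = pr (nseq m 0 ++ s) z * g z by rewrite pr_cat pr_nseq0 fE.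
have PC t : 0 <= t <= r -> pole_count t (fun z => (f z)^-1) = m%:R + (count (fun a => nc a <= t) s)%:R.
  move=> /andP[t0 tr]; rewrite (pole_count_zeros eg fE2 g0 tr) count_cat natrD; congr (_ + _).
  by rewrite count_nseq nc0 t0 mul1n.
have P0 : pole_count 0 (fun z => (f z)^-1) = m%:R.
  rewrite PC ?lexx ?ltW //; rewrite [count _ _](_ : _ = 0%N) ?addr0 //.
  apply/eqP; rewrite -leqn0 leqNgt -has_count; apply/hasPn => a /sr /andP[a0 _].
  by rewrite -ltNge.
rewrite /counting_fun P0; congr (_ + _).
rewrite -(integral_count r0 sr).2; apply: eq_Rintegral => t; rewrite inE /= in_itv /= => t0r.
by rewrite PC // addrAC subrr add0r.
Qed.

End NevanlinnaFunctions.

(** * Growth of solutions *)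

Section Growth.
Variable R : realType.
Local Notation C := R[i].
Local Notation mu := (@lebesgue_measure R).
Implicit Types (f g : C -> C) (z : C) (s : seq C).

Definition zero_free_circle f (r : R) := forall z, nc z = r -> f z != 0.

(** Jensen's formula, stated for the value at 0 of the potential. The constant is log |f1(0)| where
    f = z^m f1 with f1(0) <> 0, so it can be chosen before r; for r >= 1 the counting function is
    nonnegative. *)
Lemma potential_entire f : entire f -> (exists w, f w != 0) -> exists K : R,
  forall r, 0 < r -> zero_free_circle f r -> exists w : C -> R,
  [/\ forall u, nc u <= r -> nc (f u) <= expR (w u),
      w 0 = K + counting_fun r (fun z => (f z)^-1) /\ (1 <= r -> K <= w 0),
      forall p, 0 <= p <= r -> continuous (fun t => w (circ p t)) /\ mean (fun t => w (circ p t)) = w 0,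
      w 0 = mean (fun t => ln (nc (f (circ r t)))) /\ (forall u, nc u <= r / 2 -> w u <= 3 * Tch f r) &
      forall u v, nc u <= r / 2 -> nc v <= r / 2 ->
        w u - w v <= 8 * nc (u - v) / r * mean (fun t => `|ln (nc (f (circ r t)))|)].
Proof.
move=> ef fw; have [m [f1 [ef1 f10 f1E]]] := order_at0 ef fw.
exists (ln (nc (f1 0))) => r r0 fr.
have [s [g [eg gE sr g0]]] := factor_zeros ef1 f10 r0.
have sr' a : a \in s -> 0 < nc a < r.
  move=> as_; have /andP[-> ar] := sr a as_; rewrite lt_neqAle ar andbT.
  apply/eqP => /fr; rewrite f1E gE !mulf_eq0 !negb_or pr_neq0 as_ //.
  by rewrite andbF.
have fE z : f z = pr (nseq m 0 ++ s) z * g z by rewrite pr_cat pr_nseq0 f1E gE mulrA.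
have fE2 z : f z = z ^+ m * pr s z * g z by rewrite f1E gE mulrA.
have srn a : a \in nseq m 0 ++ s -> nc a < r.
  rewrite mem_cat => /orP[|/sr' /andP[]//].
  by rewrite mem_nseq => /andP[_ /eqP ->]; rewrite nc0.
have [w [[w1 w2] w3 w4 w5 w6]] := exists_potential r0 eg fE srn g0.
have f10E : ln (nc (f1 0)) = ln (nc (g 0)) + \sum_(a <- s) ln (nc a).
  have g00 : 0 < nc (g 0) by rewrite nc_gt0 g0 // nc0 ltW.
  rewrite gE ncM /pr.
  have pos : forall s', (forall a, a \in s' -> 0 < nc a) -> 0 < nc (\prod_(a <- s') (0 - a)) /\
     ln (nc (\prod_(a <- s') (0 - a))) = \sum_(a <- s') ln (nc a).
    elim=> [|a s' IH] h; first by rewrite !big_nil nc1 ln1.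
    have a0 : 0 < nc a by apply: h; rewrite inE eqxx.
    have [p e] : _ /\ _ := IH (fun b bs => h b (mem_behead (s := a :: s') bs)).
    by rewrite !big_cons ncM sub0r ncN lnM ?posrE // e mulr_gt0.
  have [p e] := pos s (fun a as_ => proj1 (andP (sr' a as_))).
  by rewrite lnM ?posrE // e addrC.
have cE := counting_fun_zeros r0 eg fE2 sr' g0.
have w0E : w 0 = ln (nc (f1 0)) + counting_fun r (fun z => (f z)^-1).
  rewrite w2 cE f10E size_cat size_nseq natrD sumrB big_const_seq count_predT iter_addr_0.
  by rewrite -[ln r *+ _]mulr_natl; ring.
exists w; split=> //; split=> // r1.
rewrite w0E lerDl cE addr_ge0 //; last by rewrite mulr_ge0 // ln_ge0.
rewrite big_seq; apply: sumr_ge0 => a /sr' /andP[a0 ar].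
by rewrite subr_ge0 ler_ln ?posrE // ltW.
Qed.

Lemma avoid_list (L : seq R) (a b : R) : a < b -> exists2 x, a < x < b & x \notin L.
Proof.
elim: L a b => [|p L IH] a b ab; first by exists ((a + b) / 2) => //; apply/andP; split; lra.
have [pm|pm] := leP ((a + b) / 2) p.
  have am : a < (a + b) / 2 by lra.
  have [x /andP[x1 x2] xL] := IH _ _ am.
  exists x; first by rewrite x1 (lt_trans x2) //; lra.
  by rewrite inE negb_or xL andbT lt_eqF // (lt_le_trans x2).
have mb : (a + b) / 2 < b by lra.
have [x /andP[x1 x2] xL] := IH _ _ mb.
exists x; first by rewrite x2 andbT (lt_trans _ x1) //; lra.
by rewrite inE negb_or xL andbT gt_eqF // (lt_trans pm).
Qed.

Lemma bad_radii f (b : R) : entire f -> (exists w, f w != 0) -> 0 < b ->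
  exists L : seq R, forall r, 0 < r <= b -> r \notin L -> zero_free_circle f r.
Proof.
move=> ef fw b0; have [m [f1 [ef1 f10 f1E]]] := order_at0 ef fw.
have [s [g [eg gE sr g0]]] := factor_zeros ef1 f10 b0.
exists (map (@nc R) s) => r /andP[r0 rb] rL z zr.
rewrite f1E gE mulf_neq0 ?expf_neq0 //; first by rewrite -nc_gt0 zr.
rewrite mulf_neq0 ?g0 ?zr // pr_neq0; apply: contra rL => zs.
by rewrite -zr map_f.
Qed.

Lemma exists_good_radius f (a b : R) : entire f -> (exists w, f w != 0) -> 0 <= a -> a < b ->
  exists2 r, a < r < b & zero_free_circle f r.
Proof.
move=> ef fw a0 ab; have b0 : 0 < b by exact: le_lt_trans ab.
have [L LP] := bad_radii ef fw b0.
have [x /andP[x1 x2] xL] := avoid_list L ab.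
exists x; first by rewrite x1.
by apply: LP => //; rewrite (le_lt_trans a0 x1) ltW.
Qed.

(** An interval longer than the measure of E cannot be covered by E together with the finitely many
    moduli of zeros in it. *)
Lemma exists_good_radius_off f (E : set R) (M : R) : entire f -> (exists w, f w != 0) ->
  measurable E -> (mu E < +oo)%E -> exists r, [/\ M < r, ~ E r & zero_free_circle f r].
Proof.
move=> ef fw mE Efin; apply: contrapT => H.
have Ege0 : (0 <= mu E)%E by exact: measure_ge0.
pose e := fine (mu E); have eE : mu E = e%:E by rewrite fineK // ge0_fin_numE.
pose M1 := Num.max M 1; pose b := M1 + (e + 1).
have e0 : 0 <= e by rewrite fine_ge0.
have M10 : 0 < M1 by rewrite lt_max ltr01 orbT.
have M1b : M1 < b by rewrite /b; lra.
have b0 : 0 < b by exact: lt_trans M1b.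
have [L LP] := bad_radii ef fw b0.
have sub : `]M1, b]%classic `<=` E `|` [set` L].
  move=> r /=; rewrite in_itv /= => /andP[r1 r2].
  apply: contrapT => /not_orP [nE /= nL]; apply: H; exists r; split=> //.
    by apply: le_lt_trans r1; rewrite le_max lexx.
  by apply: LP; [rewrite (lt_trans M10 r1)|apply/negP].
have mL : measurable ([set` L] : set R).
  apply: countable_measurable; first by move=> t; exact: measurable_set1.
  by apply: finite_set_countable; exact: finite_seq.
have L0 : mu [set` L] = 0%E.
  by apply: countable_lebesgue_measure0; apply: finite_set_countable; exact: finite_seq.
have h1 : (mu `]M1, b]%classic <= mu (E `|` [set` L]))%E.
  by apply: le_measure => //; rewrite inE //; exact: measurableU.
have h2 : (mu (E `|` [set` L]) <= e%:E)%E.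
  have h : (mu (E `|` [set` L]) <= mu E + mu [set` L])%E by exact: measureU2.
  by rewrite L0 adde0 eE in h.
have := le_trans h1 h2; rewrite lebesgue_measure_itv /= lte_fin M1b -EFinB lee_fin /b; lra.
Qed.

Lemma log_plus_le (x y : R) : 0 <= y -> x <= expR y -> log_plus x <= y.
Proof.
move=> y0 xy; rewrite /log_plus ge_max y0 /=.
have [x0|x0] := leP x 0; first by rewrite ln0.
by rewrite -ler_expR lnK.
Qed.

Lemma cts_log_plus_circ f r : entire f -> continuous (fun t => log_plus (nc (f (circ r t)))).
Proof.
move=> ef; apply: cts_log_plus => [|t]; last exact: nc_ge0.
by apply: ctsnc; exact: (cts_comp (@cts_circ R r) (entire_continuous ef)).
Qed.

Lemma Tch_le f r y : entire f -> 0 <= y -> (forall t, nc (f (circ r t)) <= expR y) -> Tch f r <= y.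
Proof.
move=> ef y0 h; rewrite -[leRHS]mean_cst; apply: mean_le; first exact: cts_log_plus_circ.
  by move=> t; exact: cvg_cst.
by move=> t; exact: log_plus_le.
Qed.

(** Finite order enters the proof only through this bound. The exponent N rounds up a bound of log^+
    T / log r on some neighbourhood of infinity. *)
Lemma finite_order_Tch f : entire f -> (growth_order f < +oo)%E ->
  exists (N : nat) (M : R), forall r, M < r -> Tch f r <= r ^+ N.
Proof.
move=> ef; rewrite /growth_order limf_esupE => /ereal_inf_lt [_ /= [V [M [_ MV]] <-] Vlt].
have [K KP] : exists K : R, forall r, V r -> log_plus (characteristic_fun r f) / ln r <= K.
  move: Vlt; case: ereal_sup (@ereal_sup_ubound R [set (log_plus (characteristic_fun r f) / ln r)%:E | r in V]) => [k|//|] ub _.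
    by exists k => r Vr; rewrite -lee_fin; apply: ub; exists r.
  by exists 0 => r Vr; have := ub _ (ex_intro2 _ _ r Vr erefl).
pose N := Num.Def.archi_bound `|K|.
exists N, (Num.max M 1) => r; rewrite gt_max => /andP[Mr r1].
have r0 : 0 < r by exact: lt_trans r1.
have lr : 0 < ln r by rewrite ln_gt0.
have := KP r (MV r Mr); rewrite characteristic_funE // ler_pdivrMr // => h.
have {}h : log_plus (Tch f r) <= N%:R * ln r.
  apply: le_trans h _; apply: ler_wpM2r; first exact: ltW.
  apply: le_trans (ler_norm _) _.
  by apply: ltW; apply: archi_boundP.
have [T0|T0] := leP (Tch f r) 0; first by apply: le_trans T0 _; rewrite exprn_ge0 // ltW.
rewrite -ler_ln ?posrE ?exprn_gt0 // lnXn // -mulr_natl; apply: le_trans h.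
by rewrite /log_plus le_max lexx orbT.
Qed.

Lemma pow_le_expR (N : nat) (th : R) : 0 < th ->
  exists2 D, 0 < D & forall x, 0 <= x -> x ^+ N <= D * expR (th * x).
Proof.
elim: N th => [|N IH] th th0.
  by exists 1 => // x x0; rewrite expr0 mul1r -expR0 ler_expR mulr_ge0 // ltW.
have th2 : 0 < th / 2 by rewrite divr_gt0.
have [D D0 DP] := IH _ th2.
exists (D * (2 / th)) => [|x x0]; first by rewrite mulr_gt0 // divr_gt0.
have h1 : x <= 2 / th * expR (th / 2 * x).
  have -> : 2 / th = (th / 2)^-1 by rewrite invf_div.
  rewrite -ler_pdivrMl ?invr_gt0 // invrK; apply: le_trans (expR_ge1Dx _); rewrite lerDr ler01 //.
rewrite exprS mulrC; apply: le_trans (ler_pM (exprn_ge0 N x0) x0 (DP x x0) h1) _.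
have -> : th * x = th / 2 * x + th / 2 * x by field.
by rewrite expRD le_eqVlt; apply/orP; left; apply/eqP; ring.
Qed.

Lemma poly_subexp (p : {poly C}) (e : R) : 0 < e ->
  exists2 K, 0 <= K & forall z, nc p.[z] <= K * expR (e * nc z).
Proof.
elim/poly_ind: p e => [|p c IH] e e0.
  by exists 0 => // z; rewrite horner0 nc0 mul0r.
have e2 : 0 < e / 2 by rewrite divr_gt0.
have [K K0 KP] := IH _ e2.
have [D D0 DP] := pow_le_expR 1 e2.
exists (K * D + nc c) => [|z]; first by rewrite addr_ge0 ?nc_ge0 // mulr_ge0 // ltW.
rewrite !hornerE; apply: le_trans (ncD _ _) _; rewrite ncM mulrDl lerD //.
  apply: le_trans (ler_pM (nc_ge0 _) (nc_ge0 _) (KP z) (DP _ (nc_ge0 z))) _.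
  have -> : e * nc z = e / 2 * nc z + e / 2 * nc z by field.
  by rewrite expRD le_eqVlt; apply/orP; left; apply/eqP; ring.
by rewrite ler_peMr ?nc_ge0 // -expR0 ler_expR mulr_ge0 ?nc_ge0 // ltW.
Qed.

Lemma finite_order_bound f : entire f -> (exists w, f w != 0) -> (growth_order f < +oo)%E ->
  exists (N : nat) (K : R), forall z, nc (f z) <= expR (K * (1 + nc z) ^+ N).
Proof.
move=> ef fw fo; have [N [M0 MP0]] := finite_order_Tch ef fo.
pose M := Num.max M0 1.
have M1 : 1 <= M by rewrite le_max lexx orbT.
have MP r : M < r -> Tch f r <= r ^+ N by rewrite gt_max => /andP[h _]; exact: MP0.
have [K0 KP] := potential_entire ef fw.
exists N, (3 * (M + 2) ^+ N) => z.
have z0 := nc_ge0 z.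
(* A radius in this interval gives |z| <= r/2, where w is bounded by the characteristic, and r <= (M
   + 2)(1 + |z|), which keeps the bound polynomial. *)
have ab : 2 * nc z + M < 2 * nc z + M + 1 by lra.
have a0 : 0 <= 2 * nc z + M by lra.
have [r /andP[r1 r2] fr] := exists_good_radius ef fw a0 ab.
have r0 : 0 < r by lra.
have [w [w1 _ _ [_ w5] _]] := KP r r0 fr.
have zr : nc z <= r by lra.
have zr2 : nc z <= r / 2 by lra.
apply: le_trans (w1 z zr) _; rewrite ler_expR; apply: le_trans (w5 z zr2) _.
rewrite -mulrA ler_pM2l // -exprMn.
have Mr : M < r by lra.
apply: le_trans (MP r Mr) _.
rewrite lerXn2r ?nnegrE; [|exact: ltW|by rewrite mulr_ge0 //; lra|].
  by [].
apply: le_trans (ltW r2) _; rewrite mulrDr mulr1.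
have : 0 <= M * nc z by rewrite mulr_ge0 //; lra.
rewrite mulrDl; lra.
Qed.

(** * Exponential type from the equation *)

Section ExponentialType.
Variables (f H : C -> C) (a : {poly C}) (k : nat) (beta : C) (K1 K2 : R).
Hypotheses (ef : entire f) (fw : exists w, f w != 0) (fo : (growth_order f < +oo)%E).
Hypotheses (K10 : 0 <= K1) (K20 : 0 <= K2).
Hypothesis HK : forall z, nc (H z) <= K1 * expR (K2 * nc z).
Hypothesis feq : forall z, f z ^+ 2 + a.[z] * derive1n k f (z + beta) = H z.

(* Taking square roots in the equation halves the superlinear part of any bound for log |f|;
   iterating leaves only the linear part. *)
Lemma exponential_type : exists A L : R, [/\ 0 <= A, 0 <= L &
  forall z, nc (f z) <= expR (A * (L + nc z))].
Proof.
have [N [K fK]] := finite_order_bound ef fw fo.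
have [Ka Ka0 aK] := poly_subexp a ltr01.
pose c : R := nc beta + k%:R.
have c0 : 0 <= c by rewrite addr_ge0 // nc_ge0.
have l2 : 0 < ln 2 :> R by rewrite ln_gt0 // ltr1n.
(* The equation bounds f at z by f within distance c of z, roughly. This shift multiplies e^(th x)
   by e^(th c) < 2, so after the halving a factor e^(-eta) < 1 remains. *)
pose th : R := ln 2 / (2 * (c + 1)).
have th0 : 0 < th by rewrite divr_gt0 // mulr_gt0 // ltr_wpDl.
pose eta : R := ln 2 - th * c.
have eta0 : 0 < eta.
  rewrite subr_gt0 /th mulrAC ltr_pdivrMr; last by rewrite mulr_gt0 // ltr_wpDl.
  by rewrite ltr_pM2l //; lra.
have [D D0 DP] := pow_le_expR N th0.
pose Cc := `|K| * D; have Cc0 : 0 <= Cc by rewrite mulr_ge0 // ltW.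
pose A := K2 + 1 + (K1 + Ka); have A0 : 0 <= A by rewrite !addr_ge0.
(* This L gives A (1 + x) + A (L + x + c) = 2 A (L + x), so the linear part of the bound reproduces
   itself at each iteration. *)
pose L := c + 1; have L0 : 0 <= L by rewrite addr_ge0.
pose Q n (x : R) := A * (L + x) + Cc * expR (th * (1 + x) - n%:R * eta).
have Q0 n x : 0 <= x -> 0 <= Q n x.
  move=> x0; apply: addr_ge0; apply: mulr_ge0 => //; exact: addr_ge0.
have Qmono n x y : x <= y -> Q n x <= Q n y.
  move=> xy; rewrite lerD ?ler_wpM2l ?lerD2l // ler_expR lerD2r ler_wpM2l ?lerD2l //.
  exact: ltW.
have QP n z : nc (f z) <= expR (Q n (nc z)).
  elim: n z => [|n IH] z.
    apply: le_trans (fK z) _; rewrite ler_expR /Q mul0r subr0.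
    have z1 : 0 <= 1 + nc z by rewrite addr_ge0 // nc_ge0.
    apply: (@le_trans _ _ (`|K| * (1 + nc z) ^+ N)).
      by rewrite ler_wpM2r ?exprn_ge0 // ler_norm.
    apply: (@le_trans _ _ (Cc * expR (th * (1 + nc z)))).
      by rewrite /Cc -mulrA ler_wpM2l // DP.
    by rewrite lerDr mulr_ge0 // addr_ge0 // nc_ge0.
  have z0 := nc_ge0 z.
  have fk : nc (derive1n k f (z + beta)) <= expR (Q n (nc z + c)).
    apply: derive1n_le => // u uz; apply: le_trans (IH u) _; rewrite ler_expR; apply: Qmono.
    have -> : u = (u - (z + beta)) + (z + beta) by ring.
    apply: le_trans (ncD _ _) _; have := ncD z beta; rewrite /c; lra.
  have e1 : 1 <= expR (Q n (nc z + c)) by rewrite -expR0 ler_expR Q0 // addr_ge0.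
  have Az : (K1 + Ka) * expR ((K2 + 1) * nc z) <= expR (A * (1 + nc z)).
    apply: (@le_trans _ _ (expR (K1 + Ka) * expR ((K2 + 1) * nc z))).
      rewrite ler_wpM2r ?expR_ge0 //; apply: le_trans (expR_ge1Dx _); lra.
    rewrite -expRD ler_expR /A.
    have : 0 <= (K1 + Ka) * nc z by rewrite mulr_ge0 // addr_ge0.
    have : 0 <= K2 + 1 by rewrite addr_ge0.
    by rewrite !mulrDr !mulrDl; lra.
  have sq : nc (f z) ^+ 2 <= expR (A * (1 + nc z)) * expR (Q n (nc z + c)).
    rewrite -ncX; have -> : f z ^+ 2 = H z - a.[z] * derive1n k f (z + beta) by rewrite -feq; ring.
    apply: le_trans (ncDB _ _) _; rewrite ncM.
    apply: (@le_trans _ _ ((K1 + Ka) * expR ((K2 + 1) * nc z) * expR (Q n (nc z + c)))); last first.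
      by rewrite ler_wpM2r // expR_ge0.
    rewrite mulrDl mulrDl lerD //.
      apply: le_trans (HK z) _; rewrite -[leLHS]mulr1 ler_pM ?mulr_ge0 ?expR_ge0 //.
      by rewrite ler_wpM2l // ler_expR ler_wpM2r // lerDl.
    apply: ler_pM; rewrite ?nc_ge0 //; apply: le_trans (aK z) _.
    by rewrite ler_wpM2l // ler_expR ler_wpM2r // lerDr.
  rewrite -ler_sqr ?nnegrE ?nc_ge0 ?expR_ge0 //; apply: le_trans sq _.
  rewrite -expRD expr2 -expRD ler_expR /Q.
  have E : expR (th * (1 + nc z) - n.+1%:R * eta) = expR (th * (1 + (nc z + c)) - n%:R * eta) / 2.
    have <- : expR (ln 2) = 2 :> R by rewrite lnK // posrE.
    rewrite -expRN -expRD; congr expR; rewrite -natr1 /eta; ring.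
  rewrite E /L; set X := Cc * _.
  have -> : Cc * (expR (th * (1 + (nc z + c)) - n%:R * eta) / 2) = X / 2 by rewrite mulrA.
  by rewrite !mulrDr; lra.
exists A, L; split=> // z.
have e0 : 0 < eta by [].
apply/ler_addgt0Pr => d d0.
pose B := Cc * expR (th * (1 + nc z)).
have B0 : 0 <= B by rewrite mulr_ge0 // expR_ge0.
pose M := expR (A * (L + nc z)).
have M0 : 0 < M by exact: expR_gt0.
have ln1d : 0 < ln (1 + d / M) by rewrite ln_gt0 // ltrDl divr_gt0.
(* Enough iterations to bring the superlinear part B e^(-n eta) below log(1 + d/M), using e^x >=
   x. *)
pose n := Num.Def.archi_bound (B / (eta * ln (1 + d / M))).
have nP : B / (eta * ln (1 + d / M)) < n%:R.
  by apply: archi_boundP; rewrite divr_ge0 // mulr_ge0 // ltW.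
apply: le_trans (QP n z) _.
have -> : M + d = M * expR (ln (1 + d / M)).
  rewrite lnK ?posrE; last by rewrite addr_gt0 // divr_gt0.
  by rewrite mulrDr mulr1 mulrC divfK // gt_eqF.
rewrite -expRD ler_expR lerD2l expRB mulrA -/B ler_pdivrMr ?expR_gt0 //.
rewrite mulrC -ler_pdivrMr //; apply: (@le_trans _ _ (n%:R * eta)).
  apply: ltW; rewrite -ltr_pdivrMr // -mulrA -invfM [ln _ * _]mulrC //.
by apply: le_trans (expR_ge1Dx _); rewrite lerDr.
Qed.

End ExponentialType.
End Growth.

(** * The differential equation for f^2 *)

Section MainEstimate.
Variable R : realType.
Local Notation C := R[i].
Implicit Types (f g : C -> C) (z u : C).

Lemma entire_mean0 f r : entire f -> 0 < r -> f 0 = cmean (fun t => f (circ r t)).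
Proof.
move=> ef r0; have z0r : nc (0 : C) < r by rewrite nc0.
rewrite (entire_cauchy ef z0r); congr (_ * _); apply: eq_cig => t _.
rewrite subr0 divff ?mulr1 // -nc_gt0 nc_circ //; exact: ltW.
Qed.

Lemma cts_max0 (phi : R -> R) : continuous phi -> continuous (fun t => Num.max 0 (phi t)).
Proof. by move=> c t; apply: continuous_max; [exact: cvg_cst|exact: c]. Qed.

Lemma ctsRD (phi psi : R -> R) : continuous phi -> continuous psi -> continuous (fun t => phi t + psi t).
Proof. by move=> c1 c2 t; apply: cvgD; [exact: c1|exact: c2]. Qed.

Lemma ctsRZ (k : R) (phi : R -> R) : continuous phi -> continuous (fun t => k * phi t).
Proof. by move=> c t; apply: cvgM; [exact: cvg_cst|exact: c]. Qed.

Lemma ctsRN (phi : R -> R) : continuous phi -> continuous (fun t => - phi t).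
Proof. by move=> c t; apply: cvgN; exact: c. Qed.

Lemma ctsR_cst (k : R) : continuous (fun _ : R => k).
Proof. by move=> t; exact: cvg_cst. Qed.

(* For |x| <= M one has max 0 x >= (x + x^2/M)/2, and x = Re (al z) has mean 0 and mean square M^2/2. *)
Lemma mean_max0_Re (al : C) (r : R) : 0 < r ->
  nc al * r / 4 <= mean (fun t => Num.max 0 (complex.Re (al * circ r t))).
Proof.
move=> r0; set M := nc al * r.
have cl : continuous (fun t => al * circ r t) by apply: ctsCM; [exact: ctsC_cst|exact: cts_circ].
have cRe := ctsRe cl; have cmax := cts_max0 cRe.
have [al0|al0] := eqVneq al 0.
  rewrite /M al0 nc0 mul0r mul0r -[leLHS](mean_cst 0); apply: mean_le; [exact: ctsR_cst| |].
    by rewrite -al0.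
  by move=> t; rewrite le_max lexx.
have M0 : 0 < M by rewrite mulr_gt0 // nc_gt0.
have e1 := entireZ al (entire_id R).1.
have e2 := entireX 2 e1.1.
have m1 : mean (fun t => complex.Re (al * circ r t)) = 0.
  by rewrite -Re_cmean -(entire_mean0 e1.1 r0) mulr0.
have m2 : mean (fun t => complex.Re ((al * circ r t) ^+ 2)) = 0.
  by rewrite -Re_cmean -(entire_mean0 e2.1 r0) mulr0 expr0n.
have c2 : continuous (fun t => complex.Re ((al * circ r t) ^+ 2)) by apply: ctsRe; exact: ctsCX.
have E : M / 4 = mean (fun t => (2^-1) * complex.Re (al * circ r t) + (M / 4 + (4 * M)^-1 * complex.Re ((al * circ r t) ^+ 2))).
  rewrite meanD; [|exact: ctsRZ|by apply: ctsRD; [exact: ctsR_cst|exact: ctsRZ]].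
  rewrite meanD; [|exact: ctsR_cst|exact: ctsRZ].
  by rewrite (meanZ _ cRe) (meanZ _ c2) m1 m2 !mulr0 mean_cst add0r addr0.
rewrite {1}E; apply: mean_le => //.
  by apply: ctsRD; [exact: ctsRZ|apply: ctsRD; [exact: ctsR_cst|exact: ctsRZ]].
move=> t; set x := complex.Re (al * circ r t).
have xM : `|x| <= M.
  by apply: le_trans (Re_le_nc _) _; rewrite ncM nc_circ // ltW.
have -> : complex.Re ((al * circ r t) ^+ 2) = 2 * x ^+ 2 - M ^+ 2.
  have -> : M = nc (al * circ r t) by rewrite ncM nc_circ // ltW.
  by rewrite sqr_nc expr2 ReM -/x; ring.
have -> : 2^-1 * x + (M / 4 + (4 * M)^-1 * (2 * x ^+ 2 - M ^+ 2)) = (x + x ^+ 2 / M) / 2.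
  by field; rewrite gt_eqF.
have sq : x ^+ 2 / M <= `|x|.
  by rewrite ler_pdivrMr // -real_normK ?num_real // expr2 ler_wpM2l.
have [x0|x0] := leP 0 x; first by rewrite ger0_norm // in sq; lra.
by rewrite ltr0_norm // in sq; lra.
Qed.

Lemma normr_ln (x : R) : `|ln x| = 2 * log_plus x - ln x.
Proof.
rewrite /log_plus; have [x0|x0] := leP 0 (ln x); first by rewrite ger0_norm //; ring.
by rewrite ltr0_norm // mulr0 sub0r.
Qed.

Definition quad_op (a1 a2 : C) (g : C -> C) (z : C) : C :=
  derive1 (derive1 g) z - (a1 + a2) * derive1 g z + a1 * a2 * g z.

(** The values of the functions and of their derivatives at one point enter as ring variables, which
    leaves polynomial identities. *)
Lemma exp_sum_algebra (K : comNzRingType) (p1 p2 a1 a2 E1 E2 y0 y1 y2 b0 b1 b2 : K) :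
  y0 + b0 = p1 * E1 + p2 * E2 ->
  y1 + b1 = p1 * (a1 * E1) + p2 * (a2 * E2) ->
  y2 + b2 = p1 * (a1 * (a1 * E1)) + p2 * (a2 * (a2 * E2)) ->
  y2 - (a1 + a2) * y1 + a1 * a2 * y0 = - (b2 - (a1 + a2) * b1 + a1 * a2 * b0) /\
  p1 * (a1 - a2) * E1 = y1 - a2 * y0 + (b1 - a2 * b0).
Proof.
move=> h0 h1 h2; split.
  apply/eqP; rewrite -addr_eq0; apply/eqP.
  transitivity ((y2 + b2) - (a1 + a2) * (y1 + b1) + a1 * a2 * (y0 + b0)); first by ring.
  by rewrite h0 h1 h2; ring.
transitivity ((y1 + b1) - a2 * (y0 + b0)); last by ring.
by rewrite h0 h1; ring.
Qed.

(** To be used with y = f^2 and b = a(z) f^(k)(z + beta): the operator kills the exponential sum,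
    and D - a2 isolates its first exponential. *)
Lemma exp_sum_ops (p1 p2 a1 a2 : C) (y b : C -> C) : entire y -> entire b ->
  (forall z, y z + b z = p1 * expC (a1 * z) + p2 * expC (a2 * z)) ->
  forall z, quad_op a1 a2 y z = - quad_op a1 a2 b z /\
   p1 * (a1 - a2) * expC (a1 * z) =
     derive1 y z - a2 * y z + (derive1 b z - a2 * b z).
Proof.
move=> ey eb yb z.
have [e1 d1] := entire_expC a1; have [e2 d2] := entire_expC a2.
have [e3 d3] := entireZ p1 e1; have [e4 d4] := entireZ p2 e2.
have [e5 d5] := entireZ a1 e1; have [e6 d6] := entireZ a2 e2.
have [e7 d7] := entireZ p1 e5; have [e8 d8] := entireZ p2 e6.
have HE : (fun z => y z + b z) = fun z => p1 * expC (a1 * z) + p2 * expC (a2 * z).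
  by apply/funext.
have h1 : derive1 (fun z => y z + b z) = fun z => p1 * (a1 * expC (a1 * z)) + p2 * (a2 * expC (a2 * z)).
  by rewrite HE (entireD e3 e4).2 d3 d4 d1 d2.
rewrite (entireD ey eb).2 in h1.
have h2 : derive1 (fun z => derive1 y z + derive1 b z) = fun z => p1 * (a1 * (a1 * expC (a1 * z))) + p2 * (a2 * (a2 * expC (a2 * z))).
  by rewrite h1 (entireD e7 e8).2 d7 d8 d5 d6 d1 d2.
rewrite (entireD (entire_derive1 ey) (entire_derive1 eb)).2 in h2.
have {}h0 := yb z; have {}h1 := congr1 (fun F : C -> C => F z) h1; have {}h2 := congr1 (fun F : C -> C => F z) h2.
clear yb HE d1 d2 d3 d4 d5 d6 d7 d8 e1 e2 e3 e4 e5 e6 e7 e8 ey eb.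
exact: (exp_sum_algebra h0 h1 h2).
Qed.

(** The distance 2 pays for two derivatives, one unit each. *)
Lemma quad_op_le (a1 a2 : C) (g : C -> C) z M : entire g ->
  (forall u, nc (u - z) <= 2 -> nc (g u) <= M) ->
  nc (quad_op a1 a2 g z) <= (1 + nc (a1 + a2) + nc (a1 * a2)) * M /\
  nc (derive1 g z - a2 * g z) <= (1 + nc a2) * M.
Proof.
move=> eg gM.
have g0 : nc (g z) <= M by apply: gM; rewrite subrr nc0.
have g1 : nc (derive1 g z) <= M.
  by apply: derive1_le => // u uz; apply: gM; apply: le_trans uz _; rewrite ler1n.
have g2 : nc (derive1 (derive1 g) z) <= M.
  by have := @derive1n_le R g 2 z M eg; rewrite !derive1nS derive1n0; apply.
rewrite /quad_op; clear gM eg.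
move: (g z) (derive1 g z) (derive1 (derive1 g) z) g0 g1 g2 => x0 x1 x2 g0 g1 g2.
have a0 := nc_ge0 (a1 + a2); have a3 := nc_ge0 (a1 * a2); have a4 := nc_ge0 a2.
have h1 : nc ((a1 + a2) * x1) <= nc (a1 + a2) * M by rewrite ncM ler_wpM2l.
have h2 : nc (a1 * a2 * x0) <= nc (a1 * a2) * M by rewrite ncM ler_wpM2l.
have h3 : nc (a2 * x0) <= nc a2 * M by rewrite ncM ler_wpM2l.
split.
  have := ncD (x2 - (a1 + a2) * x1) (a1 * a2 * x0); have := ncDB x2 ((a1 + a2) * x1).
  have -> : (1 + nc (a1 + a2) + nc (a1 * a2)) * M = M + nc (a1 + a2) * M + nc (a1 * a2) * M by ring.
  lra.
have -> : (1 + nc a2) * M = M + nc a2 * M by ring.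
have := ncDB x1 (a2 * x0); lra.
Qed.

End MainEstimate.

(** * Real inequalities for the final estimate *)

Section TwoBounds.
Variable R : realType.
Implicit Types (c K x W g : R).

(** The last summand is W - W^- = min(2 W, W): the first bound serves when W < 0, the second when W
    >= 0. *)
Lemma ln_le_min c K x W g : 1 <= c -> 0 <= K -> 0 <= x -> 0 < g ->
  g <= c * expR (2 * W) -> g <= c * (K * expR x * expR W) ->
  ln g <= ln (c * (K + 1)) + x + (W + - Num.max 0 (- W)).
Proof.
move=> c1 K0 x0 g0 g1 g2.
have c0 : 0 < c by lra.
have K1 : 1 <= K + 1 by lra.
have Kp : 0 < K + 1 by lra.
have ex : 1 <= expR x by rewrite -expR0 ler_expR.
rewrite -ler_expR lnK ?posrE // expRD (expRD (ln _)) lnK ?posrE ?mulr_gt0 //.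
have [W0|W0] := leP 0 (- W).
  rewrite opprK; apply: le_trans g1 _.
  have -> : W + W = 2 * W by ring.
  rewrite ler_wpM2r ?expR_ge0 // -mulrA ler_peMr ?mulr_ege1 //; exact: ltW.
rewrite oppr0 addr0; apply: le_trans g2 _; rewrite mulrA ler_wpM2r ?expR_ge0 // mulrA.
by rewrite ler_wpM2r ?expR_ge0 // ler_wpM2l ?lerDl // ltW.
Qed.

(** Both e^(2 W) and e^W are at most e^(2 W^+). *)
Lemma ln_le_max c K x W g : 1 <= c -> 0 <= K -> 0 <= x -> 0 < g ->
  g <= c * expR (2 * W) + c * (K * expR x * expR W) ->
  ln g <= ln (2 * c * (K + 1)) + x + 2 * Num.max 0 W.
Proof.
move=> c1 K0 x0 g0 g1; set V := Num.max 0 W.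
have V0 : 0 <= V by rewrite le_max lexx.
have WV : W <= V by rewrite le_max lexx orbT.
have c0 : 0 < c by lra.
have K1 : 1 <= K + 1 by lra.
have Kp : 0 < K + 1 by lra.
have c2 : 0 < 2 * c by rewrite mulr_gt0.
have ex : 1 <= expR x by rewrite -expR0 ler_expR.
rewrite -ler_expR lnK ?posrE // 2!expRD lnK ?posrE ?mulr_gt0 //; apply: le_trans g1 _.
have h1 : expR (2 * W) <= expR (2 * V) by rewrite ler_expR ler_pM2l.
have h2 : expR W <= expR (2 * V) by rewrite ler_expR; lra.
have h3 : c * expR (2 * W) <= c * ((K + 1) * expR x * expR (2 * V)).
  rewrite ler_wpM2l ?(ltW c0) //; apply: le_trans h1 _.
  by rewrite ler_peMl ?expR_ge0 // mulr_ege1.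
have h4 : c * (K * expR x * expR W) <= c * ((K + 1) * expR x * expR (2 * V)).
  rewrite ler_wpM2l ?(ltW c0) //; apply: ler_pM; rewrite ?expR_ge0 ?mulr_ge0 ?expR_ge0 //.
  by rewrite ler_wpM2r ?expR_ge0 // lerDl.
have -> : 2 * c * (K + 1) * expR x * expR (2 * V) = c * ((K + 1) * expR x * expR (2 * V)) + c * ((K + 1) * expR x * expR (2 * V)) by ring.
exact: lerD.
Qed.

Lemma addr_max0N x : x + Num.max 0 (- x) = Num.max 0 x.
Proof. by have [h|h] := leP 0 (- x); have [h'|h'] := leP 0 x; lra. Qed.

Lemma ler_shift (u v b c d : R) : - u <= c -> u + v <= b + d -> v <= b + c + d.
Proof. lra. Qed.

Lemma small_share (n A L r : R) : 0 <= n -> 0 <= A -> 0 <= r ->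
  n / (256 * (A + 1)) * (A * (L + r)) <= n / (256 * (A + 1)) * (A * L) + n * r / 256.
Proof.
move=> n0 A0 r0; have A1 : 0 < A + 1 by lra.
rewrite [A * (L + r)]mulrDr [leLHS]mulrDr lerD2l.
have -> : n / (256 * (A + 1)) * (A * r) = (A / (A + 1)) * (n * r / 256).
  by field; rewrite gt_eqF.
rewrite ler_piMl // ?ler_pdivrMr ?mul1r ?lerDl //.
by rewrite divr_ge0 // mulr_ge0.
Qed.

(** Here ar and as_ stand for |al| r and |al| s, X for the mean of the positive part of Re(al z), m
    for that of W^-. Eliminating X, m and w0 leaves ar/16 on the left and, besides constants, 3 er =
    ar/64 and 4 ar/256 = ar/64 on the right; ar/32 survives. *)
Lemma growth_clash (ar as_ X c1 c2 c3 er w0 kap m KG K0 eAL eALr : R) :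
  as_ / 4 <= X -> X <= c2 + er + c3 + 2 * (w0 + kap + m) ->
  m <= c1 + er + (w0 + kap) - KG -> w0 <= K0 + eALr -> eALr <= eAL + ar / 256 ->
  er = ar / 192 -> ar / 4 <= as_ ->
  ar <= 32 * (2 * (c1 + 2 * (K0 + eAL + kap) - KG) + c2 + c3).
Proof. lra. Qed.

End TwoBounds.

(** * Vanishing of G by comparison of means on circles *)

Section Estimate.
Variable R : realType.
Local Notation C := R[i].
Variables (f G : C -> C) (al q : C) (a : {poly C}) (A L B C1 C2 : R).
Hypotheses (al_neq0 : al != 0) (q0 : q != 0) (ef : entire f) (fw : exists w, f w != 0).
Hypotheses (eG : entire G) (A0 : 0 <= A) (L0 : 0 <= L) (B0 : 0 < B).
Hypotheses (C1_1 : 1 <= C1) (C2_1 : 1 <= C2).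
Hypothesis fA : forall u, nc (f u) <= expR (A * (L + nc u)).
Hypothesis f_zeros : small_wrt (fun r : R => counting_fun r (fun z => (f z)^-1)) f.
(** All that the estimate uses of the equation. The number e^W majorizes |f| within distance B of z,
    where B covers the shift and the Cauchy estimates for all derivatives involved. *)
Hypothesis pointwise : forall (W : R) (Ka e r : R) z, 0 <= Ka ->
  (forall u, nc u <= r -> nc a.[u] <= Ka * expR (e * r)) ->
  (forall u, nc (u - z) <= B -> nc u <= r /\ nc (f u) <= expR W) ->
  [/\ nc (G z) <= C1 * expR (2 * W), nc (G z) <= C1 * (Ka * expR (e * r) * expR W) &
    nc (q * expC (al * z)) <=
      C2 * expR (2 * W) + C2 * (Ka * expR (e * r) * expR W)].

Lemma estimate_eq0 z : G z = 0.
Proof.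
apply/eqP; apply: contrapT => /negP Gz.
have Gw : exists w, G w != 0 by exists z.
have [K0 KP] := potential_entire ef fw.
have [KG KGP] := potential_entire eG Gw.
have al0 : 0 < nc al by rewrite nc_gt0.
pose e := nc al / 192; have e0 : 0 < e by rewrite divr_gt0.
have [Ka Ka0 aK] := poly_subexp a e0.
pose e' := nc al / (256 * (A + 1)).
have A1 : 0 < A + 1 by rewrite ltr_wpDl.
have e'0 : 0 < e' by apply: divr_gt0; [exact: al0|apply: mulr_gt0; [|exact: A1]].
have [E [mE Efin /(_ e' e'0)[M0 [_ EP]]]] := f_zeros.
(* The variation of w over a distance B: 8 B / r times a bound 2 A (L + r) - K0 for the mean of |log
   |f||, made independent of r by r >= 1. *)
pose kap := 8 * B * (2 * A * (L + 1) + `|K0|).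
have kap0 : 0 <= kap.
  apply: mulr_ge0; first by rewrite mulr_ge0 // ltW.
  apply: addr_ge0 => //; apply: mulr_ge0; first by rewrite mulr_ge0.
  by rewrite addr_ge0.
pose c1 := ln (C1 * (Ka + 1)); pose c2 := ln (2 * C2 * (Ka + 1)); pose c3 := `|ln (nc q)|.
have c10 : 0 <= c1 by rewrite ln_ge0 // mulr_ege1 // lerDr.
have c20 : 0 <= c2.
  rewrite ln_ge0 // !mulr_ege1 // ?lerDr // ler1n.
pose const := 2 * (c1 + 2 * (K0 + e' * (A * L) + kap) - KG) + c2 + c3.
(* The thresholds, in order: smallness of N(r, 1/f) outside E; r/3 + B <= r/2; s > 1, for the lower
   Jensen bound on G; and the contradiction with [growth_clash]. *)
pose M := Num.max M0 (Num.max (6 * B) (Num.max 4 (32 * const / nc al))).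
have [r [Mr Er fr]] := exists_good_radius_off M ef fw mE Efin.
move: Mr; rewrite !gt_max => /and4P[r_M0 r_B r_4 r_const].
have r0 : 0 < r by lra.
have r34 : r / 4 < r / 3 by lra.
have [s /andP[s1 s2] sgood] := exists_good_radius eG Gw (ltW (divr_gt0 r0 (ltr0n R 4))) r34.
have s_gt0 : 0 < s by lra.
have sge1 : 1 <= s by lra.
have [w [w1 [w2 w2'] w3 [w4 _] w5]] := KP r r0 fr.
have [wG [_ [_ KG'] _ [wG4 _] _]] := KGP s s_gt0 sgood.
have Tr : Tch f r <= A * (L + r).
  apply: Tch_le => // [|t]; first by rewrite mulr_ge0 // addr_ge0 // ltW.
  by have := fA (circ r t); rewrite nc_circ // ltW.
have w0le : w 0 <= K0 + e' * (A * (L + r)).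
  rewrite w2 lerD2l; apply: le_trans (ler_norm _) _; apply: le_trans (EP r r_M0 Er) _.
  by rewrite characteristic_funE // ler_wpM2l // ltW.
have w0ge : K0 <= w 0 by apply: w2'; lra.
have nf0 t : 0 < nc (f (circ r t)) by rewrite nc_gt0 fr // nc_circ // ltW.
have cnf : continuous (fun t => nc (f (circ r t))).
  by apply: ctsnc; exact: (cts_comp (@cts_circ R r) (entire_continuous ef)).
have clnf := cts_ln cnf nf0.
have clp : continuous (fun t => log_plus (nc (f (circ r t)))) := cts_log_plus_circ ef.
have mabs : mean (fun t => `|ln (nc (f (circ r t)))|) <= 2 * (A * (L + r)) - K0.
  rewrite (eq_mean (psi := fun t => 2 * log_plus (nc (f (circ r t))) + - ln (nc (f (circ r t))))).
    rewrite (meanD (ctsRZ clp) (ctsRN clnf)) (meanZ _ clp) (meanN clnf) -w4 -/(Tch f r).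
    by apply: lerD; [rewrite ler_pM2l|rewrite lerN2].
  by move=> t; rewrite normr_ln.
have harnack u v : nc u <= r / 2 -> nc v <= r / 2 -> nc (u - v) <= B -> w u <= w v + kap.
  move=> u2 v2 uv; rewrite -lerBlDl; apply: le_trans (w5 u v u2 v2) _.
  have m0 : 0 <= mean (fun t => `|ln (nc (f (circ r t)))|).
    rewrite -[0]mean_cst; apply: mean_le; [exact: ctsR_cst| |by move=> t; exact: normr_ge0].
    by move=> t; apply: cvg_norm; exact: clnf.
  apply: (@le_trans _ _ (8 * B / r * (2 * (A * (L + r)) - K0))).
    apply: ler_pM => //; first by rewrite divr_ge0 ?mulr_ge0 ?nc_ge0 // ltW.
    by rewrite ler_wpM2r ?invr_ge0 ?(ltW r0) // ler_pM2l.
  rewrite /kap mulrAC ler_pdivrMr // -[leRHS]mulrA ler_pM2l ?mulr_gt0 // mulrDl.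
  have h1 : - K0 <= `|K0| * r.
    apply: (@le_trans _ _ `|K0|); first by rewrite -normrN ler_norm.
    by rewrite ler_peMr //; lra.
  have h2 : 2 * (A * (L + r)) <= 2 * A * (L + 1) * r.
    rewrite mulrA -[leRHS]mulrA ler_wpM2l ?mulr_ge0 // mulrDl mul1r lerD2r ler_peMr //; lra.
  lra.
(* W at a point of |z| = s bounds log |f| throughout the disc of radius B around that point. *)
pose W z := w z + kap.
have zr t : nc (circ s t) = s by rewrite nc_circ // ltW.
have near t u : nc (u - circ s t) <= B -> nc u <= r /\ nc (f u) <= expR (W (circ s t)).
  move=> uz.
  have u2 : nc u <= r / 2.
    have -> : u = (u - circ s t) + circ s t by ring.
    by apply: le_trans (ncD _ _) _; rewrite zr; lra.
  have ur : nc u <= r by lra.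
  split=> //; apply: le_trans (w1 u ur) _; rewrite ler_expR; apply: harnack => //.
  by rewrite zr; lra.
have aKr u : nc u <= r -> nc a.[u] <= Ka * expR (e * r).
  by move=> ur; apply: le_trans (aK u) _; rewrite ler_wpM2l // ler_expR ler_pM2l.
have PW t := pointwise Ka0 aKr (near t).
have er0 : 0 <= e * r by rewrite mulr_ge0 // ltW.
have eer : 1 <= expR (e * r) by rewrite -expR0 ler_expR.
pose Wm t := Num.max 0 (- W (circ s t)).
have s0r : 0 <= s <= r by apply/andP; split; lra.
have [cw mw] := w3 s s0r.
have cW : continuous (fun t => W (circ s t)) by apply: ctsRD cw (@ctsR_cst R _).
have cWm : continuous Wm by apply: cts_max0; exact: ctsRN.
have mW : mean (fun t => W (circ s t)) = w 0 + kap by rewrite (meanD cw (@ctsR_cst R _)) mw mean_cst.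
have G_le t : ln (nc (G (circ s t))) <= c1 + e * r + (W (circ s t) + - Wm t).
  have [g1 g2 _] := PW t.
  have gp : 0 < nc (G (circ s t)) by rewrite nc_gt0 sgood.
  exact: (ln_le_min C1_1 Ka0 er0 gp g1 g2).
have cG : continuous (fun t => nc (G (circ s t))).
  by apply: ctsnc; exact: (cts_comp (@cts_circ R s) (entire_continuous eG)).
have G0 t : 0 < nc (G (circ s t)) by rewrite nc_gt0 sgood.
(* Jensen's inequality bounds the mean of log |G| below by KG, while the pointwise bound has mean at
   most c1 + e r + mean W - mean W^-, and the mean of W is w(0) + kap. *)
have mWm : mean Wm <= c1 + e * r + (w 0 + kap) - KG.
  have := mean_le (cts_ln cG G0) (ctsRD (@ctsR_cst R (c1 + e * r)) (ctsRD cW (ctsRN cWm))) G_le.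
  rewrite -wG4 (meanD (@ctsR_cst R _) (ctsRD cW (ctsRN cWm))) (meanD cW (ctsRN cWm)) (meanN cWm) mW mean_cst.
  have := KG' sge1; lra.
have R_le t : Num.max 0 (complex.Re (al * circ s t)) <= c2 + e * r + c3 + 2 * (W (circ s t) + Wm t).
  have -> : W (circ s t) + Wm t = Num.max 0 (W (circ s t)).
    exact: addr_max0N.
  set Wp := Num.max 0 (W (circ s t)).
  have Wp0 : 0 <= Wp by rewrite le_max lexx.
  have c30 : 0 <= c3 by exact: normr_ge0.
  rewrite ge_max; apply/andP; split.
    by apply: addr_ge0; [apply: addr_ge0; [exact: addr_ge0|]|exact: mulr_ge0].
  have [_ _ g3] := PW t.
  have qp : 0 < nc q by rewrite nc_gt0.
  have gp : 0 < nc (q * expC (al * circ s t)).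
    by rewrite ncM nc_expC mulr_gt0 // expR_gt0.
  have := ln_le_max C2_1 Ka0 er0 gp g3.
  rewrite ncM nc_expC lnM ?posrE ?expR_gt0 // expRK -/c2 -/Wp.
  have : - ln (nc q) <= c3 by rewrite /c3 -normrN ler_norm.
  exact: ler_shift.
have cR : continuous (fun t => Num.max 0 (complex.Re (al * circ s t))).
  by apply: cts_max0; apply: ctsRe; apply: ctsCM; [exact: ctsC_cst|exact: cts_circ].
have fin := mean_max0_Re al s_gt0.
have := mean_le cR (ctsRD (@ctsR_cst R _) (ctsRZ (ctsRD cW cWm))) R_le.
rewrite (meanD (@ctsR_cst R _) (ctsRZ (ctsRD cW cWm))) (meanZ _ (ctsRD cW cWm)) (meanD cW cWm) mW mean_cst => fin2.
have sA : nc al * r / 4 <= nc al * s by rewrite -mulrA ler_wpM2l // ltW.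
have eA : e' * (A * (L + r)) <= e' * (A * L) + nc al * r / 256.
  exact: (small_share L (ltW al0) A0 (ltW r0)).
have eE : e * r = nc al * r / 192 by rewrite /e mulrAC.
have := growth_clash fin fin2 mWm w0le eA eE sA; rewrite -/const leNgt => /negP; apply.
by rewrite [ltRHS]mulrC -ltr_pdivrMr; [exact: r_const|exact: al0].
Qed.

End Estimate.

(** * Application to f^2 *)

Section SquareODE.
Variable R : realType.
Local Notation C := R[i].
Implicit Types (f g : C -> C) (z u : C).

Lemma square_ode (p1 p2 alpha1 alpha2 beta : C) (a : {poly C}) (k : nat) (f : C -> C) :
  p1 != 0 -> alpha1 != 0 -> alpha1 != alpha2 ->
  entire f -> (exists w, f w != 0) -> (growth_order f < +oo)%E ->
  (forall z : C, f z ^+ 2 + a.[z] * derive1n k f (z + beta) =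
            p1 * expC (alpha1 * z) + p2 * expC (alpha2 * z)) ->
  small_wrt (fun r : R => counting_fun r (fun z => (f z)^-1)) f ->
  forall z, quad_op alpha1 alpha2 (fun z => f z ^+ 2) z = 0.
Proof.
move=> p1_neq0 alpha1_neq0 alpha_neq ef fw fo feq f_zeros.
have K1_0 : 0 <= nc p1 + nc p2 by rewrite addr_ge0 // nc_ge0.
have K2_0 : 0 <= nc alpha1 + nc alpha2 by rewrite addr_ge0 // nc_ge0.
have HK u : nc (p1 * expC (alpha1 * u) + p2 * expC (alpha2 * u)) <= (nc p1 + nc p2) * expR ((nc alpha1 + nc alpha2) * nc u).
  have h (al : C) : nc al <= nc alpha1 + nc alpha2 -> nc (expC (al * u)) <= expR ((nc alpha1 + nc alpha2) * nc u).
    move=> hal; rewrite nc_expC ler_expR; apply: le_trans (ler_norm _) _.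
    by apply: le_trans (Re_le_nc _) _; rewrite ncM ler_wpM2r // nc_ge0.
  have h1 := h alpha1; have h2 := h alpha2.
  apply: le_trans (ncD _ _) _; rewrite !ncM mulrDl.
  apply: lerD; apply: ler_wpM2l; rewrite ?nc_ge0 //.
    by apply: h1; rewrite lerDl nc_ge0.
  by apply: h2; rewrite lerDr nc_ge0.
have [A [L [A0 L0 fA]]] := exponential_type ef fw fo K1_0 K2_0 HK feq.
have ey := (entireX 2 ef).1.
have ek := @entire_derive1n R f k ef.
have eb := (entireM (@entire_poly R a) (entire_shift beta ek).1).1.
(* This radius covers the 2 of [quad_op_le], the shift by beta and k derivatives of f. *)
have B0 : 0 < nc beta + k%:R + 3 by rewrite ltr_wpDl // addr_ge0 // nc_ge0.
have q0 : p1 * (alpha1 - alpha2) != 0 by rewrite mulf_neq0 // subr_eq0.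
have a0 := nc_ge0 (alpha1 + alpha2); have a1 := nc_ge0 (alpha1 * alpha2); have a2 := nc_ge0 alpha2.
have C1_1 : 1 <= 1 + nc (alpha1 + alpha2) + nc (alpha1 * alpha2) by lra.
have C2_1 : 1 <= 1 + nc alpha2 by lra.
have e1 := entire_derive1 ey; have e2 := entire_derive1 e1.
have e3 := (entireZ (alpha1 + alpha2) e1).1.
have e4 := (entireZ (alpha1 * alpha2) ey).1.
have eG := (entireD (entireB e2 e3).1 e4).1.
apply: (estimate_eq0 alpha1_neq0 q0 ef fw eG A0 L0 B0 C1_1 C2_1 fA f_zeros (a := a)).
move=> W Ka e r z Ka0 aK fW.
have B2 : 2 <= nc beta + k%:R + 3 by have := nc_ge0 beta; have : 0 <= (k%:R : R) by []; lra.
have yb u : nc (u - z) <= 2 -> nc (f u ^+ 2) <= expR (2 * W).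
  move=> uz; rewrite ncX; have [_ h] := fW u (le_trans uz B2).
  have -> : expR (2 * W) = expR W ^+ 2 by rewrite expr2 -expRD; congr expR; ring.
  by rewrite lerXn2r // nnegrE ?nc_ge0 ?expR_ge0.
have bb u : nc (u - z) <= 2 -> nc (a.[u] * derive1n k f (u + beta)) <= Ka * expR (e * r) * expR W.
  move=> uz; rewrite ncM; have [ur _] := fW u (le_trans uz B2).
  apply: ler_pM; [exact: nc_ge0|exact: nc_ge0|exact: aK|].
  apply: derive1n_le => // v vu; apply: (fW v _).2.
  have -> : v - z = (v - (u + beta)) + ((u - z) + beta) by ring.
  have := ncD (v - (u + beta)) ((u - z) + beta); have := ncD (u - z) beta; lra.
have [y1 y2] := quad_op_le alpha1 alpha2 ey yb; have [b1 b2] := quad_op_le alpha1 alpha2 eb bb.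
have [q1 q2] := exp_sum_ops ey eb feq z.
split; first exact: y1.
  by move: b1; rewrite -[leLHS]ncN -q1.
by rewrite q2; apply: le_trans (ncD _ _) _; exact: lerD.
Qed.

End SquareODE.

(** * Exponential solutions *)

Section ExponentialODE.
Variable R : realType.
Local Notation C := R[i].
Implicit Types (f g v y : C -> C) (z : C) (p : {poly C}).

Lemma entire_constant v : entire v -> (forall z, derive1 v z = 0) -> forall z, v z = v 0.
Proof.
move=> ev dv z; apply: segment_const => s _.
have h := @entire_cd R v (0 + rc s * (z - 0)) ev; rewrite dv in h; exact: h.
Qed.

Lemma ode1 (al : C) v : entire v -> (forall z, derive1 v z = al * v z) ->
  forall z, v z = v 0 * expC (al * z).
Proof.
move=> ev dv z; have [ee de] := entire_expC (- al).
have [eg dg] := entireM ev ee.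
have dg0 w : derive1 (fun z => v z * expC (- al * z)) w = 0.
  by rewrite dg de dv; ring.
have := entire_constant eg dg0 z; rewrite mulr0 expC0 mulr1 => <-.
by rewrite -mulrA -expCD mulNr addNr expC0 mulr1.
Qed.

Lemma quad_factor (K : comNzRingType) (a1 a2 x0 x1 x2 : K) :
  x2 - (a1 + a2) * x1 + a1 * a2 * x0 = 0 -> x2 - a2 * x1 = a1 * (x1 - a2 * x0).
Proof. by move=> h; apply/eqP; rewrite -subr_eq0 -h; apply/eqP; ring. Qed.

(** The function y' - a2 y solves v' = a1 v, so it is v0 e^(a1 z); subtracting the particular
    solution v0/(a1 - a2) e^(a1 z) from y leaves a solution of u' = a2 u. *)
Lemma ode2 (a1 a2 : C) y : entire y -> a1 != a2 -> (forall z, quad_op a1 a2 y z = 0) ->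
  exists A B, forall z, y z = A * expC (a1 * z) + B * expC (a2 * z).
Proof.
move=> ey a12 op0; have a12' : a1 - a2 != 0 by rewrite subr_eq0.
have e1 := entire_derive1 ey; have [e2 d2] := entireZ a2 ey.
have [ev dv] := entireB e1 e2.
have vE := ode1 ev (al := a1).
have {}vE z : derive1 y z - a2 * y z = (derive1 y 0 - a2 * y 0) * expC (a1 * z).
  apply: vE => w; rewrite dv d2; exact: (quad_factor (op0 w)).
have [v0 {}vE] : exists v0 : C, forall z : C, derive1 y z - a2 * y z = v0 * expC (a1 * z).
  by exists (derive1 y 0 - a2 * y 0).
have [e3 d3] := entire_expC a1; have [e4 d4] := entireZ (v0 / (a1 - a2)) e3.
have [eu du] := entireB ey e4.
exists (v0 / (a1 - a2)), (y 0 - v0 / (a1 - a2) * expC (a1 * 0)) => z.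
rewrite -(ode1 eu (al := a2)); first by rewrite addrC subrK.
move=> w; rewrite du d4 d3.
have -> : derive1 y w = v0 * expC (a1 * w) + a2 * y w by rewrite -vE subrK.
by field.
Qed.

(* A zero of f is a double zero of f^2, but A e^{a1 z} + B e^{a2 z} only has simple zeros. *)
Lemma square_exp_sum f (A B a1 a2 : C) : entire f -> a1 != a2 ->
  (forall z, f z ^+ 2 = A * expC (a1 * z) + B * expC (a2 * z)) -> A = 0 \/ B = 0.
Proof.
move=> ef a12 fE; have [A0|A0] := eqVneq A 0; first by left.
have [B0|B0] := eqVneq B 0; first by right.
exfalso.
have a12' : a1 - a2 != 0 by rewrite subr_eq0.
have [c cE] : exists c, expC c = - (B / A) by apply: expC_surj; rewrite oppr_eq0 mulf_neq0 ?invr_eq0.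
pose z0 := c / (a1 - a2).
have z0E : A * expC (a1 * z0) + B * expC (a2 * z0) = 0.
  have -> : a1 * z0 = c + a2 * z0 by rewrite /z0; field.
  by rewrite expCD cE; field.
have f0 : f z0 = 0 by apply/eqP; rewrite -sqrf_eq0 fE z0E.
have [e1 d1] := entire_expC a1; have [e2 d2] := entire_expC a2.
have [e3 d3] := entireZ A e1; have [e4 d4] := entireZ B e2.
have := (entireX 2 ef).2; have -> : (fun z => f z ^+ 2) = fun z => A * expC (a1 * z) + B * expC (a2 * z).
  by apply/funext.
rewrite (entireD e3 e4).2 d3 d4 d1 d2 => /(congr1 (fun F : C -> C => F z0)).
rewrite /= f0 expr1 mulr0 mul0r => dE.
have : A * (a1 - a2) * expC (a1 * z0) = 0.
  transitivity ((A * (a1 * expC (a1 * z0)) + B * (a2 * expC (a2 * z0))) - a2 * (A * expC (a1 * z0) + B * expC (a2 * z0))); first by ring.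
  by rewrite dE z0E mulr0 subr0.
by apply/eqP; rewrite !mulf_neq0 // expC_neq0.
Qed.

(** The square of g = f e^(-al z/2) is the constant A, so 2 g g' = 0 with g nowhere zero, and g is
    constant. *)
Lemma sqrt_exp f (A al : C) : entire f -> A != 0 ->
  (forall z, f z ^+ 2 = A * expC (al * z)) ->
  exists2 c, c ^+ 2 = A & forall z, f z = c * expC (al / 2 * z).
Proof.
move=> ef A0 fE; have [ee _] := entire_expC (- (al / 2)).
have [eg _] := entireM ef ee; pose g z := f z * expC (- (al / 2) * z).
have g2 z : g z ^+ 2 = A.
  rewrite /g exprMn fE expr2 -expCD -mulrA -expCD.
  have -> : al * z + (- (al / 2) * z + - (al / 2) * z) = 0 by field.
  by rewrite expC0 mulr1.
have g0 z : g z != 0 by rewrite -sqrf_eq0 g2.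
have dg z : derive1 g z = 0.
  have := (entireX 2 eg).2.
  have -> : (fun z => (f z * expC (- (al / 2) * z)) ^+ 2) = fun=> A by apply/funext => w; exact: g2.
  rewrite (entire_cst A).2 => /(congr1 (fun F : C -> C => F z)) /= /esym /eqP.
  by rewrite expr1 mulf_eq0 mulf_eq0 pnatr_eq0 (negbTE (g0 z)) /= => /eqP.
exists (g 0); first exact: g2.
move=> z; have gz : g z = g 0 := entire_constant eg dg z.
by rewrite -gz /g -mulrA -expCD mulNr addNr expC0 mulr1.
Qed.

Lemma derive1n_cexp (c g : C) n : derive1n n (fun z => c * expC (g * z)) = fun z => c * g ^+ n * expC (g * z).
Proof.
elim: n => [|n IH]; first by apply/funext => z; rewrite expr0 mulr1.
have [e1 d1] := entire_expC g; have [_ d2] := entireZ (c * g ^+ n) e1.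
by rewrite derive1nS IH d2 d1; apply/funext => z; rewrite exprSr; ring.
Qed.

Lemma derive1_poly p : derive1 (fun z => p.[z]) = fun z => (p^`()).[z].
Proof.
elim/poly_ind: p => [|p c IH].
  rewrite deriv0; have -> : (fun z => (0 : {poly C}).[z]) = fun=> 0 by apply/funext => z; rewrite horner0.
  by rewrite (entire_cst 0).2.
have e1 := @entire_poly R p; have [e2 d2] := entire_id R.
have [e3 d3] := entireM e1 e2; have [e4 d4] := entire_cst c.
have -> : (fun z => (p * 'X + c%:P).[z]) = fun z => p.[z] * z + c.
  by apply/funext => z; rewrite hornerMXaddC.
rewrite (entireD e3 e4).2 d3 d4 d2 IH; apply/funext => z.
by rewrite derivMXaddC hornerD hornerMX mulr1 addr0 addrC.
Qed.

Lemma horner_const p (c : C) : (forall z, p.[z] = c) -> p = c%:P.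
Proof.
move=> pc; apply/eqP; rewrite -subr_eq0; apply/eqP.
pose rs : seq C := [seq n%:R | n <- iota 0 (size (p - c%:P))].
apply: (@roots_geq_poly_eq0 _ _ rs).
- by apply/allP => x _; rewrite rootE hornerD hornerN hornerC pc subrr.
- rewrite map_inj_uniq ?iota_uniq // => m n /eqP; rewrite eqr_nat => /eqP; exact.
- by rewrite size_map size_iota.
Qed.

(* Differentiating [size p] times kills the polynomial. *)
Lemma exp_poly_indep (A B g d : C) p : g != d -> g != 0 -> B != 0 ->
  (forall z, A * expC (g * z) + p.[z] = B * expC (d * z)) ->
  [/\ A = 0, d = 0 & p = B%:P].
Proof.
move=> gd g0 B0 h.
have hn n : forall z, A * g ^+ n * expC (g * z) + (p^`(n)).[z] = B * d ^+ n * expC (d * z).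
  elim: n => [|n IH] z; first by rewrite !expr0 !mulr1 derivn0.
  have [e1 d1] := entire_expC g; have [e2 d2] := entire_expC d.
  have [e3 d3] := entireZ (A * g ^+ n) e1; have [e4 d4] := entireZ (B * d ^+ n) e2.
  have e5 := @entire_poly R (p^`(n)).
  have E := funext IH; have := (entireD e3 e5).2; rewrite E d4 d3 d1 d2 derive1_poly.
  move=> /(congr1 (fun F : C -> C => F z)) /= E2.
  rewrite !exprSr.
  transitivity (A * g ^+ n * (g * expC (g * z)) + (p^`(n)^`()).[z]); first by ring.
  by rewrite -E2; ring.
pose n := size p.
(* Two consecutive orders at z = 0 give A g^n = B d^n and A g^(n+1) = B d^(n+1), hence B d^n (g - d)
   = 0. *)
have h0 := hn n 0; have h1 := hn n.+1 0.
rewrite !derivn_poly0 /n ?leqnSn // in h0 h1.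
rewrite !mulr0 expC0 !mulr1 horner0 !addr0 in h0 h1.
rewrite !exprSr !mulrA h0 -/n in h1.
have Bd : B * d ^+ n = 0.
  have : B * d ^+ n * (g - d) = 0 by rewrite mulrBr h1 subrr.
  by move/eqP; rewrite mulf_eq0 subr_eq0 (negbTE gd) orbF => /eqP.
have d0 : d = 0.
  by move/eqP: Bd; rewrite mulf_eq0 (negbTE B0) expf_eq0 => /andP[_ /eqP].
have A0 : A = 0.
  by move/eqP: h0; rewrite -/n Bd mulf_eq0 expf_eq0 (negbTE g0) andbF orbF => /eqP.
split=> //; apply: horner_const => z.
by have := h z; rewrite A0 d0 !mul0r add0r expC0 mulr1.
Qed.

(** With g = a1/2 and f = c e^(g z), dividing the equation by e^(g z) leaves (A - p1) e^(g z) + K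
    a(z) = p2 e^((a2 - g) z), where K = c g^k e^(g beta). Independence then gives A = p1, a2 = g and
    a = p2/K. The other case is the same with the indices exchanged. *)
Lemma one_exponential (p1 p2 a1 a2 be A : C) (a : {poly C}) k f : entire f ->
  p2 != 0 -> a1 != 0 -> a1 != a2 -> A != 0 ->
  (forall z, f z ^+ 2 + a.[z] * derive1n k f (z + be) = p1 * expC (a1 * z) + p2 * expC (a2 * z)) ->
  (forall z, f z ^+ 2 = A * expC (a1 * z)) ->
  exists a0 : C, a = a0%:P /\ exists c, [/\ c ^+ 2 = p1, (forall z, f z = c * expC (a1 * z / 2)),
    a0 * c * (a1 / 2) ^+ k * expC (a1 * be / 2) = p2 & a1 = 2 * a2].
Proof.
move=> ef p20 a10 a12 A0 feq f2.
have [c cA fE] := sqrt_exp ef A0 f2.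
have c0 : c != 0 by rewrite -sqrf_eq0 cA.
have g0 : a1 / 2 != 0 by rewrite mulf_neq0 // invr_eq0 pnatr_eq0.
set g := a1 / 2 in fE g0.
have ag : a1 = g + g by rewrite /g; field.
have gd : g != a2 - g by rewrite eq_sym subr_eq -ag eq_sym.
pose K := c * g ^+ k * expC (g * be).
have K0 : K != 0 by rewrite !mulf_neq0 ?expf_neq0 ?expC_neq0.
have h z : (A - p1) * expC (g * z) + (K *: a).[z] = p2 * expC ((a2 - g) * z).
  have := feq z; rewrite f2; have -> : f = fun z => c * expC (g * z) by exact/funext.
  rewrite derive1n_cexp mulrDr expCD => E.
  have e1 : expC (a1 * z) = expC (g * z) * expC (g * z) by rewrite -expCD -mulrDl -ag.
  have e2 : expC (a2 * z) = expC ((a2 - g) * z) * expC (g * z) by rewrite -expCD -mulrDl subrK.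
  apply: (mulIf (expC_neq0 (g * z))); rewrite hornerZ -[RHS]mulrA -e2.
  transitivity (A * expC (a1 * z) + a.[z] * (c * g ^+ k * (expC (g * z) * expC (g * be))) - p1 * expC (a1 * z)).
    by rewrite e1 /K; ring.
  by rewrite E; ring.
have [Ap d0 ap] := exp_poly_indep gd g0 p20 h.
exists (p2 / K); split.
  by rewrite -[a]scale1r -(mulVf K0) -scalerA ap -mul_polyC -polyCM mulrC.
exists c; split.
- by apply/eqP; rewrite cA -subr_eq0 Ap.
- by move=> z; rewrite fE /g mulrAC.
- have -> : a1 * be / 2 = g * be by rewrite /g mulrAC.
  by rewrite -[RHS](divfK K0) /K !mulrA.
- by rewrite mulr_natl mulr2n {1}ag; move/eqP: d0; rewrite subr_eq0 => /eqP ->.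
Qed.

End ExponentialODE.

(** * The order of an exponential function *)

Section ExponentialGrowth.
Variable R : realType.
Local Notation C := R[i].

(** Since log T(r) differs from log r by at most |log m| + |log M|, the quotient is within e of 1 as
    soon as e log r exceeds this constant. *)
Lemma linear_growth_order (T : R -> R) (m M r1 : R) : 0 < m -> 1 <= M ->
  (forall r, r1 < r -> m * r <= T r <= M * r) ->
  limf_esup (fun r => (log_plus (T r) / ln r)%:E) (pinfty_nbhs R) = 1%:E.
Proof.
move=> m0 M1 Tb.
have M0 : 0 < M by exact: lt_le_trans M1.
have key e : 0 < e -> exists X, forall r, X < r -> 1 - e <= log_plus (T r) / ln r <= 1 + e.
  move=> e0; pose K := `|ln m| + `|ln M|.
  exists (Num.max r1 (Num.max 1 (expR (K / e)))) => r; rewrite !gt_max => /and3P[r1r r_1 rK].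
  have r0 : 0 < r by exact: lt_trans r_1.
  have lr : 0 < ln r by rewrite ln_gt0.
  have Kl : K <= e * ln r.
    by rewrite mulrC -ler_pdivrMr // -[K / e]expRK ler_ln ?posrE ?expR_gt0 // ltW.
  have /andP[T1 T2] := Tb r r1r.
  have lm : - ln m <= `|ln m| by rewrite -normrN ler_norm.
  have lM : ln M <= `|ln M| by rewrite ler_norm.
  have nm := normr_ge0 (ln m); have nM := normr_ge0 (ln M).
  have mr0 : 0 < m * r by rewrite mulr_gt0.
  have Mr0 : 0 < M * r by rewrite mulr_gt0.
  have low : ln m + ln r <= log_plus (T r).
    rewrite -lnM ?posrE //; apply: (@le_trans _ _ (ln (T r))); last by rewrite /log_plus le_max lexx orbT.
    by rewrite ler_ln ?posrE // (lt_le_trans mr0).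
  have up : log_plus (T r) <= ln M + ln r.
    rewrite -lnM ?posrE //; apply: log_plus_le; last by rewrite lnK.
    by rewrite ln_ge0 // mulr_ege1 // ltW.
  rewrite ler_pdivlMr // ler_pdivrMr // !mulrDl !mul1r mulNr; apply/andP; split; rewrite /K in Kl; lra.
rewrite /limf_esup; apply/eqP; rewrite eq_le; apply/andP; split.
  apply/lee_addgt0Pr => e e0; have [X XP] := key e e0.
  have XV : pinfty_nbhs R [set r | X < r] by exists X; split=> //; exact: num_real.
  apply: le_trans (ereal_inf_lbound (ex_intro2 _ _ _ XV erefl)) _.
  apply: ge_ereal_sup => _ [r Xr <-]; rewrite -EFinD lee_fin.
  by have /andP[] := XP r Xr.
apply: le_ereal_inf_tmp => _ [V [N [_ NV]] <-]; apply/lee_addgt0Pr => e e0; have [X XP] := key e e0.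
pose r := Num.max N X + 1.
have /andP[Nr Xr] : (N < r) && (X < r) by rewrite -gt_max ltrDl.
have /andP[h _] := XP r Xr.
apply: (@le_trans _ _ ((log_plus (T r) / ln r)%:E + e%:E)%E).
  by rewrite -EFinD lee_fin -lerBlDr.
by rewrite leeD2r //; apply: ereal_sup_ubound; exists r => //; exact: NV.
Qed.

Lemma growth_order_exp (f : C -> C) (c g : C) : c != 0 -> g != 0 ->
  (forall z, f z = c * expC (g * z)) -> growth_order f = 1%:E.
Proof.
move=> c0 g0 fE.
have ef : entire f.
  by have [e1 _] := entire_expC g; have [e2 _] := entireZ c e1; rewrite (funext fE).
have ng : 0 < nc g by rewrite nc_gt0.
have lnf z : nc (f z) = expR (ln (nc c) + complex.Re (g * z)).
  by rewrite fE ncM nc_expC expRD lnK // posrE nc_gt0.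
set K := ln (nc c) in lnf; have K0 := normr_ge0 K.
have KN : - K <= `|K| by rewrite -normrN ler_norm.
have KP : K <= `|K| by rewrite ler_norm.
(* The mean of the positive part of Re(g z) is at least |g| r/4; the constant log |c| costs at most
   half of it once r > 8 |K|/|g|, which leaves |g| r/8. *)
rewrite /growth_order; apply: (@linear_growth_order _ (nc g / 8) (nc g + 1) (Num.max 1 (Num.max `|K| (8 * `|K| / nc g)))).
- by rewrite divr_gt0.
- by rewrite lerDr ltW.
move=> r; rewrite !gt_max => /and3P[r1 rK rg]; rewrite characteristic_funE //.
have r0 : 0 < r by exact: lt_trans r1.
rewrite ltr_pdivrMr // in rg.
have gr0 : 0 < nc g * r by rewrite mulr_gt0.
apply/andP; split; last first.
  apply: Tch_le => // [|t]; first by rewrite mulr_ge0 ?(ltW r0) // addr_ge0 // ltW.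
  rewrite lnf ler_expR mulrDl mul1r addrC.
  apply: lerD; last exact: le_trans KP (ltW rK).
  apply: le_trans (ler_norm _) _; apply: le_trans (Re_le_nc _) _.
  by rewrite ncM (nc_circ _ (ltW r0)).
have cRe : continuous (fun t => Num.max 0 (complex.Re (g * circ r t))).
  by apply: cts_max0; apply: ctsRe; apply: ctsCM; [exact: ctsC_cst|exact: cts_circ].
have clp : continuous (fun t => log_plus (nc (f (circ r t)))) := cts_log_plus_circ ef.
have low t : Num.max 0 (complex.Re (g * circ r t)) <= log_plus (nc (f (circ r t))) + `|K|.
  rewrite lnf /log_plus expRK; move: (complex.Re _) => x.
  rewrite ge_max; apply/andP; split; first by rewrite addr_ge0 // le_max lexx.
  rewrite -lerBlDr; apply: (@le_trans _ _ (K + x)); first lra.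
  by rewrite le_max lexx orbT.
have := mean_le cRe (ctsRD clp (@ctsR_cst R `|K|)) low.
rewrite (meanD clp (@ctsR_cst R `|K|)) mean_cst -/(Tch f r).
have := mean_max0_Re g r0; rewrite mulrAC; lra.
Qed.

End ExponentialGrowth.

Theorem corollary1 (R : realType) (p1 p2 alpha1 alpha2 beta : R[i])
  (a : {poly R[i]}) (k : nat) (f : R[i] -> R[i])
  (p1_neq0 : p1 != 0) (p2_neq0 : p2 != 0)
  (alpha1_neq0 : alpha1 != 0) (alpha2_neq0 : alpha2 != 0)
  (alpha_neq : alpha1 != alpha2) (a_neq0 : a != 0)
  (f_trans : transcendental_entire f)
  (f_finite_order : (growth_order f < +oo)%E)
  (f_eq : forall z : R[i], f z ^+ 2 + a.[z] * derive1n k f (z + beta) =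
            p1 * expC (alpha1 * z) + p2 * expC (alpha2 * z))
  (f_zeros : small_wrt (fun r : R => counting_fun r (fun z => (f z)^-1)) f) :
  growth_order f = 1%:E /\
  exists a0 : R[i], a = a0%:P /\
    ((exists c1 : R[i], [/\ c1 ^+ 2 = p1,
        (forall z : R[i], f z = c1 * expC (alpha1 * z / 2)),
        a0 * c1 * (alpha1 / 2) ^+ k * expC (alpha1 * beta / 2) = p2 &
        alpha1 = 2 * alpha2])
     \/
     (exists c2 : R[i], [/\ c2 ^+ 2 = p2,
        (forall z : R[i], f z = c2 * expC (alpha2 * z / 2)),
        a0 * c2 * (alpha2 / 2) ^+ k * expC (alpha2 * beta / 2) = p1 &
        alpha2 = 2 * alpha1])).
Proof.
have [ef f_npoly] := f_trans.
have fw : exists w, f w != 0.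
  apply: contrapT => fN; apply: f_npoly; exists 0 => z; rewrite horner0.
  by apply/eqP; apply/negPn/negP => fz; apply: fN; exists z.
have op0 := square_ode p1_neq0 alpha1_neq0 alpha_neq ef fw f_finite_order f_eq f_zeros.
have [A [B f2]] := ode2 (entireX 2 ef).1 alpha_neq op0.
have order1 c al : c ^+ 2 != 0 -> al != 0 -> (forall z, f z = c * expC (al * z / 2)) -> growth_order f = 1%:E.
  move=> c0 al0 fE; apply: (@growth_order_exp _ _ c (al / 2)).
  - by rewrite -sqrf_eq0.
  - by rewrite mulf_neq0 // invr_eq0 pnatr_eq0.
  - by move=> z; rewrite fE mulrAC.
have [w fw0] := fw.
have [A0|B0] := square_exp_sum ef alpha_neq f2.
  have f2' z : f z ^+ 2 = B * expC (alpha2 * z) by rewrite f2 A0 mul0r add0r.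
  have B0 : B != 0 by apply: contraNneq fw0 => B0; rewrite -sqrf_eq0 f2' B0 mul0r.
  have f_eq' z : f z ^+ 2 + a.[z] * derive1n k f (z + beta) = p2 * expC (alpha2 * z) + p1 * expC (alpha1 * z).
    by rewrite f_eq addrC.
  have alpha_neq' : alpha2 != alpha1 by rewrite eq_sym.
  have [a0 [aE [c [c2 fE h1 h2]]]] := one_exponential ef p1_neq0 alpha2_neq0 alpha_neq' B0 f_eq' f2'.
  split; first by apply: (order1 c alpha2) => //; rewrite c2.
  by exists a0; split=> //; right; exists c.
have f2' z : f z ^+ 2 = A * expC (alpha1 * z) by rewrite f2 B0 mul0r addr0.
have A0 : A != 0 by apply: contraNneq fw0 => A0; rewrite -sqrf_eq0 f2' A0 mul0r.
have [a0 [aE [c [c2 fE h1 h2]]]] := one_exponential ef p2_neq0 alpha1_neq0 alpha_neq A0 f_eq f2'.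
split; first by apply: (order1 c alpha1) => //; rewrite c2.
by exists a0; split=> //; left; exists c.
Qed.
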